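(* Let $\Phi_t:\Omega_0\to\Omega_0$ be a finite horizon (two-dimensional) billiard flow associated to finitely many scatterers $B_i$ with $C^3$ boundaries of positive curvature and such that the closures $\overline{B_i}$ are pairwise disjoint, and let $\upsilon_{Do}>0$ be the constant described in the context. Then for any $\kappa\in(0,1)$ there exist $0<\upsilon_{corr}(\kappa)<\upsilon_{Do}$ and $C_{corr}(\kappa)>0$ such that for any $\psi,f\in C^\kappa(\Omega_0)$ $$ \left|\int(\psi\circ\Phi_t)\,f\,dm-\int\psi\,dm\cdot\int f\,dm\right|\le C_{corr}(\kappa)\,|\psi|_{C^\kappa(\Omega_0)}\,|f|_{C^\kappa(\Omega_0)}\,e^{-\upsilon_{corr}(\kappa)t}\qquad\forall t\ge0 . $$
   Context: Billiard setting. Let $B_1,\dots,B_d$ be open convex subsets of $\mathbb{T}^2=\mathbb{R}^2/\mathbb{Z}^2$ with pairwise disjoint closures, whose boundaries $\Gamma_i=\partial B_i$ are $C^3$ curves of strictly positive curvature. Put $Q=\mathbb{T}^2\setminus\bigcup_i B_i$ and $\Omega_0=\{(x,y,\omega):(x,y)\in Q,\ \omega\in\mathbb{S}^1\}\subset\mathbb{T}^3$. The billiard flow $\Phi_t$ on $\Omega_0$ moves $(x,y)$ in $Q$ with unit velocity $(\cos\omega,\sin\omega)$ and reflects the velocity elastically at $\partial Q$. Write $Z\sim Y$ if $Z,Y$ are the ingoing and outgoing velocity vectors of the same collision; $\Phi_t$ is well defined on $\Omega=\Omega_0/\!\sim$. $C^0(\Omega)$ is the set of $f\in C^0(\Omega_0)$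 with $f(Z)=f(Y)$ whenever $Z\sim Y$. Finite horizon means that the time $\tau(Z)$ of the first collision of $Z$ with a scatterer satisfies $\tau(Z)\le\tau_{\max}<\infty$ for all $Z\in\Omega_0$. The flow preserves $m=(2\pi|Q|)^{-1}dx\,dy\,d\omega$. $C^\ell(\Omega_0)$ ($\ell$ integer) is understood in the sense of Whitney on $\Omega_0\subset\mathbb{T}^3$ with its usual norm. For $\kappa\in(0,1)$, $|f|_{C^\kappa(\Omega_0)}=\sup_{x\in\Omega_0}|f(x)|+\sup_{x\ne y\in\Omega_0}\frac{|f(x)-f(y)|}{d(x,y)^\kappa}$, where $d$ is the distance on $\Omega_0$ induced by $\mathbb{T}^3$. The constant $\upsilon_{Do}>0$ is one for which the following holds: there are a finite dimensional space $F\subset(C^1(\Omega_0))^*$, a bounded operator $\Pi:C^2(\Omega_0)\cap C^0(\Omega)\to F$, a linear map $\widehat X:F\to F$ with $\mathrm{sp}(\widehat X)\subset\{-\upsilon_{Do}<\Re z<0\}\cup\{0\}$, with $0$ a simple eigenvalue whose contribution to $\Pi f$ is $\int f\,dm$, and for any $\upsilon_1<\upsilon_{Do}$ a constant $C_1>0$ such that $|\int(\psi\circ\Phi_t)f\,dm-\int\psi\,e^{\widehat Xt}\Pi f\,dm|\le C_1|f|_{C^2(\Omega_0)}|\psi|_{C^1(\Omega_0)}e^{-\upsilon_1t}$ for all $t\ge0$, $\psi\in C^1(\Omega_0)$, $f\in C^2(\Omega_0)\cap C^0(\Omega)$. *)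

(* Defs.v *)
From HB Require Import structures.
From mathcomp Require Import all_boot all_order all_algebra.
From mathcomp Require Import all_classical all_reals all_analysis.
From mathcomp Require Import complex.

Set Implicit Arguments.
Unset Strict Implicit.
Unset Printing Implicit Defensive.

Import Order.TTheory GRing.Theory Num.Theory.
Import numFieldNormedType.Exports ComplexField.Normc.

Local Open Scope classical_set_scope.
Local Open Scope complex_scope.
Local Open Scope ring_scope.

(* The tori T^2 = R^2/Z^2 and T^3 = R^2/Z^2 x R/(2 pi Z) are handled through
   their universal covers: subsets of a torus are lattice-invariant subsets of
   the cover, functions on a torus are lattice-periodic functions, and integrals
   are taken over the fundamental domain [0,1[ x [0,1[ x [0,2 pi[.
   A point of phase space is Z = ((x, y), w). *)
Notation plane R := (R * R)%type.
Notation phase R := (R * R * R)%type.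

Section Torus.
Context {R : realType}.
Implicit Types (q : plane R) (Z : phase R).

Definition shift2 (n m : int) q : plane R := (q.1 + n%:~R, q.2 + m%:~R).

Definition shift3 (n m k : int) Z : phase R :=
  (shift2 n m Z.1, Z.2 + k%:~R * (2 * pi)).

Definition eucl_dist Z Z' : R :=
  Num.sqrt ((Z.1.1 - Z'.1.1) ^+ 2 + (Z.1.2 - Z'.1.2) ^+ 2 + (Z.2 - Z'.2) ^+ 2).

Definition tdist Z Z' : R :=
  inf [set r | exists n m k : int, r = eucl_dist Z (shift3 n m k Z')].

Definition same_point Z Z' := exists n m k : int, Z = shift3 n m k Z'.

Definition fundamental2 : set (plane R) :=
  [set q | (0 <= q.1 < 1) /\ (0 <= q.2 < 1)].

Definition fundamental3 : set (phase R) :=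
  [set Z | fundamental2 Z.1 /\ (0 <= Z.2 < 2 * pi)].

End Torus.

Section Scatterers.
Context {R : realType}.

Definition C3 (h : R -> R) :=
  (forall k s, (k < 3)%N -> derivable (derive1n k h) s 1) /\ continuous (derive1n 3 h).

Section Curve.
Variable g : R -> plane R.
Let x s := (g s).1.
Let y s := (g s).2.

Definition curvature (s : R) : R :=
  (derive1n 1 x s * derive1n 2 y s - derive1n 1 y s * derive1n 2 x s)
    / Num.sqrt (derive1n 1 x s ^+ 2 + derive1n 1 y s ^+ 2) ^+ 3.

(* Since 1/0 = 0, the condition [0 < curvature s] also makes the
   parametrization regular; with the sign chosen here the curve runs
   counterclockwise around the convex set it bounds. *)
Definition convex_C3_loop :=
  [/\ C3 x, C3 y,
      exists2 L : R, 0 < L &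
        (forall s, g (s + L) = g s) /\
        (forall s t, 0 <= s < L -> 0 <= t < L -> g s = g t -> s = t)
    & forall s, 0 < curvature s].
End Curve.

Variables (d : nat) (B : 'I_d -> set (plane R)) (gam : 'I_d -> R -> plane R).

(* [B i] is one lift of the i-th scatterer and [gam i] a parametrization of its
   boundary; all the lifts of the scatterer are the translates of [B i] by Z^2.
   The last clause says both that the closure of [B i] projects injectively to
   T^2 and that the closures of distinct scatterers are disjoint in T^2. *)
Definition billiard_table :=
  [/\ forall i, open (B i) /\ convex_set (B i),
      forall i, convex_C3_loop (gam i),
      forall i, range (gam i) = closure (B i) `\` B i
    & forall i j (n m : int) q, closure (B i) q ->
        closure (B j) (shift2 n m q) -> [/\ i = j, n = 0 & m = 0]].

Definition in_scatterer : set (plane R) :=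
  [set q | exists i (n m : int), B i (shift2 n m q)].

Definition in_closed_scatterer : set (plane R) :=
  [set q | exists i (n m : int), closure (B i) (shift2 n m q)].

Definition Q : set (plane R) := ~` in_scatterer.

Definition Omega0 : set (phase R) := [set Z | Q Z.1].

(* Elastic law at a boundary point q, for velocities of angles w and w': the
   tangential component is kept and the normal one is reversed. *)
Definition elastic (q : plane R) (w w' : R) :=
  exists i (n m : int) s,
    let tx := derive1 (fun u => (gam i u).1) s in
    let ty := derive1 (fun u => (gam i u).2) s in
    [/\ q = shift2 n m (gam i s),
        cos w' * tx + sin w' * ty = cos w * tx + sin w * ty
      & cos w' * ty - sin w' * tx = - (cos w * ty - sin w * tx)].

Definition outgoing (q : plane R) (w : R) : R :=
  xget 0 [set w' | (0 <= w' < 2 * pi) /\ elastic q w w'].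

Definition free_flight (t : R) (Z : phase R) : phase R :=
  (Z.1.1 + t * cos Z.2, Z.1.2 + t * sin Z.2, Z.2).

(* Time of the first collision. It is 0 when Z lies on the boundary with
   ingoing velocity, and it ignores the contact at time 0 when the velocity is
   outgoing or tangent. Tangential contacts count as collisions; they leave the
   velocity unchanged. *)
Definition tau (Z : phase R) : \bar R :=
  ereal_inf [set t%:E | t in
    [set t : R | 0 < t /\ in_closed_scatterer (free_flight t Z).1]].

Definition finite_horizon :=
  exists tmax : R, forall Z, Omega0 Z -> (tau Z <= tmax%:E)%E.

Definition collide (Z : phase R) : phase R :=
  let Y := free_flight (fine (tau Z)) Z in (Y.1, outgoing Y.1 Y.2).

Definition collision_time (Z : phase R) (k : nat) : R :=
  \sum_(j < k) fine (tau (iter j collide Z)).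

(* The billiard flow on the cover; at a collision time the outgoing velocity is
   taken. *)
Definition flow (t : R) (Z : phase R) : phase R :=
  let k := xget 0%N
    [set k | collision_time Z k <= t < collision_time Z k.+1] in
  free_flight (t - collision_time Z k) (iter k collide Z).

Definition area : R :=
  fine ((@lebesgue_measure R \x @lebesgue_measure R)%E (Q `&` fundamental2)).

Definition integral_m_real (h : phase R -> R) : R :=
  (2 * pi * area)^-1 *
  \int[((@lebesgue_measure R \x @lebesgue_measure R)
          \x @lebesgue_measure R)%E]_(Z in Omega0 `&` fundamental3) h Z.

(* Observables are complex valued. *)
Definition integral_m (h : phase R -> R[i]) : R[i] :=
  integral_m_real (fun Z => complex.Re (h Z))
    +i* integral_m_real (fun Z => complex.Im (h Z)).

Definition torus_periodic (h : phase R -> R[i]) :=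
  forall (n m k : int) Z, Omega0 Z -> h (shift3 n m k Z) = h Z.

Definition holder_norm (kappa : R) (h : phase R -> R[i]) : \bar R :=
  (ereal_sup [set (normc (h Z))%:E | Z in Omega0] +
   ereal_sup [set r | exists Z Z',
     [/\ Omega0 Z, Omega0 Z', ~ same_point Z Z' &
         r = (normc (h Z - h Z') / tdist Z Z' `^ kappa)%:E]])%E.

Definition holder (kappa : R) (h : phase R -> R[i]) :=
  torus_periodic h /\ (holder_norm kappa h < +oo)%E.

(* Whitney jets of order l on Omega0: [J a b c] plays the role of the partial
   derivative of order (a, b, c) in (x, y, w), for a + b + c <= l, and
   [taylor_rem] is x |-> J_alpha(x) - T_y(x), T_y being the Taylor polynomial
   of order l - |alpha| at y built from J. *)
Definition taylor_rem (l : nat) (J : nat -> nat -> nat -> phase R -> R[i])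
    (a b c : nat) (X Y : phase R) : R[i] :=
  J a b c X -
  \sum_(a' < l.+1) \sum_(b' < l.+1)
    \sum_(c' < l.+1 | (a + b + c + (a' + b' + c') <= l)%N)
      ((X.1.1 - Y.1.1) ^+ a' * (X.1.2 - Y.1.2) ^+ b' * (X.2 - Y.2) ^+ c'
         / (a'`! * b'`! * c'`!)%:R)%:C * J (a + a')%N (b + b')%N (c + c')%N Y.

Definition whitney_jet (l : nat) (h : phase R -> R[i])
    (J : nat -> nat -> nat -> phase R -> R[i]) :=
  [/\ forall Z, Omega0 Z -> J 0%N 0%N 0%N Z = h Z,
      forall a b c, (a + b + c <= l)%N -> torus_periodic (J a b c)
    & forall a b c, (a + b + c <= l)%N -> forall e : R, 0 < e ->
        exists2 delta : R, 0 < delta & forall X Y, Omega0 X -> Omega0 Y ->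
          eucl_dist X Y < delta ->
          normc (taylor_rem l J a b c X Y) <= e * eucl_dist X Y ^+ (l - (a + b + c))].

Definition jet_norm (l : nat) (J : nat -> nat -> nat -> phase R -> R[i])
    : \bar R :=
  (ereal_sup [set r | exists a b c Z,
     [/\ (a + b + c <= l)%N, Omega0 Z & r = (normc (J a b c Z))%:E]] +
   ereal_sup [set r | exists a b c X Y,
     [/\ (a + b + c <= l)%N, Omega0 X, Omega0 Y, X <> Y &
         r = (normc (taylor_rem l J a b c X Y)
                / eucl_dist X Y ^+ (l - (a + b + c)))%:E]])%E.

Definition Cl (l : nat) (h : phase R -> R[i]) := exists J, whitney_jet l h J.

(* The jet of h on Omega0 is in fact unique, Omega0 being the closure of its
   interior; the infimum avoids having to choose it. *)
Definition Cl_norm (l : nat) (h : phase R -> R[i]) : \bar R :=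
  ereal_inf [set jet_norm l J | J in whitney_jet l h].

Definition C0_Omega (h : phase R -> R[i]) :=
  [/\ torus_periodic h,
      {within Omega0, continuous (fun Z => complex.Re (h Z))},
      {within Omega0, continuous (fun Z => complex.Im (h Z))}
    & forall q w w', Q q -> elastic q w w' -> h (q, w) = h (q, w')].

Definition expmx (N : nat) (A : 'M[R[i]]_N) : 'M[R[i]]_N :=
  let S n := \sum_(k < n) (k`!%:R)^-1 *: A ^+ k in
  \matrix_(i, j) (limn (fun n => complex.Re (S n i j))
                    +i* limn (fun n => complex.Im (S n i j))).

(* A finite dimensional space F of functionals on C^1(Omega0) is given by a
   basis phi; the row vector u stands for the element \sum_i u_i phi_i of F, and
   linear maps F -> F are matrices acting on row vectors on the right. *)
Definition pairing (N : nat) (phi : 'I_N -> (phase R -> R[i]) -> R[i])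
    (u : 'rV[R[i]]_N) (psi : phase R -> R[i]) : R[i] :=
  \sum_i u 0 i * phi i psi.

Definition basis_in_dual_C1 (N : nat)
    (phi : 'I_N -> (phase R -> R[i]) -> R[i]) :=
  [/\ forall i (a : R[i]) psi1 psi2, Cl 1 psi1 -> Cl 1 psi2 ->
        phi i (fun Z => a * psi1 Z + psi2 Z) = a * phi i psi1 + phi i psi2,
      forall i, exists K : R, forall psi, Cl 1 psi ->
        normc (phi i psi) <= K * fine (Cl_norm 1 psi)
    & forall u, (forall psi, Cl 1 psi -> pairing phi u psi = 0) -> u = 0].

(* Boundedness of Pi is expressed with the norm of (C^1)^* on F. *)
Definition bounded_into_dual (N : nat)
    (phi : 'I_N -> (phase R -> R[i]) -> R[i])
    (Pi : (phase R -> R[i]) -> 'rV[R[i]]_N) :=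
  (forall (a : R[i]) f1 f2,
     Cl 2 f1 -> C0_Omega f1 -> Cl 2 f2 -> C0_Omega f2 ->
     Pi (fun Z => a * f1 Z + f2 Z) = a *: Pi f1 + Pi f2) /\
  (exists K : R, forall f psi, Cl 2 f -> C0_Omega f -> Cl 1 psi ->
     normc (pairing phi (Pi f) psi)
       <= K * fine (Cl_norm 2 f) * fine (Cl_norm 1 psi)).

(* As 0 is a simple eigenvalue of X, F is the direct sum of the kernel and the
   image of X; mu is the functional psi |-> \int psi dm, and the last condition
   says that the component of Pi f in the kernel is (\int f dm) mu. *)
Definition simple_zero_contribution (N : nat)
    (phi : 'I_N -> (phase R -> R[i]) -> R[i])
    (Pi : (phase R -> R[i]) -> 'rV[R[i]]_N) (X : 'M[R[i]]_N) :=
  mup 0 (char_poly X) = 1%N /\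
  exists mu : 'rV[R[i]]_N,
    [/\ forall psi, Cl 1 psi -> pairing phi mu psi = integral_m psi,
        mu *m X = 0
      & forall f, Cl 2 f -> C0_Omega f ->
          (Pi f - integral_m f *: mu <= X)%MS].

Definition Dolgopyat_constant (v : R) :=
  0 < v /\
  exists (N : nat) (phi : 'I_N -> (phase R -> R[i]) -> R[i])
         (Pi : (phase R -> R[i]) -> 'rV[R[i]]_N) (X : 'M[R[i]]_N),
    [/\ basis_in_dual_C1 phi,
        bounded_into_dual phi Pi,
        forall z : R[i], eigenvalue X z -> (- v < complex.Re z < 0) \/ z = 0,
        simple_zero_contribution phi Pi X
      & forall v1 : R, v1 < v -> exists2 C1 : R, 0 < C1 &
          forall (t : R) psi f, 0 <= t -> Cl 1 psi -> Cl 2 f -> C0_Omega f ->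
            normc (integral_m (fun Z => psi (flow t Z) * f Z)
                   - pairing phi (Pi f *m expmx (t%:C *: X)) psi)
              <= C1 * fine (Cl_norm 2 f) * fine (Cl_norm 1 psi)
                 * expR (- v1 * t)].

End Scatterers.

(* Main.v *)
Require Import Defs.
From HB Require Import structures.
From mathcomp Require Import all_boot all_order all_algebra.
From mathcomp Require Import all_classical all_reals all_analysis.
From mathcomp Require Import complex.
From mathcomp Require Import ring lra zify measurable_realfun.

Set Implicit Arguments.
Unset Strict Implicit.
Unset Printing Implicit Defensive.

Import Order.TTheory GRing.Theory Num.Theory.
Import numFieldNormedType.Exports ComplexField.Normc.

Local Open Scope classical_set_scope.
Local Open Scope complex_scope.
Local Open Scope ring_scope.

(* A Hoelder observable is approximated at scale 2 ^ (- j) by a combination of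
   smooth bumps centred at a grid of phase space, with C^1 and C^2 norms growing
   like a fixed power of 2 ^ j; for f, the bumps whose support meets the boundary
   of the table are dropped, so that the approximant vanishes there and hence
   lies in C^0(Omega), at the price of an error O(1) on a set of measure
   O(2 ^ (- j)).  For the approximants the correlation is governed by exp (t X),
   which decays exponentially on the image of X; taking j proportional to t
   balances the approximation error and the growth of the norms.

   Neither the measurability of the flow nor the invariance of Omega0 is proved.
   The integral of a nonmeasurable function is the difference of the inner
   integrals of its positive and negative parts, and this functional is still
   Lipschitz for the sup norm.  The set of the points of Omega0 which the flow
   takes out of Omega0 is controlled by Dolgopyat's estimate itself: C^1(Omega0)
   does not see the values of psi off Omega0, so the estimate for the indicator
   functions of Omega0 and of its complement shows that this set has zero inner
   measure and exponentially small outer measure. *)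

(** The smoothing uses neither convolution nor an extension of the observables off [Omega0]: an
    approximant is a finite combination of tensor products of periodic bumps whose coefficients are
    values taken at points of [Omega0]. Being defined on all of R^3, it has its genuine partial
    derivatives as a Whitney jet whatever the shape of the table, so its norms reduce to Taylor's
    formula in one variable. The bumps are not an exact partition of unity: the sum of N equally
    spaced translates has period 2 pi / N, hence a variation bounded independently of N, while its
    size grows with N. A fine enough grid makes it constant up to a relative error 2 ^ (- j), and
    division by a constant suffices.

    The decay of exp (t X) on the image of X needs no Jordan form: Cayley-Hamilton gives X q(X) = 0
    where all roots of q have negative real part, and these roots are removed one at a time by a
    Gronwall estimate.

    The Hoelder norm does not control psi off [Omega0], so psi composed with the flow may be
    arbitrarily large on the exit set. This is why integrals are compared up to a set of zero inner
    measure on which nothing is assumed. *)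

Section ComplexNorm.
Context {R : realType}.
Implicit Types (z w : R[i]) (x : R).

Lemma normc_ge0 z : 0 <= normc z.
Proof. by rewrite /normc; case: z => a b; exact: sqrtr_ge0. Qed.

Lemma normcD_le z w : normc (z + w) <= normc z + normc w.
Proof. exact: le_normcD. Qed.

Lemma normc_opp z : normc (- z) = normc z.
Proof. exact: normcN. Qed.

Lemma normcB_le z w : normc (z - w) <= normc z + normc w.
Proof. by rewrite -(normc_opp w) normcD_le. Qed.

Lemma normc_distC z w : normc (z - w) = normc (w - z).
Proof. by rewrite -normc_opp opprB. Qed.

Lemma normc_real x : normc x%:C = `|x|.
Proof. by rewrite /normc /= expr0n /= addr0 sqrtr_sqr. Qed.

Lemma normc_Re z : `|complex.Re z| <= normc z.
Proof.
case: z => a b; rewrite /normc /= -sqrtr_sqr ler_sqrt ?lerDl ?sqr_ge0//.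
by rewrite addr_ge0 ?sqr_ge0.
Qed.

Lemma normc_Im z : `|complex.Im z| <= normc z.
Proof.
case: z => a b; rewrite /normc /= -sqrtr_sqr ler_sqrt ?lerDr ?sqr_ge0//.
by rewrite addr_ge0 ?sqr_ge0.
Qed.

Lemma normc_le_ReIm z : normc z <= `|complex.Re z| + `|complex.Im z|.
Proof.
case: z => a b; rewrite /normc /=.
rewrite -[leRHS](@ger0_norm _) ?addr_ge0// -sqrtr_sqr ler_sqrt ?sqr_ge0//.
by rewrite sqrrD !real_normK ?num_real// [leRHS]addrAC lerDl mulrn_wge0// mulr_ge0.
Qed.

Lemma normc_sqr z : normc z ^+ 2 = complex.Re z ^+ 2 + complex.Im z ^+ 2.
Proof. by case: z => a b; rewrite /normc /= sqr_sqrtr// addr_ge0 ?sqr_ge0. Qed.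

Lemma normc_zero : normc (0 : R[i]) = 0.
Proof. exact: normc0. Qed.

Lemma normc_sum I (r : seq I) (P : pred I) (F : I -> R[i]) :
  normc (\sum_(i <- r | P i) F i) <= \sum_(i <- r | P i) normc (F i).
Proof.
elim/big_ind2 : _ => [|z x w y zx wy|i _//]; first by rewrite normc_zero.
by rewrite (le_trans (normcD_le _ _)) ?lerD.
Qed.

Lemma complex_eqP z w :
  complex.Re z = complex.Re w -> complex.Im z = complex.Im w -> z = w.
Proof. by case: z w => a b [c k] /= -> ->. Qed.

End ComplexNorm.

(** * Integrals of nonmeasurable functions *)

Section InnerIntegral.
Context d (T : measurableType d) (R : realType).
Variable mu : {measure set T -> \bar R}.
Variable D : set T.
Hypothesis mD : measurable D.
Hypothesis muD : (mu D < +oo)%E.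
Local Open Scope ereal_scope.
Import HBNNSimple.

Lemma ge0_integral_mono (p q : T -> \bar R) :
  (forall x, D x -> 0 <= p x) -> (forall x, D x -> p x <= q x) ->
  \int[mu]_(x in D) p x <= \int[mu]_(x in D) q x.
Proof.
move=> p0 pq; have q0 x : D x -> 0 <= q x by move=> Dx; rewrite (le_trans (p0 x Dx)) ?pq.
rewrite !ge0_integralE//; apply: ereal_sup_le => _ [h hp <-].
exists h => // x; apply: (le_trans (hp x)); rewrite /patch; case: ifPn => //.
by rewrite inE => Dx; apply: pq.
Qed.

(* For a simple function h <= p, the function (min (h, M) - e)^+ cut off outside A
   is measurable and below q, whether or not p and q are measurable. *)
Lemma inner_integral_le (E A : set T) (p q : T -> R) (M e : R) :
  measurable A -> E `<=` A ->
  (forall U, measurable U -> U `<=` D `&` E -> mu U = 0) ->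
  (0 <= M)%R -> (0 <= e)%R ->
  (forall x, D x -> 0 <= p x)%R -> (forall x, D x -> 0 <= q x)%R ->
  (forall x, D x -> ~ E x -> p x <= M)%R ->
  (forall x, D x -> ~ A x -> p x <= q x + e)%R ->
  \int[mu]_(x in D) (p x)%:E <=
    \int[mu]_(x in D) (q x)%:E + (e%:E * mu D + M%:E * mu A).
Proof.
move=> mA EA Enull M0 e0 p0 q0 pM pq.
rewrite {1}ge0_integralE; last by move=> x Dx; rewrite lee_fin p0.
apply: ge_ereal_sup => _ [h /= hp <-].
rewrite -integralT_nnsfun.
have hD x : ~ D x -> h x = 0%R.
  move=> Dx; apply/eqP; rewrite eq_le fun_ge0 andbT.
  by have := hp x; rewrite /patch memNset.
have hDp x : D x -> (h x <= p x)%R.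
  by move=> Dx; have := hp x; rewrite /patch mem_set// lee_fin.
have -> : \int[mu]_x (h x)%:E = \int[mu]_(x in D) (h x)%:E.
  rewrite [RHS]integral_mkcond; apply: eq_integral => x _; rewrite /patch.
  by case: ifPn => //; rewrite notin_setE => /hD ->.
pose u x := (Num.max 0 (Num.min (h x) M - e) * \1_(~` A) x)%R.
have mh : measurable_fun [set: T] h by exact: measurable_funP.
have mu_ : measurable_fun D u.
  apply: measurable_funM; last exact: measurable_indic (measurableC mA).
  apply: measurable_maxr => //; apply: measurable_funB => //.
  apply: measurable_minr => //; exact: measurable_funS mh.
have uq : \int[mu]_(x in D) (u x)%:E <= \int[mu]_(x in D) (q x)%:E.
  apply: ge0_integral_mono => x Dx; rewrite lee_fin /u.
    by rewrite mulr_ge0// le_max lexx.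
  rewrite indicE; case: (boolP (x \in ~` A)) => [|_]; last by rewrite mulr0 q0.
  rewrite inE /= mulr1 => nAx; rewrite ge_max q0//=.
  by rewrite lerBlDr ge_min (le_trans (hDp _ Dx) (pq _ Dx nAx)).
(* Since [h <= p], the simple function exceeds [M] only inside [E]; so [U] is a measurable subset of
   the inner null set, hence null. *)
pose U := h @^-1` `]M, +oo[%classic.
have mU : measurable U by rewrite -[U]setTI; apply: mh.
have U0 : mu U = 0.
  apply: Enull => // x; rewrite /U /= in_itv/= andbT => Mh.
  have Dx : D x by apply: contrapT => /hD hx; move: Mh; rewrite hx ltNge M0.
  split=> //; apply: contrapT => nE; move: Mh.
  by rewrite ltNge (le_trans (hDp _ Dx)) ?pM.
apply: (@le_trans _ _ (\int[mu]_(x in D) (u x + (e + M * \1_A x))%:E)).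
  apply: ae_ge0_le_integral => //.
  - by move=> x _; rewrite lee_fin fun_ge0.
  - by apply/measurable_EFinP; exact: measurable_funS mh.
  - move=> x _; rewrite lee_fin addr_ge0// ?addr_ge0// ?mulr_ge0// /u.
    by rewrite le_max lexx.
  - apply/measurable_EFinP; apply: measurable_funD => //.
    apply: measurable_funD => //; apply: measurable_funM => //.
  exists U; split=> // x /= /not_implyP[Dx]; rewrite lee_fin => /negP.
  rewrite -ltNge /U /= in_itv/= andbT ltNge => nle.
  rewrite ltNge; apply/negP => hM; move/negP: nle; apply.
  rewrite /u (min_idPl hM) !indicE in_setC.
  case: (boolP (x \in A)) => _ /=; first by rewrite mulr0 mulr1 add0r; lra.
  by rewrite mulr1 mulr0 addr0 -lerBlDr le_max lexx orbT.
under eq_integral do rewrite EFinD.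
rewrite ge0_integralD//=; last 4 first.
- by move=> x _; rewrite lee_fin mulr_ge0// le_max lexx.
- exact/measurable_EFinP.
- by move=> x _; rewrite lee_fin addr_ge0// mulr_ge0.
- apply/measurable_EFinP; apply: measurable_funD => //.
  by apply: measurable_funM => //; exact: measurable_indic.
apply: leeD => //.
under eq_integral do rewrite EFinD EFinM.
rewrite ge0_integralD//=; last 2 first.
- by move=> x _; rewrite lee_fin mulr_ge0.
- apply/measurable_EFinP.
  by apply: measurable_funM => //; exact: measurable_indic.
rewrite integral_cst// leeD2l// ge0_integralZl_EFin//; last first.
  by apply/measurable_EFinP; exact: measurable_indic.
rewrite integral_indic// lee_wpmul2l ?lee_fin// le_measure ?inE//; exact: measurableI.
Qed.

(** The one-sided bound is applied in both directions. Applied with 0 in place of [q] and [M] in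
    place of [e], it also shows that the integrals are finite, without which the difference of the
    [fine] values would carry no information. *)
Lemma inner_integral_close (E A : set T) (p q : T -> R) (M e : R) :
  measurable A -> mu A < +oo -> E `<=` A ->
  (forall U, measurable U -> U `<=` D `&` E -> mu U = 0) ->
  (0 <= M)%R -> (0 <= e)%R ->
  (forall x, D x -> 0 <= p x)%R -> (forall x, D x -> 0 <= q x)%R ->
  (forall x, D x -> ~ E x -> p x <= M)%R ->
  (forall x, D x -> ~ E x -> q x <= M)%R ->
  (forall x, D x -> ~ A x -> `|p x - q x| <= e)%R ->
  [/\ \int[mu]_(x in D) (p x)%:E \is a fin_num,
      \int[mu]_(x in D) (q x)%:E \is a fin_num &
      (`|fine (\int[mu]_(x in D) (p x)%:E) - fine (\int[mu]_(x in D) (q x)%:E)|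
        <= e * fine (mu D) + M * fine (mu A))%R].
Proof.
move=> mA Aoo EA En M0 e0 p0 q0 pM qM pq.
have fD : mu D \is a fin_num by rewrite ge0_fin_numE.
have fA : mu A \is a fin_num by rewrite ge0_fin_numE.
have fin (f : T -> R) : (forall x, D x -> 0 <= f x)%R ->
    (forall x, D x -> ~ E x -> f x <= M)%R ->
    \int[mu]_(x in D) (f x)%:E \is a fin_num.
  move=> f0 fM; rewrite ge0_fin_numE; last first.
    by apply: integral_ge0 => x Dx; rewrite lee_fin f0.
  apply: (@le_lt_trans _ _ (\int[mu]_(x in D) (cst 0%R x)%:E +
    (M%:E * mu D + M%:E * mu A))).
    apply: (inner_integral_le mA EA En) => // x Dx nA.
    by rewrite add0r fM// => /EA.
  by rewrite integral0 add0r -(fineK fD) -(fineK fA) -!EFinM -EFinD ltry.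
have [fp fq] : \int[mu]_(x in D) (p x)%:E \is a fin_num /\
    \int[mu]_(x in D) (q x)%:E \is a fin_num by split; apply: fin.
split=> //.
have le (f g : T -> R) : (forall x, D x -> 0 <= f x)%R ->
    (forall x, D x -> 0 <= g x)%R ->
    (forall x, D x -> ~ E x -> f x <= M)%R ->
    (forall x, D x -> ~ A x -> `|f x - g x| <= e)%R ->
    \int[mu]_(x in D) (f x)%:E \is a fin_num ->
    \int[mu]_(x in D) (g x)%:E \is a fin_num ->
    (fine (\int[mu]_(x in D) (f x)%:E) - fine (\int[mu]_(x in D) (g x)%:E)
        <= e * fine (mu D) + M * fine (mu A))%R.
  move=> f0 g0 fM fg ff fg'; rewrite lerBlDl -lee_fin.
  rewrite fineK// !EFinD fineK// !EFinM !fineK//.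
  apply: (inner_integral_le mA EA En) => // x Dx nA.
  by rewrite -lerBlDl (le_trans (ler_norm _) (fg _ Dx nA)).
rewrite ler_norml lerNl opprB !le// => x Dx nA; rewrite distrC; exact: pq.
Qed.

(** Taking positive and negative parts is 1-Lipschitz and preserves the bound [M]; each part
    contributes one error term, hence the factor 2. *)
Lemma Rintegral_close (E A : set T) (g h : T -> R) (M e : R) :
  measurable A -> mu A < +oo -> E `<=` A ->
  (forall U, measurable U -> U `<=` D `&` E -> mu U = 0) ->
  (0 <= M)%R -> (0 <= e)%R ->
  (forall x, D x -> ~ E x -> `|g x| <= M)%R ->
  (forall x, D x -> ~ E x -> `|h x| <= M)%R ->
  (forall x, D x -> ~ A x -> `|g x - h x| <= e)%R ->
  (`|\int[mu]_(x in D) g x - \int[mu]_(x in D) h x|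
     <= 2 * (e * fine (mu D) + M * fine (mu A)))%R.
Proof.
move=> mA Aoo EA En M0 e0 gM hM gh; rewrite /Rintegral.
have pos (f : T -> R) : \int[mu]_(x in D) (f x)%:E =
    \int[mu]_(x in D) (Num.max (f x) 0)%:E -
    \int[mu]_(x in D) (Num.max (- f x)%R 0)%:E.
  rewrite integralE; congr (_ - _); apply: eq_integral => x _.
    by rewrite funeposE -EFin_max.
  by rewrite funenegE -EFinN -EFin_max.
rewrite (pos g) (pos h).
have [p1 p2 p3] : [/\ \int[mu]_(x in D) (Num.max (g x) 0)%:E \is a fin_num,
      \int[mu]_(x in D) (Num.max (h x) 0)%:E \is a fin_num &
      (`|fine (\int[mu]_(x in D) (Num.max (g x) 0)%:E)
         - fine (\int[mu]_(x in D) (Num.max (h x) 0)%:E)|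
        <= e * fine (mu D) + M * fine (mu A))%R].
  apply: (inner_integral_close mA Aoo EA En) => // x Dx.
  - by rewrite le_max lexx orbT.
  - by rewrite le_max lexx orbT.
  - by move=> nE; rewrite ge_max M0 andbT (le_trans (ler_norm _)) ?gM.
  - by move=> nE; rewrite ge_max M0 andbT (le_trans (ler_norm _)) ?hM.
  - move=> nA; apply: le_trans (gh _ Dx nA).
    by rewrite /Num.max ler_norml; do 2 case: ltP => ?; rewrite !ler_normr;
      case: (ler0P (g x - h x)) => ?; lra.
have [n1 n2 n3] : [/\ \int[mu]_(x in D) (Num.max (- g x)%R 0)%:E \is a fin_num,
      \int[mu]_(x in D) (Num.max (- h x)%R 0)%:E \is a fin_num &
      (`|fine (\int[mu]_(x in D) (Num.max (- g x)%R 0)%:E)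
         - fine (\int[mu]_(x in D) (Num.max (- h x)%R 0)%:E)|
        <= e * fine (mu D) + M * fine (mu A))%R].
  apply: (inner_integral_close mA Aoo EA En) => // x Dx.
  - by rewrite le_max lexx orbT.
  - by rewrite le_max lexx orbT.
  - by move=> nE; rewrite ge_max M0 andbT (le_trans (ler_norm _)) ?normrN ?gM.
  - by move=> nE; rewrite ge_max M0 andbT (le_trans (ler_norm _)) ?normrN ?hM.
  - move=> nA; apply: le_trans (gh _ Dx nA).
    by rewrite /Num.max ler_norml; do 2 case: ltP => ?; rewrite !ler_normr;
      case: (ler0P (g x - h x)) => ?; lra.
rewrite (fineB p1 n1) (fineB p2 n2).
have H (a b c k : R) : (a - c - (b - k) = (a - b) - (c - k))%R by ring.
rewrite H.
by apply: (le_trans (ler_normB _ _)); move: p3 n3; set X := (e * _ + _)%R => p3 n3; lra.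
Qed.

(** [A] is the complement in [D] of the support of a nearly optimal simple function below the
    indicator of the complement of [E]. Such a function vanishes on [E], and it is at most 1, so its
    integral bounds the measure of its support from below. *)
Lemma inner_integral_hull (E : set T) (del : R) : (0 < del)%R ->
  exists A, [/\ measurable A, A `<=` D, D `&` E `<=` A &
    (fine (mu A) <= fine (mu D) - \int[mu]_(x in D) \1_(~` E) x + del)%R].
Proof.
move=> del0.
have fD : mu D \is a fin_num by rewrite ge0_fin_numE.
have i0 : 0 <= \int[mu]_(x in D) (\1_(~` E) x : R)%:E by apply: integral_ge0.
have iD : \int[mu]_(x in D) (\1_(~` E) x : R)%:E <= mu D.
  apply: (@le_trans _ _ (\int[mu]_(x in D) (cst 1 x))).
    by apply: ge0_integral_mono => x _; rewrite lee_fin indicE; case: (_ \in _).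
  by rewrite integral_cst// mul1e.
have fi : \int[mu]_(x in D) (\1_(~` E) x : R)%:E \is a fin_num.
  by rewrite ge0_fin_numE// (le_lt_trans iD).
rewrite /Rintegral; set I := \int[mu]_(x in D) _ in i0 iD fi *.
have IE : I = ereal_sup [set sintegral mu h | h in
    [set h : {nnsfun T >-> R} | forall x, (h x)%:E <= ((fun x => (\1_(~` E) x : R)%:E) \_ D) x]].
  by rewrite /I ge0_integralE.
rewrite IE in fi; have [_ [h /= hE <-]] := ub_ereal_sup_adherent del0 fi.
rewrite -IE => hlt; rewrite -IE in fi.
have mh : measurable_fun [set: T] h by exact: measurable_funP.
pose V := D `&` h @^-1` `]0%R, +oo[%classic.
have mV : measurable V.
  by apply: measurableI => //; rewrite -[X in measurable X]setTI; exact: mh.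
have VD : V `<=` D by move=> x [].
have hD x : ~ D x -> h x = 0%R.
  move=> Dx; apply/eqP; rewrite eq_le fun_ge0 andbT.
  by have := hE x; rewrite /patch memNset.
have hV : sintegral mu h <= mu V.
  rewrite -integralT_nnsfun -[V in mu V]setIT -(integral_indic mu measurableT mV).
  apply: ge0_le_integral => //.
  - by move=> x _; rewrite lee_fin fun_ge0.
  - exact/measurable_EFinP.
  - by apply/measurable_EFinP; exact: measurable_indic.
  move=> x _; rewrite lee_fin indicE.
  have [Dx|/hD ->] := pselect (D x); last by case: (_ \in _).
  have [h0|h0] := leP (h x) 0%R; first by rewrite (le_trans h0)//; case: (_ \in _).
  rewrite mem_set /=; last by split=> //=; rewrite in_itv/= h0.
  have := hE x; rewrite /patch mem_set// lee_fin => /le_trans; apply.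
  by rewrite indicE; case: (_ \in _).
exists (D `\` V); split; [exact: measurableD|by move=> x []| |].
  move=> x [Dx Ex]; split=> // -[_] /=; rewrite in_itv/= andbT ltNge => /negP; apply.
  have nE : (x \in ~` E) = false by apply: memNset => /(_ Ex).
  by have := hE x; rewrite /patch mem_set// lee_fin indicE nE.
have fV : mu V \is a fin_num.
  by rewrite ge0_fin_numE// (le_lt_trans _ muD)// le_measure ?inE.
have -> : mu (D `\` V) = mu D - mu V.
  by rewrite measureD// (_ : D `&` V = V)//; apply/seteqP; split=> x; [case|split=> //; exact: VD].
have hIV : (fine I - del <= fine (mu V))%R.
  by rewrite -lee_fin EFinB !fineK// (le_trans (ltW hlt)).
rewrite fineB//; lra.
Qed.

End InnerIntegral.

(** * Decay of the matrix exponential *)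

Section EntireSeries.
Context {R : realType}.
Implicit Types (u v : nat -> R[i]) (t : R).

(** Geometric growth, under which the exponential generating series converges on the whole line. *)
Definition exp_bounded u :=
  exists CM : R * R, [/\ 0 <= CM.1, 0 <= CM.2 &
    forall k, normc (u k) <= CM.1 * CM.2 ^+ k].

(* Exponential generating function of the real sequence f (u k), the only case of
   interest being f = Re and f = Im. *)
Definition egf (f : R[i] -> R) u t : R :=
  limn (pseries (fun k => f (u k) / k`!%:R) t).

Definition cegf u t : R[i] :=
  egf (@complex.Re R) u t +i* egf (@complex.Im R) u t.

Lemma is_cvg_egf (f : R[i] -> R) u t : (forall z, `|f z| <= normc z) ->
  exp_bounded u -> cvgn (pseries (fun k => f (u k) / k`!%:R) t).
Proof.
move=> fle [[C M] /= [C0 M0 uCM]].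
apply: normed_cvg.
apply: (@series_le_cvg _ _ (fun n => C * exp_coeff (M * `|t|) n)) => [n|n|n|] //.
- exact: normr_ge0.
- by rewrite mulr_ge0 ?exp_coeff_ge0 ?mulr_ge0.
- rewrite /exp_coeff /= normrM normrM normrX exprMn normfV normr_nat.
  rewrite !mulrA [leRHS]mulrAC ler_wpM2r ?exprn_ge0// ler_wpM2r ?invr_ge0//.
  exact: le_trans (fle _) (uCM n).
- by apply: (@is_cvg_seriesZ _ _ C); exact: is_cvg_series_exp_coeff.
Qed.

Lemma exp_bounded_shift u : exp_bounded u -> exp_bounded (fun k => u k.+1).
Proof.
case=> [[C M] /= [C0 M0 uCM]]; exists (C * M, M); split=> //=; first exact: mulr_ge0.
by move=> k; rewrite -mulrA -exprS.
Qed.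

(** Termwise differentiation of an exponential generating series shifts its coefficients; for the
    entries of Y X ^ k the shift is the replacement of Y by Y X. *)
Lemma is_derive_egf (f : R[i] -> R) u t : (forall z, `|f z| <= normc z) ->
  exp_bounded u -> is_derive t 1 (egf f u) (egf f (fun k => u k.+1) t).
Proof.
move=> fle bu.
have E w : pseries_diffs (fun k => f (w k) / k`!%:R) =
    (fun k => f (w k.+1) / k`!%:R).
  apply/funext => k; rewrite /pseries_diffs factS natrM invfM.
  by rewrite mulrCA mulVKf ?pnatr_eq0.
rewrite /egf -E.
have b1 := exp_bounded_shift bu; have b2 := exp_bounded_shift b1.
apply: (@pseries_snd_diffs _ _ (`|t| + 1)).
- exact: is_cvg_egf.
- by rewrite E; exact: is_cvg_egf.
- by rewrite E E; exact: is_cvg_egf.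
- by rewrite [ltRHS]ger0_norm ?addr_ge0// ltrDl.
Qed.

Lemma exp_boundedD u v : exp_bounded u -> exp_bounded v ->
  exp_bounded (fun k => u k + v k).
Proof.
case=> [[C M] /= [C0 M0 uCM]] [[C' M'] /= [C'0 M'0 vCM]].
exists (C + C', M + M'); split=> /=; try exact: addr_ge0.
move=> k; rewrite (le_trans (normcD_le _ _))// mulrDl lerD//.
- by rewrite (le_trans (uCM k))// ler_wpM2l// lerXn2r ?nnegrE ?addr_ge0// lerDl.
- by rewrite (le_trans (vCM k))// ler_wpM2l// lerXn2r ?nnegrE ?addr_ge0// lerDr.
Qed.

Lemma exp_boundedZ (a : R[i]) u : exp_bounded u -> exp_bounded (fun k => a * u k).
Proof.
case=> [[C M] /= [C0 M0 uCM]].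
exists (normc a * C, M); split=> //=; first by rewrite mulr_ge0 ?normc_ge0.
by move=> k; rewrite normcM -mulrA ler_wpM2l ?normc_ge0.
Qed.

Lemma cvg_egf (f : R[i] -> R) u t : (forall z, `|f z| <= normc z) ->
  exp_bounded u -> pseries (fun k => f (u k) / k`!%:R) t @ \oo --> egf f u t.
Proof. by move=> fle bu; exact: (is_cvg_egf fle bu). Qed.

Lemma cegfD u v t : exp_bounded u -> exp_bounded v ->
  cegf (fun k => u k + v k) t = cegf u t + cegf v t.
Proof.
move=> bu bv.
have D (f : R[i] -> R) : (forall z, `|f z| <= normc z) ->
    (forall z w, f (z + w) = f z + f w) ->
    egf f (fun k => u k + v k) t = egf f u t + egf f v t.
  move=> fle fD; apply: cvg_lim => //.
  have -> : pseries (fun k => f (u k + v k) / k`!%:R) t =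
      (pseries (fun k => f (u k) / k`!%:R) t
       + pseries (fun k => f (v k) / k`!%:R) t)%R.
    apply/funext => n; rewrite /pseries /series /= -[RHS]big_split /=.
    by apply: eq_bigr => k _; rewrite fD !mulrDl.
  by apply: cvgD; exact: cvg_egf.
by apply: complex_eqP => /=; apply: D => [z|[a b] [c k]] //;
  [exact: normc_Re|exact: normc_Im].
Qed.

Lemma cegfZ (a : R[i]) u t : exp_bounded u ->
  cegf (fun k => a * u k) t = a * cegf u t.
Proof.
move=> bu.
(* Multiplication by [a] mixes the real and imaginary parts, so either part of the product is a
   combination of both real series. *)
have Z (f : R[i] -> R) (p q : R) : (forall z, `|f z| <= normc z) ->
    (forall z, f (a * z) = p * complex.Re z + q * complex.Im z) ->
    egf f (fun k => a * u k) t =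
      p * egf (@complex.Re R) u t + q * egf (@complex.Im R) u t.
  move=> fle fZ; apply: cvg_lim => //.
  have -> : pseries (fun k => f (a * u k) / k`!%:R) t =
      (p *: pseries (fun k => complex.Re (u k) / k`!%:R) t
       + q *: pseries (fun k => complex.Im (u k) / k`!%:R) t)%R.
    apply/funext => n; rewrite /pseries /series /=.
    rewrite [RHS](_ : _ =
      p * (\sum_(0 <= k < n) complex.Re (u k) / k`!%:R * t ^+ k) +
      q * (\sum_(0 <= k < n) complex.Im (u k) / k`!%:R * t ^+ k))//.
    rewrite !mulr_sumr -big_split /=.
    by apply: eq_bigr => k _; rewrite fZ !mulrDl -!mulrA.
  by apply: cvgD; apply: cvgZr => //; apply: cvg_egf => // z;
    [exact: normc_Re|exact: normc_Im].
case: a Z => a b Z.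
apply: complex_eqP => /=.
  rewrite (Z _ a (- b)); first by rewrite mulNr.
    exact: normc_Re.
  by case=> x y /=; rewrite mulNr.
rewrite (Z _ b a); first by rewrite addrC.
  exact: normc_Im.
by case=> x y /=; rewrite addrC.
Qed.

Lemma cegf_sum (I : Type) (r : seq I) (F : I -> nat -> R[i]) t :
  (forall i, exp_bounded (F i)) ->
  exp_bounded (fun k => \sum_(i <- r) F i k) /\
  cegf (fun k => \sum_(i <- r) F i k) t = \sum_(i <- r) cegf (F i) t.
Proof.
move=> bF.
have b0 : exp_bounded (fun=> 0 : R[i]).
  by exists (0, 0); split=> // k; rewrite (normc_zero : normc ((fun=> 0) k) = 0) mul0r.
elim: r => [|i r [IHb IH]].
  under eq_fun do rewrite big_nil; split=> //.
  rewrite big_nil -[RHS](mul0r (cegf (fun=> 0) t)) -cegfZ//.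
  by congr cegf; apply/funext => k; rewrite mul0r.
under eq_fun do rewrite big_cons; split; first exact: exp_boundedD.
by rewrite big_cons cegfD// IH.
Qed.

Lemma cegf_const (u : nat -> R[i]) t :
  (forall k, (0 < k)%N -> u k = 0) -> cegf u t = u 0%N.
Proof.
move=> u0.
have L (f : R[i] -> R) : f 0 = 0 -> egf f u t = f (u 0%N).
  move=> f0; apply: cvg_lim => //.
  rewrite -cvg_shiftS /=.
  rewrite (_ : (fun n => _) = cst (f (u 0%N))); first exact: cvg_cst.
  apply/funext => n; rewrite /pseries /series /= big_nat_recl//= big1 => [|k _].
    by rewrite fact0 divr1 expr0 mulr1 addr0.
  by rewrite u0// f0 !mul0r.
by apply: complex_eqP => /=; exact: L.
Qed.

Lemma cegf_at0 (u : nat -> R[i]) : cegf u 0 = u 0%N.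
Proof.
rewrite -[RHS](@cegf_const (fun k => if k == 0%N then u 0%N else 0) 0); last first.
  by case.
have L (f : R[i] -> R) : egf f u 0 = egf f (fun k => if k == 0%N then u 0%N else 0) 0.
  congr (limn _); apply/funext => n; apply: eq_bigr => -[|k] _ //=.
  by rewrite expr0n !mulr0.
by apply: complex_eqP => /=; exact: L.
Qed.

End EntireSeries.

(** * Derivatives of real functions given by explicit formulas *)

Section PointwiseDerivatives.
Context {R : realType}.
Implicit Types (f g : R -> R) (t : R).

Lemma ptderD f g t df dg : is_derive t (1 : R) f df -> is_derive t (1 : R) g dg ->
  is_derive t (1 : R) (fun s => f s + g s) (df + dg).
Proof. by move=> hf hg; exact: is_deriveD. Qed.

Lemma ptderB f g t df dg : is_derive t (1 : R) f df -> is_derive t (1 : R) g dg ->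
  is_derive t (1 : R) (fun s => f s - g s) (df - dg).
Proof. by move=> hf hg; exact: is_deriveB. Qed.

Lemma ptderM f g t df dg : is_derive t (1 : R) f df -> is_derive t (1 : R) g dg ->
  is_derive t (1 : R) (fun s => f s * g s) (df * g t + f t * dg).
Proof.
move=> hf hg; suff -> : df * g t + f t * dg = f t *: (dg : R^o) + g t *: (df : R^o).
  exact: is_deriveM.
by rewrite /GRing.scale /= addrC [g t * _]mulrC.
Qed.

Lemma ptder_cst (a : R) t : is_derive t (1 : R) (fun=> a) 0.
Proof. exact: is_derive_cst. Qed.

Lemma ptder_id t : is_derive t (1 : R) (fun s => s) 1.
Proof. exact: is_derive_id. Qed.

Lemma ptder_comp f g t df dg : is_derive (g t) (1 : R) f df ->
  is_derive t (1 : R) g dg -> is_derive t (1 : R) (fun s => f (g s)) (dg * df).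
Proof. by move=> hf hg; rewrite mulrC; exact: is_derive1_comp. Qed.

Lemma ptder_eq f t df df' : is_derive t (1 : R) f df -> df = df' ->
  is_derive t (1 : R) f df'.
Proof. by move=> ? <-. Qed.

Lemma ptder_lip f df (B : R) : (forall t : R, is_derive t (1 : R) f (df t)) ->
  (forall t, `|df t| <= B) -> forall s t, `|f s - f t| <= B * `|s - t|.
Proof.
move=> Hf HB.
have le s t : s <= t -> `|f t - f s| <= B * `|t - s|.
  move=> st.
  have [c _ ->] := @MVT_segment R f df s t st (fun x _ => Hf x)
    (derivable_within_continuous (fun x _ => @ex_derive _ _ _ _ _ _ _ (Hf x))).
  by rewrite normrM ler_wpM2r.
move=> s t; have [st|/ltW ts] := leP s t; last exact: le.
by rewrite distrC [`|s - t|]distrC le.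
Qed.

End PointwiseDerivatives.

Section DampedODE.
Context {R : realType}.

Lemma is_derive_nonincreasing (f df : R -> R) :
  (forall t : R, is_derive t (1 : R) f (df t)) ->
  (forall t, 0 <= t -> df t <= 0) -> forall t, 0 <= t -> f t <= f 0.
Proof.
move=> Hf Hd t t0.
have [c] := @MVT_segment R f df 0 t t0 (fun x _ => Hf x)
  (derivable_within_continuous (fun x _ => @ex_derive _ _ _ _ _ _ _ (Hf x))).
rewrite in_itv/= => /andP[c0 _]; rewrite subr0 => E.
by rewrite -subr_le0 E mulr_le0_ge0 ?Hd.
Qed.

(* Gronwall for V = p ^ 2 + q ^ 2: V' <= - l V + (p1 ^ 2 + q1 ^ 2) / l, because
   2 (p p1 + q q1) <= l V + (p1 ^ 2 + q1 ^ 2) / l. *)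
Lemma damped_ode_decay (l om C del : R) : 0 < l -> 0 <= C -> 0 < del ->
  exists del' C' : R, [/\ 0 < del', 0 <= C' &
  forall p q p1 q1 : R -> R,
    (forall t : R, is_derive t (1 : R) p (- l * p t - om * q t + p1 t)) ->
    (forall t : R, is_derive t (1 : R) q (- l * q t + om * p t + q1 t)) ->
    (forall t, 0 <= t -> p1 t ^+ 2 + q1 t ^+ 2 <= C * expR (- del * t)) ->
  forall t, 0 <= t ->
    p t ^+ 2 + q t ^+ 2 <= (p 0 ^+ 2 + q 0 ^+ 2 + C') * expR (- del' * t)].
Proof.
(* Strictly below both the damping rate and the rate of the forcing, so that the two never
   resonate. *)
move=> l0 C0 d0; pose e : R := Num.min l del / 2.
have m0 : 0 < Num.min l del by rewrite lt_min l0.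
have e0 : 0 < e by rewrite divr_gt0.
have el : e < l.
  by rewrite ltr_pdivrMr// (le_lt_trans (_ : _ <= l)) ?ge_min ?lexx//; lra.
have ed : e < del.
  by rewrite ltr_pdivrMr// (le_lt_trans (_ : _ <= del)) ?ge_min ?lexx ?orbT//; lra.
(* Chosen with k (del - e) = C / l: the derivative of the second term of [U] below then cancels the
   contribution of the forcing. *)
pose k : R := C / l / (del - e).
have k0 : 0 <= k by rewrite /k !mulr_ge0 ?invr_ge0 ?subr_ge0// ltW.
exists e, k; split=> // p q p1 q1 Hp Hq H1 t t0.
pose U s := (p s ^+ 2 + q s ^+ 2) * expR (e * s) + k * expR ((e - del) * s).
have HU s : is_derive s (1 : R) U
   ((2 * (p s * (- l * p s - om * q s + p1 s) + q s * (- l * q s + om * p s + q1 s))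
      + e * (p s ^+ 2 + q s ^+ 2)) * expR (e * s)
    - C / l * expR ((e - del) * s)).
  have := Hp s; have := Hq s => hq hp.
  have hE (c : R) : is_derive s (1 : R) (fun s => expR (c * s)) (c * expR (c * s)).
    apply: ptder_eq (ptder_comp (is_derive_expR _) (ptderM (ptder_cst c s) (ptder_id s))) _.
    by rewrite mul0r add0r mulr1.
  apply: ptder_eq (ptderD (ptderM (ptderD (ptderM hp hp) (ptderM hq hq)) (hE e))
    (ptderM (ptder_cst k s) (hE (e - del)))) _.
  rewrite /k; field; rewrite ?subr_eq0 !gt_eqF//; lra.
have : U t <= U 0.
  apply: (is_derive_nonincreasing HU) => // s s0.
  have -> : expR ((e - del) * s) = expR (- del * s) * expR (e * s).
    by rewrite -expRD; congr expR; ring.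
  rewrite mulrA -mulrBl pmulr_lle0 ?expR_gt0//.
  have := H1 _ s0; set E := expR _; set P := p s; set Qs := q s.
  set P1 := p1 s; set Q1 := q1 s => hE.
  have h2 : (P1 ^+ 2 + Q1 ^+ 2) / l <= C / l * E.
    by rewrite mulrAC ler_wpM2r// invr_ge0 ltW.
  have h3 : 2 * (P * P1 + Qs * Q1) <= l * (P ^+ 2 + Qs ^+ 2) + (P1 ^+ 2 + Q1 ^+ 2) / l.
    rewrite -subr_ge0.
    have -> : l * (P ^+ 2 + Qs ^+ 2) + (P1 ^+ 2 + Q1 ^+ 2) / l - 2 * (P * P1 + Qs * Q1)
      = ((l * P - P1) ^+ 2 + (l * Qs - Q1) ^+ 2) / l.
      by field; rewrite gt_eqF.
    by rewrite divr_ge0 ?addr_ge0 ?sqr_ge0// ltW.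
  have h4 : 0 <= (l - e) * (P ^+ 2 + Qs ^+ 2).
    by apply: mulr_ge0; [rewrite subr_ge0 ltW|rewrite addr_ge0 ?sqr_ge0].
  lra.
rewrite /U !mulr0 expR0 !mulr1 => HUt.
have E : expR (e * t) * expR (- e * t) = 1 by rewrite -expRD mulNr subrr expR0.
rewrite -[leLHS]mulr1 -E mulrA ler_wpM2r ?expR_ge0//.
apply: le_trans HUt.
by rewrite lerDl mulr_ge0 ?expR_ge0.
Qed.

End DampedODE.

Section MatrixExponential.
Context {R : realType} (N : nat) (X : 'M[R[i]]_N).
Implicit Types (p : nat) (t : R).

Lemma mulmx_pow_bounded p (Y : 'M[R[i]]_(p, N)) i j :
  exp_bounded (fun k => (Y *m X ^+ k) i j).
Proof.
pose M := \sum_(l : 'I_N) \sum_(j : 'I_N) normc (X l j).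
pose C := \sum_(j : 'I_N) normc (Y i j).
have M0 : 0 <= M by apply: sumr_ge0 => l _; apply: sumr_ge0 => k _; exact: normc_ge0.
have C0 : 0 <= C by apply: sumr_ge0 => k _; exact: normc_ge0.
have XM l j' : normc (X l j') <= \sum_(j : 'I_N) normc (X l j).
  by rewrite (bigD1 j')//= lerDl sumr_ge0// => k _; exact: normc_ge0.
exists (C, M); split=> //= k.
have Y0 j' : normc (Y i j') <= C.
  by rewrite /C (bigD1 j')//= lerDl sumr_ge0// => l _; exact: normc_ge0.
elim: k j => [|k IH] j; first by rewrite expr0 mulmx1 expr0 mulr1.
rewrite exprSr mulmxA mxE (le_trans (normc_sum _ _ _))//.
rewrite exprSr mulrA {2}/M mulr_sumr; apply: ler_sum => l _.
by rewrite normcM ler_pM ?normc_ge0.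
Qed.

(* The entries of Y exp (t X); see mul_expmx. *)
Definition mexp p (Y : 'M[R[i]]_(p, N)) i j t : R[i] :=
  cegf (fun k => (Y *m X ^+ k) i j) t.

Lemma mexpD p (Y Z : 'M[R[i]]_(p, N)) i j t :
  mexp (Y + Z) i j t = mexp Y i j t + mexp Z i j t.
Proof.
rewrite /mexp -cegfD; try exact: mulmx_pow_bounded.
by congr cegf; apply/funext => k; rewrite mulmxDl mxE.
Qed.

Lemma mexpZ p (Y : 'M[R[i]]_(p, N)) (a : R[i]) i j t :
  mexp (a *: Y) i j t = a * mexp Y i j t.
Proof.
rewrite /mexp -cegfZ; last exact: mulmx_pow_bounded.
by congr cegf; apply/funext => k; rewrite -scalemxAl mxE.
Qed.

Lemma mexp_at0 p (Y : 'M[R[i]]_(p, N)) i j : mexp Y i j 0 = Y i j.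
Proof. by rewrite /mexp cegf_at0 expr0 mulmx1. Qed.

Lemma scalemx_pow (a : R[i]) k : (a *: X) ^+ k = a ^+ k *: X ^+ k.
Proof.
elim: k => [|k IH]; first by rewrite !expr0 scale1r.
by rewrite !exprS IH -!mulmxE -scalemxAl -scalemxAr scalerA.
Qed.

Lemma mul_expmx p (Y : 'M[R[i]]_(p, N)) t i j :
  (Y *m expmx (t%:C *: X)) i j = mexp Y i j t.
Proof.
have E l j' : expmx (t%:C *: X) l j' = cegf (fun k => (X ^+ k) l j') t.
  rewrite mxE; have H (f : R[i] -> R) : (forall z w, f (z + w) = f z + f w) ->
      (forall (a : R) z, f (a%:C * z) = a * f z) ->
      (fun n => f ((\sum_(k < n) (k`!%:R)^-1 *: (t%:C *: X) ^+ k) l j')) =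
      pseries (fun k => f ((X ^+ k) l j') / k`!%:R) t.
    move=> fD fZ; apply/funext => n; rewrite summxE.
    have f0 : f 0 = 0 by apply: (@addIr _ (f 0)); rewrite -fD !add0r.
    rewrite (big_morph f fD f0) /pseries /series /= big_mkord.
    apply: eq_bigr => k _; rewrite scalemx_pow !mxE mulrA.
    rewrite (_ : k`!%:R^-1 * t%:C ^+ k = (k`!%:R^-1 * t ^+ k)%:C).
      by rewrite fZ mulrC mulrA.
    by rewrite rmorphM rmorphXn fmorphV rmorph_nat.
  by apply: complex_eqP => /=; congr (limn _);
    apply: H => [[a b] [c k]|a [b c]] //=; rewrite mul0r ?subr0 ?addr0.
have bX l : exp_bounded (fun k => (X ^+ k) l j).
  have := mulmx_pow_bounded 1%:M l j.
  by under eq_fun do rewrite mul1mx.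
rewrite mxE; under eq_bigr => l _ do rewrite E -cegfZ//.
have [_ <-] := @cegf_sum _ _ (index_enum 'I_N)
  (fun l k => Y i l * (X ^+ k) l j) t (fun l => exp_boundedZ _ (bX l)).
by congr cegf; apply/funext => k; rewrite mxE.
Qed.

Lemma is_derive_mexp p (Y : 'M[R[i]]_(p, N)) i j t :
  is_derive t (1 : R) (fun t => complex.Re (mexp Y i j t))
    (complex.Re (mexp (Y *m X) i j t)) /\ is_derive t (1 : R) (fun t => complex.Im (mexp Y i j t))
    (complex.Im (mexp (Y *m X) i j t)).
Proof.
rewrite /mexp /cegf /=.
have -> : (fun k => (Y *m X *m X ^+ k) i j) = (fun k => (Y *m X ^+ k.+1) i j).
  by apply/funext => k; rewrite exprS mulmxA.
by split; apply: (is_derive_egf t _ (mulmx_pow_bounded Y i j)) => z;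
  [exact: normc_Re|exact: normc_Im].
Qed.

(** Stated for squared moduli because the Gronwall estimate concerns p ^ 2 + q ^ 2; the moduli
    themselves decay at the rate del / 2. *)
Definition exp_decays p (Y : 'M[R[i]]_(p, N)) := exists C del : R,
  [/\ 0 <= C, 0 < del & forall i j t, 0 <= t ->
    complex.Re (mexp Y i j t) ^+ 2 + complex.Im (mexp Y i j t) ^+ 2
      <= C * expR (- del * t)].

(* If z is the eigenvalue peeled off, E_Y' = E_(Y X) = z E_Y + E_(Y (X - z)). *)
Lemma exp_decays_peel p (Y : 'M[R[i]]_(p, N)) (z : R[i]) :
  complex.Re z < 0 -> exp_decays (Y *m (X - z%:M)) -> exp_decays Y.
Proof.
case: z => a b /= a0 [C [del [C0 d0 H]]].
have la : 0 < - a by rewrite oppr_gt0.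
have [del' [C' [d'0 C'0 K]]] := damped_ode_decay b la C0 d0.
pose S := \sum_i \sum_j (complex.Re (Y i j) ^+ 2 + complex.Im (Y i j) ^+ 2).
have s0 i j : 0 <= complex.Re (Y i j) ^+ 2 + complex.Im (Y i j) ^+ 2.
  by rewrite addr_ge0 ?sqr_ge0.
have S0 : 0 <= S by apply: sumr_ge0 => i _; apply: sumr_ge0.
have YS i j : complex.Re (Y i j) ^+ 2 + complex.Im (Y i j) ^+ 2 <= S.
  rewrite /S (bigD1 i)//= (bigD1 j)//= -addrA lerDl addr_ge0 ?sumr_ge0// => k _.
  exact: sumr_ge0.
exists (S + C'), del'; split=> // [|i j t t0]; first exact: addr_ge0.
have E s : mexp (Y *m X) i j s =
    (a +i* b) * mexp Y i j s + mexp (Y *m (X - (a +i* b)%:M)) i j s.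
  by rewrite -mexpZ -mexpD mulmxBr mul_mx_scalar addrC subrK.
have Hp s : is_derive s (1 : R) (fun t => complex.Re (mexp Y i j t))
   (- - a * complex.Re (mexp Y i j s) - b * complex.Im (mexp Y i j s)
     + complex.Re (mexp (Y *m (X - (a +i* b)%:M)) i j s)).
  have [h _] := is_derive_mexp Y i j s; apply: ptder_eq h _; rewrite E opprK.
  by case: (mexp Y i j s) => c k; case: (mexp _ _ _ _).
have Hq s : is_derive s (1 : R) (fun t => complex.Im (mexp Y i j t))
   (- - a * complex.Im (mexp Y i j s) + b * complex.Re (mexp Y i j s)
     + complex.Im (mexp (Y *m (X - (a +i* b)%:M)) i j s)).
  have [_ h] := is_derive_mexp Y i j s; apply: ptder_eq h _; rewrite E opprK.
  by case: (mexp Y i j s) => c k; case: (mexp _ _ _ _) => * /=.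
have := K _ _ _ _ Hp Hq (H i j) t t0; rewrite !mexp_at0 => /le_trans; apply.
by rewrite ler_wpM2r ?expR_ge0// lerD2r.
Qed.

(** Induction on the list of roots: Y (X - z) is annihilated by the remaining factors, so it decays,
    and peeling off z passes the decay to Y. With no factor left, Y = 0. Repeated roots need no
    separate treatment. *)
Lemma exp_decays_prod (s : seq R[i]) p (Y : 'M[R[i]]_(p, N)) :
  (forall z, z \in s -> complex.Re z < 0) ->
  Y *m (\prod_(z <- s) (X - z%:M)) = 0 -> exp_decays Y.
Proof.
elim: s p Y => [|z s IH] p Y Hs.
  rewrite big_nil mulmx1 => ->; exists 0, 1; split=> // i j t _.
  rewrite /mexp cegf_const => [|k _]; last by rewrite mul0mx mxE.
  by rewrite mul0mx mxE /= expr0n /= addr0 mul0r.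
rewrite big_cons -mulmxE mulmxA => H0.
apply: (@exp_decays_peel _ _ z); first by rewrite Hs ?mem_head.
by apply: IH H0 => w ws; rewrite Hs// in_cons ws orbT.
Qed.

End MatrixExponential.

(** As 0 is a simple root, the characteristic polynomial is the indeterminate times a product q over
    roots of negative real part; Cayley-Hamilton then reads X q(X) = 0, which is the hypothesis of
    [exp_decays_prod] for Y = X. *)
Lemma exp_decays_image (R : realType) (N : nat) (X : 'M[R[i]]_N) :
  (forall z : R[i], eigenvalue X z -> complex.Re z < 0 \/ z = 0) ->
  mup 0 (char_poly X) = 1%N -> exp_decays X X.
Proof.
case: N X => [|N] X Hev mup1.
  by exists 0, 1; split=> // -[].
have [r Er] := closed_field_poly_normal (char_poly X).
rewrite (monicP (char_poly_monic X)) scale1r in Er.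
have cp0 : char_poly X != 0 by rewrite monic_neq0 ?char_poly_monic.
have r0 : 0 \in r.
  rewrite -root_prod_XsubC -Er -dvdp_XsubCl XsubC_dvd// mup1//.
pose q := \prod_(z <- rem 0 r) ('X - z%:P).
have Eq : char_poly X = ('X - 0%:P) * q.
  by rewrite Er (perm_big _ (perm_to_rem r0)) big_cons.
have q0 : q != 0 by apply: contraNneq cp0 => q0; rewrite Eq q0 mulr0.
have nr : 0 \notin rem 0 r.
  rewrite -root_prod_XsubC -/q -dvdp_XsubCl XsubC_dvd//.
  have := mup1; rewrite Eq mupM ?polyXsubC_eq0// -['X - _]expr1 mup_XsubCX eqxx.
  by case; rewrite add0n => ->.
apply: (@exp_decays_prod _ _ X (rem 0 r)) => [z zr|].
  have ez : eigenvalue X z.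
    by rewrite eigenvalue_root_char Er root_prod_XsubC (mem_rem zr).
  by have [//|z0] := Hev z ez; rewrite z0 (negbTE nr) in zr.
have := Cayley_Hamilton X; rewrite Eq rmorphM /= subr0 horner_mx_X.
by rewrite rmorph_prod /=; under eq_bigr do rewrite rmorphB /= horner_mx_X horner_mx_C.
Qed.

(** * Coordinates with respect to a free family of functionals *)

Section DualCoordinates.
Context {R : realType} (F : Type) (P : F -> Prop) (N : nat).
Variable phi : 'I_N -> F -> R[i].
Hypothesis phi_free : forall u : 'rV[R[i]]_N,
  (forall psi, P psi -> \sum_i u 0 i * phi i psi = 0) -> u = 0.

Let M k (psi : 'I_k -> F) : 'M[R[i]]_(N, k) := \matrix_(i, j) phi i (psi j).

(** While the rank k is less than N, some nonzero u annihilates the columns already chosen; by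
    freeness u is nonzero on some admissible function, whose column is therefore independent of the
    others and is appended last. *)
Lemma dual_rank k : (k <= N)%N -> exists psi : 'I_k -> F,
  (forall j, P (psi j)) /\ \rank (M psi) = k.
Proof.
elim: k => [_|k IH kN].
  exists (fun j : 'I_0 => match notF (ltn_ord j) with end); split; first by case.
  by apply/eqP; rewrite -leqn0 rank_leq_col.
have [psi [Ppsi rk]] := IH (ltnW kN).
have /rowV0Pn[u uM u0] : kermx (M psi) != 0.
  by rewrite kermx_eq0 /row_free rk neq_ltn kN.
have [psi1 [P1 nz]] : exists psi1, P psi1 /\ \sum_i u 0 i * phi i psi1 != 0.
  apply: contrapT => H; case/eqP: u0; apply: phi_free => psi1 P1.
  by apply/eqP; apply/negPn/negP => nz; apply: H; exists psi1.
pose psi' (j : 'I_k.+1) := if unlift ord_max j is Some i then psi i else psi1.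
exists psi'; split=> [j|]; first by rewrite /psi'; case: unlift.
apply/eqP; rewrite eqn_leq rank_leq_col -{1}rk -![\rank (M _)]mxrank_tr.
apply: rank_ltmx; rewrite ltmxE; apply/andP; split.
  apply/row_subP => j; apply/submxP; exists (delta_mx 0 (lift ord_max j)).
  by rewrite -rowE; apply/rowP => i; rewrite !mxE /psi' liftK.
apply/negP => /submxP[D ED]; case/eqP: nz.
have : row ord_max (M psi')^T = row ord_max D *m (M psi)^T by rewrite -row_mul -ED.
have uM0 : u *m M psi = 0 by exact/sub_kermxP.
move=> /(congr1 (fun v => v *m u^T)); rewrite -mulmxA -trmx_mul uM0 trmx0 mulmx0.
move=> /matrixP/(_ 0 0); rewrite !mxE => E0; rewrite -[RHS]E0; apply: eq_bigr => i _.
by rewrite !mxE /psi' unlift_none mulrC.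
Qed.

(** N test functions with an invertible evaluation matrix recover u from its pairings. This converts
    the boundedness of [Pi], which is expressed with the dual norm, into bounds on coordinates. *)
Lemma dual_coordinates_bounded (nrm : F -> R) : exists2 K : R, 0 <= K &
  forall (u : 'rV[R[i]]_N) (c : R), 0 <= c ->
    (forall psi, P psi -> normc (\sum_i u 0 i * phi i psi) <= c * nrm psi) ->
    forall i, normc (u 0 i) <= K * c.
Proof.
have [psi [Ppsi rk]] := dual_rank (leqnn N).
have Mu : M psi \in unitmx by rewrite -row_free_unit /row_free rk.
pose K := \sum_(i : 'I_N) \sum_(j : 'I_N) `|nrm (psi j)| * normc (invmx (M psi) j i).
have t0 i j : 0 <= `|nrm (psi j)| * normc (invmx (M psi) j i).
  by rewrite mulr_ge0 ?normc_ge0.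
exists K => [|u c c0 H i]; first by apply: sumr_ge0 => i _; exact: sumr_ge0.
apply: (@le_trans _ _ ((\sum_(j : 'I_N) `|nrm (psi j)| * normc (invmx (M psi) j i)) * c)).
  rewrite -{1}[u](mulmxK Mu) mxE (le_trans (normc_sum _ _ _))// mulr_suml.
  apply: ler_sum => j _; rewrite normcM mulrAC ler_wpM2r ?normc_ge0// mulrC.
  rewrite mxE; under eq_bigr do rewrite mxE.
  by rewrite (le_trans (H _ (Ppsi j)))// ler_wpM2l// ler_norm.
rewrite ler_wpM2r// /K [leRHS](bigD1 i)//= lerDl.
by apply: sumr_ge0 => k _; exact: sumr_ge0.
Qed.

End DualCoordinates.

(** * Jet norms, and the part of the correlation governed by exp (t X) *)

Section FlowFunctionals.
Context {R : realType} {d : nat}.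
Variables (B : 'I_d -> set (plane R)) (gam : 'I_d -> R -> plane R).
Local Notation Omega0 := (Omega0 B).

(** The first alternative is the supremum of the empty set, met for instance when [Omega0] is empty;
    [fine] later sends it to 0, so the norms stay nonnegative. *)
Lemma ereal_sup_ge0_or (S : set (\bar R)) : (forall x, S x -> 0 <= x)%E ->
  ereal_sup S = -oo%E \/ (0 <= ereal_sup S)%E.
Proof.
move=> S0; have [[x Sx]|nS] := pselect (exists x, S x).
  by right; apply: (le_trans (S0 _ Sx)); exact: ereal_sup_ubound.
left; suff -> : S = set0 by rewrite ereal_sup0.
by apply/seteqP; split=> // x Sx; apply: nS; exists x.
Qed.

Lemma jet_norm_ge0_or l J : jet_norm B l J = -oo%E \/ (0 <= jet_norm B l J)%E.
Proof.
rewrite /jet_norm; set S1 := ereal_sup _; set S2 := ereal_sup _.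
have [->|h1] : S1 = -oo%E \/ (0 <= S1)%E.
- by apply: ereal_sup_ge0_or => _ [a [b [c [Z [_ _ ->]]]]]; rewrite lee_fin normc_ge0.
- by left; rewrite addNye.
have [->|h2] : S2 = -oo%E \/ (0 <= S2)%E.
- apply: ereal_sup_ge0_or => _ [a [b [c [X [Y [_ _ _ _ ->]]]]]].
  by rewrite lee_fin divr_ge0 ?normc_ge0// exprn_ge0// sqrtr_ge0.
- by left; rewrite addeNy.
by right; rewrite adde_ge0.
Qed.

Lemma fine_Cl_norm_ge0 l h : 0 <= fine (Cl_norm B l h).
Proof.
rewrite /Cl_norm; set S := (X in ereal_inf X).
have [SN|SN] := pselect (S -oo%E).
  suff -> : ereal_inf S = -oo%E by [].
  by apply/eqP; rewrite -leeNy_eq; exact: ereal_inf_lbound.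
rewrite fine_ge0//; apply: le_ereal_inf_tmp => _ [J hJ <-].
by have [h0|//] := jet_norm_ge0_or l J; case: SN; exists J.
Qed.

Lemma fine_Cl_norm_le l h J (K : R) : 0 <= K -> whitney_jet B l h J ->
  (jet_norm B l J <= K%:E)%E -> fine (Cl_norm B l h) <= K.
Proof.
move=> K0 hJ JK; have : (Cl_norm B l h <= K%:E)%E.
  by apply: le_trans JK; apply: ereal_inf_lbound; exists J.
by case: (Cl_norm B l h) => [r| |] //=.
Qed.

(* Pi f = (\int f) mu + u with u in the image of X, that is u = (u pinvmx X) X,
   and mu exp (t X) = mu. *)
Lemma pairing_decay (N : nat) (phi : 'I_N -> (phase R -> R[i]) -> R[i])
    (Pi : (phase R -> R[i]) -> 'rV[R[i]]_N) (X : 'M[R[i]]_N) (v : R) :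
  basis_in_dual_C1 B phi -> bounded_into_dual B gam phi Pi ->
  (forall z : R[i], eigenvalue X z -> (- v < complex.Re z < 0) \/ z = 0) ->
  simple_zero_contribution B gam phi Pi X ->
  exists C g : R, [/\ 0 <= C, 0 < g &
    forall t psi f, 0 <= t -> Cl B 1 psi -> Cl B 2 f -> C0_Omega B gam f ->
      normc (pairing phi (Pi f *m expmx (t%:C *: X)) psi
             - integral_m B psi * integral_m B f)
      <= C * (fine (Cl_norm B 2 f) + normc (integral_m B f))
           * fine (Cl_norm B 1 psi) * expR (- g * t)].
Proof.
move=> [_ phib phifree] [_ [K0 Pib]] Hev [mup1 [mu [muE muX Pimu]]].
have Hev' z : eigenvalue X z -> complex.Re z < 0 \/ z = 0.
  by move=> /Hev[/andP[_ ?]|->]; [left|right].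
have [Ce [del [Ce0 del0 HX]]] := exp_decays_image Hev' mup1.
pose Kp i := xget 0 [set K : R | forall psi, Cl B 1 psi ->
  normc (phi i psi) <= K * fine (Cl_norm B 1 psi)].
have HKp i psi : Cl B 1 psi -> normc (phi i psi) <= Kp i * fine (Cl_norm B 1 psi).
  by rewrite /Kp; case: xgetP => [y _ /(_ psi)//|H]; have [K hK] := phib i; case: (H K).
have [K1 K10 HK1] := @dual_coordinates_bounded R _ (Cl B 1) N phi phifree
   (fun psi => fine (Cl_norm B 1 psi)).
pose mu1 := \sum_i normc (mu 0 i).
have mu10 : 0 <= mu1 by apply: sumr_ge0 => i _; exact: normc_ge0.
pose P1 := \sum_i \sum_j normc (pinvmx X i j).
have P10 : 0 <= P1 by apply: sumr_ge0 => i _; apply: sumr_ge0 => j _; exact: normc_ge0.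
pose Kph := \sum_i `|Kp i|.
have Kph0 : 0 <= Kph by exact: sumr_ge0.
pose A := K1 * `|K0| + mu1.
have A0 : 0 <= A by rewrite addr_ge0// mulr_ge0.
(* The square root of [Ce] and the half of [del] come from taking the root of a bound on squared
   moduli; each factor [N%:R] comes from one matrix product. *)
exists (N%:R * (N%:R * A * P1) * Num.sqrt Ce * Kph), (del / 2); split.
- by rewrite !mulr_ge0// ?sqrtr_ge0// addr_ge0.
- by rewrite divr_gt0.
move=> t psi f t0 Cpsi Cf C0f.
set I := integral_m B f; set nf := fine (Cl_norm B 2 f).
set np := fine (Cl_norm B 1 psi).
have nf0 : 0 <= nf by exact: fine_Cl_norm_ge0.
have np0 : 0 <= np by exact: fine_Cl_norm_ge0.
pose u := Pi f - I *: mu; pose w := u *m pinvmx X.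
have uE : u = w *m X by rewrite /w mulmxKpV// Pimu.
have PiE : Pi f = I *: mu + w *m X by rewrite -uE /u addrC subrK.
have ub i : normc (u 0 i) <= A * (nf + normc I).
  rewrite !mxE (le_trans (normcB_le _ _))// normcM.
  rewrite mulrDr lerD//.
    rewrite /A mulrDl ler_wpDr ?mulr_ge0// -mulrA; apply: HK1; first exact: mulr_ge0.
    move=> psi1 C1; apply: (le_trans (Pib f psi1 Cf C0f C1)).
    by rewrite ler_wpM2r ?fine_Cl_norm_ge0// ler_wpM2r// ler_norm.
  rewrite mulrC ler_wpM2r ?normc_ge0// (@le_trans _ _ mu1)//.
    by rewrite /mu1 (bigD1 i)//= lerDl sumr_ge0// => j _; exact: normc_ge0.
  by rewrite /A lerDr mulr_ge0.
have nI0 : 0 <= nf + normc I by rewrite addr_ge0 ?normc_ge0.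
have wb i : normc (w 0 i) <= N%:R * A * P1 * (nf + normc I).
  rewrite mxE (le_trans (normc_sum _ _ _))//.
  apply: (@le_trans _ _ (\sum_(j : 'I_N) A * P1 * (nf + normc I))); last first.
    by rewrite sumr_const card_ord -[leLHS]mulr_natl !mulrA.
  apply: ler_sum => j _; rewrite normcM mulrAC ler_pM ?normc_ge0//.
  rewrite /P1 (bigD1 j)//= (bigD1 i)//= -addrA lerDl addr_ge0 ?sumr_ge0// => k _.
    exact: normc_ge0.
  by apply: sumr_ge0 => l _; exact: normc_ge0.
have muk : mu *m expmx (t%:C *: X) = mu.
  apply/rowP => i; rewrite mul_expmx /mexp cegf_const ?expr0 ?mulmx1//.
  by case=> // k _; rewrite exprS mulmxA muX mul0mx mxE.
have Xb i j : normc ((X *m expmx (t%:C *: X)) i j) <= Num.sqrt Ce * expR (- (del / 2) * t).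
  rewrite -(@ler_pXn2r _ 2)// ?nnegrE ?normc_ge0 ?mulr_ge0 ?sqrtr_ge0 ?expR_ge0//.
  rewrite normc_sqr exprMn sqr_sqrtr// [expR _ ^+ 2]expr2 -expRD mul_expmx.
  by rewrite (_ : - (del / 2) * t + - (del / 2) * t = - del * t); [exact: HX|field].
have E : pairing phi (Pi f *m expmx (t%:C *: X)) psi - integral_m B psi * I
    = pairing phi (w *m (X *m expmx (t%:C *: X))) psi.
  rewrite PiE mulmxDl -scalemxAl muk -mulmxA -(muE _ Cpsi) /pairing.
  under eq_bigr => i _ do rewrite mxE mulrDl.
  rewrite big_split /= addrAC mulr_suml -sumrB [X in X + _]big1 ?add0r// => i _.
  by rewrite mxE; ring.
rewrite E /pairing (le_trans (normc_sum _ _ _))//.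
set e := expR _ in Xb *.
apply: (@le_trans _ _ (\sum_(i : 'I_N) (N%:R * (N%:R * A * P1 * (nf + normc I))
   * (Num.sqrt Ce * e)) * (`|Kp i| * np))).
  apply: ler_sum => i _; rewrite normcM ler_pM ?normc_ge0//; last first.
    by rewrite (le_trans (HKp _ _ Cpsi))// ler_wpM2r// ler_norm.
  rewrite mxE (le_trans (normc_sum _ _ _))//.
  rewrite -mulrA mulr_natl -[X in _ *+ X](card_ord N) -sumr_const.
  by apply: ler_sum => j _; rewrite normcM ler_pM ?normc_ge0.
rewrite -mulr_sumr -mulr_suml -/Kph le_eqVlt; apply/orP; left; apply/eqP; ring.
Qed.

End FlowFunctionals.

(** * Whitney jets of tensor products *)

Section OneVariableJets.
Context {R : realType}.
Implicit Types (F : nat -> R -> R) (x y K : R).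

(* F a plays the role of the a-th derivative; the sum is indexed as in
   [taylor_rem], and m is the order of the expansion. *)
Definition taylor1 l F a m x y : R :=
  \sum_(i < l.+1 | (i <= m)%N) (x - y) ^+ i / i`!%:R * F (a + i)%N y.

(** The two values of [e] serve two purposes: e = 1 yields the little-o conditions of a Whitney jet,
    and e = 0 yields the bounded quotients of [jet_norm], including at large distances. *)
Definition jet1 l K F :=
  (forall a x, (a <= l)%N -> `|F a x| <= K) /\
  forall a m e x y, (a + m <= l)%N -> (e <= 1)%N ->
    `|F a x - taylor1 l F a m x y| <= K * `|x - y| ^+ (m + e).

Lemma taylor1_0 l F a x y : taylor1 l F a 0 x y = F a y.
Proof.
by rewrite /taylor1 big_mkcond big_ord_recl /= big1 // addr0 expr0 fact0 divr1 mul1r addn0.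
Qed.

Lemma taylor1S l F a m x y : (m < l)%N -> taylor1 l F a m.+1 x y =
  taylor1 l F a m x y + (x - y) ^+ m.+1 / m.+1`!%:R * F (a + m.+1)%N y.
Proof.
move=> ml; rewrite /taylor1.
rewrite (bigD1 (Ordinal (ml : (m.+1 < l.+1)%N)))//= addrC; congr (_ + _).
apply: eq_bigl => i; rewrite -(inj_eq val_inj) /=.
by rewrite [(i <= m.+1)%N]leq_eqVlt ltnS; case: eqP => [->|] /=; rewrite ?ltnn ?andbT ?andbF.
Qed.

Lemma is_derive_taylor1 l F a m x y : (m <= l)%N ->
  is_derive x (1 : R) (fun x => taylor1 l F a m x y)
    (if m is m'.+1 then taylor1 l F a.+1 m' x y else 0).
Proof.
elim: m => [_|m IH ml].
  rewrite (_ : (fun x => _) = (fun=> F a y)); first exact: ptder_cst.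
  by apply/funext => z; rewrite taylor1_0.
rewrite (_ : (fun x => _) = (fun x => taylor1 l F a m x y +
  (x - y) ^+ m.+1 * ((m.+1`!%:R)^-1 * F (a + m.+1)%N y))); last first.
  by apply/funext => z; rewrite taylor1S// mulrA.
have dX : is_derive x (1 : R) (fun x => (x - y) ^+ m.+1) (m.+1%:R * (x - y) ^+ m).
  have d1 : is_derive x (1 : R) (fun x => x - y) 1.
    by apply: ptder_eq (ptderD (ptder_id x) (ptder_cst (- y) x)) _; rewrite addr0.
  elim: m {IH ml} => [|m IH].
    by apply: ptder_eq d1 _; rewrite expr0 mulr1.
  rewrite (_ : (fun x => _) = (fun x => (x - y) * (x - y) ^+ m.+1)); last first.
    by apply/funext => z; rewrite exprS.
  apply: ptder_eq (ptderM d1 IH) _.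
  by rewrite mul1r mulrCA -exprS -[in RHS]nat1r mulrDl mul1r.
apply: ptder_eq (ptderD (IH (ltnW ml)) (ptderM dX (ptder_cst _ x))) _.
rewrite mulr0 addr0.
have E : m.+1%:R * (x - y) ^+ m * ((m.+1`!%:R)^-1 * F (a + m.+1)%N y) =
    (x - y) ^+ m / m`!%:R * F (a.+1 + m)%N y.
  rewrite addnS addSn factS natrM invfM.
  have : (m.+1%:R : R) != 0 by rewrite pnatr_eq0.
  have : (m`!%:R : R) != 0 by rewrite pnatr_eq0 -lt0n fact_gt0.
  move: (m.+1%:R : R) (m`!%:R : R) => A P h1 h2; field; exact/andP.
rewrite E; case: m ml {IH dX E} => [_|m ml].
  by rewrite add0r taylor1_0 expr0 fact0 divr1 mul1r addn0.
by rewrite taylor1S// ltnW.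
Qed.

Lemma MVT_bound (f df : R -> R) x y B :
  (forall t : R, is_derive t (1 : R) f (df t)) ->
  (forall t, `|t - y| <= `|x - y| -> `|df t| <= B) ->
  `|f x - f y| <= B * `|x - y|.
Proof.
move=> Hf HB.
have cf a b : {within `[a, b], continuous f}.
  exact: (derivable_within_continuous (fun x _ => @ex_derive _ _ _ _ _ _ _ (Hf x))).
have [xy|/ltW yx] := leP x y.
  have [c] := @MVT_segment R f df x y xy (fun x _ => Hf x) (cf x y).
  rewrite in_itv/= => /andP[xc cy]; rewrite distrC => ->.
  rewrite normrM [`|x - y|]distrC ler_wpM2r// HB//.
  by rewrite !ler0_norm ?subr_le0// lerN2 lerD2r.
have [c] := @MVT_segment R f df y x yx (fun x _ => Hf x) (cf y x).
rewrite in_itv/= => /andP[yc cx] ->; rewrite normrM ler_wpM2r// HB//.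
by rewrite !ger0_norm ?subr_ge0// lerD2r.
Qed.

(** Taylor's formula by induction on the order: the derivative of the remainder of [F a] is the
    remainder of [F a.+1] of one order less, and the Lipschitz bound on [F l] starts the induction
    at the top. The factor 2 is used when e = 0, where the last Taylor term is bounded
    separately. *)
Lemma jet1_of_derivatives l K F : 0 <= K ->
  (forall a t, (a < l)%N -> is_derive t (1 : R) (F a) (F a.+1 t)) ->
  (forall a x, (a <= l)%N -> `|F a x| <= K) ->
  (forall x y, `|F l x - F l y| <= K * `|x - y|) ->
  jet1 l (2 * K) F.
Proof.
move=> K0 dF bF lF.
have K2 : K <= 2 * K by rewrite ler_peMl// ler1n.
have main a m x y : (a + m <= l)%N ->
    `|F a x - taylor1 l F a m x y| <= K * `|x - y| ^+ m.+1.
  elim: m a x y => [|m IH] a x y aml.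
    rewrite taylor1_0 expr1; rewrite addn0 in aml.
    have := aml; rewrite leq_eqVlt => /predU1P[->//|al].
    by apply: MVT_bound (fun t => dF a t al) _ => t _; rewrite bF.
  have ml : (m.+1 <= l)%N by rewrite (leq_trans _ aml)// leq_addl.
  have al : (a < l)%N by rewrite (leq_trans _ aml)// -addn1 leq_add2l.
  pose g z := F a z - taylor1 l F a m.+1 z y.
  have dg t : is_derive t (1 : R) g (F a.+1 t - taylor1 l F a.+1 m t y).
    rewrite /g; have h := is_derive_taylor1 F a t y ml.
    exact: (ptderB (dF a t al) h).
  have gy : g y = 0.
    rewrite /g /taylor1 big_mkcond big_ord_recl /= big1 => [|i _]; last first.
      by rewrite subrr expr0n !mul0r if_same.
    by rewrite expr0 fact0 divr1 mul1r addn0 addr0 subrr.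
  have -> : F a x - taylor1 l F a m.+1 x y = g x - g y by rewrite gy subr0.
  rewrite exprSr mulrA; apply: MVT_bound dg _ => t txy.
  apply: le_trans (IH a.+1 t y _) _; first by rewrite addSnnS.
  by rewrite ler_wpM2l// lerXn2r// nnegrE.
split=> [a x al|a m [|[|//]] x y aml _]; first by rewrite (le_trans (bF _ _ al)).
  rewrite addn0; case: m aml => [|m] aml.
    rewrite taylor1_0 expr0 mulr1 (le_trans (ler_normB _ _))// mulr_natl mulr2n.
    by rewrite lerD// bF//; rewrite addn0 in aml.
  have ml : (m < l)%N by rewrite (leq_trans _ aml)// leq_addl.
  rewrite taylor1S// opprD addrA (le_trans (ler_normB _ _))// mulr_natl mulr2n mulrDl.
  rewrite lerD ?main//; first by rewrite (leq_trans _ aml)// leq_add2l.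
  rewrite !normrM normrX mulrC ler_pM//; first by rewrite bF.
  by rewrite normfV normr_nat ler_piMr// invf_le1 ?ltr0n ?fact_gt0// ler1n fact_gt0.
by rewrite addn1 (le_trans (main _ _ _ _ aml))// ler_wpM2r// exprn_ge0.
Qed.

End OneVariableJets.

Section TensorJets.
Context {R : realType}.
Implicit Types (K D : R).

(** Here [al i] is meant as the i-th Taylor term of one factor and [be i] as the Taylor polynomial
    of order n - i of the other, so that their products sum to the Taylor polynomial of order n of
    the product. One error comes from the first factor and at most l + 1 from the second, whence l +
    2. *)
Lemma truncated_product_bound (l n e : nat) (phi psi K L D : R) (al be : nat -> R) :
  0 <= K -> 0 <= L -> 0 <= D ->
  `|psi| <= L ->
  `|phi - \sum_(i < l.+1 | (i <= n)%N) al i| <= K * D ^+ (n + e) ->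
  (forall i, (i <= n)%N -> `|al i| <= K * D ^+ i) ->
  (forall i, (i <= n)%N -> `|psi - be i| <= L * D ^+ (n - i + e)) ->
  `|phi * psi - \sum_(i < l.+1 | (i <= n)%N) al i * be i|
     <= l.+2%:R * (K * L) * D ^+ (n + e).
Proof.
move=> K0 L0 D0 hpsi hphi hal hbe.
have -> : phi * psi - \sum_(i < l.+1 | (i <= n)%N) al i * be i =
    (phi - \sum_(i < l.+1 | (i <= n)%N) al i) * psi
    + \sum_(i < l.+1 | (i <= n)%N) al i * (psi - be i).
  under [X in _ = _ + X]eq_bigr do rewrite mulrBr.
  by rewrite mulrBl mulr_suml sumrB addrA subrK.
have -> : l.+2%:R * (K * L) * D ^+ (n + e) =
    K * L * D ^+ (n + e) + l.+1%:R * (K * L * D ^+ (n + e)).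
  by rewrite -natr1; ring.
rewrite (le_trans (ler_normD _ _))// lerD//.
  by rewrite normrM [leRHS]mulrAC ler_pM.
rewrite (le_trans (ler_norm_sum _ _ _))//.
apply: (@le_trans _ _ (\sum_(i < l.+1) K * L * D ^+ (n + e))); last first.
  by rewrite sumr_const card_ord mulr_natl.
have h0 : 0 <= K * L * D ^+ (n + e) by rewrite !mulr_ge0 ?exprn_ge0.
rewrite big_mkcond; apply: ler_sum => i _; case: ifPn => // hi; rewrite normrM.
have -> : (n + e = i + (n - i + e))%N by rewrite addnA subnKC.
by rewrite exprD mulrACA ler_pM// ?hal ?hbe.
Qed.

Definition rtaylor_rem (l : nat) (J : nat -> nat -> nat -> phase R -> R)
    (a b c : nat) (X Y : phase R) : R :=
  J a b c X -
  \sum_(a' < l.+1) \sum_(b' < l.+1)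
    \sum_(c' < l.+1 | (a + b + c + (a' + b' + c') <= l)%N)
      ((X.1.1 - Y.1.1) ^+ a' * (X.1.2 - Y.1.2) ^+ b' * (X.2 - Y.2) ^+ c'
         / (a'`! * b'`! * c'`!)%:R) * J (a + a')%N (b + b')%N (c + c')%N Y.

Definition tensor (F G H : nat -> R -> R) a b c (Z : phase R) : R :=
  F a Z.1.1 * (G b Z.1.2 * H c Z.2).

Lemma eucl_dist_ge (X Y : phase R) :
  [/\ `|X.1.1 - Y.1.1| <= eucl_dist X Y, `|X.1.2 - Y.1.2| <= eucl_dist X Y &
      `|X.2 - Y.2| <= eucl_dist X Y].
Proof.
rewrite /eucl_dist; set x := X.1.1 - _; set y := X.1.2 - _; set z := X.2 - _.
have [x0 y0 z0] : [/\ 0 <= x ^+ 2, 0 <= y ^+ 2 & 0 <= z ^+ 2] by rewrite !sqr_ge0.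
by split; rewrite -sqrtr_sqr ler_sqrt ?addr_ge0//; lra.
Qed.

Lemma eucl_dist_ge0 (X Y : phase R) : 0 <= eucl_dist X Y.
Proof. exact: sqrtr_ge0. Qed.

(** The sum over indices of bounded total degree is written as nested one-variable sums, each
    truncated at the degree left by the previous ones; [truncated_product_bound] then applies once
    for G H and once for F (G H). *)
Lemma tensor_rem_bound l K F G H a b c e X Y :
  0 <= K -> jet1 l K F -> jet1 l K G -> jet1 l K H ->
  (a + b + c <= l)%N -> (e <= 1)%N ->
  `|rtaylor_rem l (tensor F G H) a b c X Y| <=
    l.+2%:R ^+ 2 * K ^+ 3 * eucl_dist X Y ^+ (l - (a + b + c) + e).
Proof.
move=> K0 [bF jF] [bG jG] [bH jH] abc e1.
set D := eucl_dist X Y; set n := (l - (a + b + c))%N.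
have D0 : 0 <= D by exact: eucl_dist_ge0.
have [dx dy dz] := eucl_dist_ge X Y; rewrite -/D in dx dy dz.
set x := X.1.1 in dx *; set x' := Y.1.1 in dx *.
set y := X.1.2 in dy *; set y' := Y.1.2 in dy *.
set z := X.2 in dz *; set z' := Y.2 in dz *.
have pw (E : R) (p q : R) m : `|p - q| <= D -> E <= K * `|p - q| ^+ m -> E <= K * D ^+ m.
  by move=> pD /le_trans; apply; rewrite ler_wpM2l// lerXn2r// nnegrE.
pose al (F : nat -> R -> R) a p q (i : nat) := (p - q) ^+ i / i`!%:R * F (a + i)%N q.
have alb (F' : nat -> R -> R) a' p q i : (forall a x, (a <= l)%N -> `|F' a x| <= K) ->
    (a' + i <= l)%N -> `|p - q| <= D -> `|al F' a' p q i| <= K * D ^+ i.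
  move=> bF' ai pq; rewrite /al normrM mulrC ler_pM// ?bF'//.
  rewrite normrM normrX normfV normr_nat -[leRHS]mulr1 ler_pM ?exprn_ge0//.
    by rewrite lerXn2r// nnegrE.
  by rewrite invf_le1 ?ltr0n ?fact_gt0// ler1n fact_gt0.
(* The Taylor polynomial of G H of order n - i, for i <= n. *)
pose be1 i := \sum_(j < l.+1 | (j <= n - i)%N)
  al G b y y' j * taylor1 l H c (n - i - j) z z'.
have -> : rtaylor_rem l (tensor F G H) a b c X Y =
    F a x * (G b y * H c z) - \sum_(i < l.+1 | (i <= n)%N) al F a x x' i * be1 i.
  rewrite /rtaylor_rem; congr (_ - _).
  rewrite [RHS]big_mkcond /=; apply: eq_bigr => i _.
  rewrite (_ : (if _ then _ else _) = \sum_(j < l.+1)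
    if (i + j <= n)%N then al F a x x' i * (al G b y y' j * taylor1 l H c (n - i - j) z z')
    else 0); last first.
    case: ifPn => hi.
      rewrite /be1 mulr_sumr big_mkcond /=; apply: eq_bigr => j _.
      by rewrite (_ : (i + j <= n)%N = (j <= n - i)%N)//; lia.
    by rewrite big1// => j _; case: ifPn => //; lia.
  apply: eq_bigr => j _; case: ifPn => hij; last first.
    by rewrite big_pred0// => k; apply/negbTE; lia.
  rewrite /taylor1 2!mulr_sumr; apply: eq_big => [k|k _]; first by lia.
  rewrite /al /tensor !natrM -/x -/x' -/y -/y' -/z -/z'.
  have fz m : (m`!%:R : R) != 0 by rewrite pnatr_eq0 -lt0n fact_gt0.
  have := fz i; have := fz j; have := fz k.
  move: (i`!%:R : R) (j`!%:R : R) (k`!%:R : R) => p q r hr hq hp.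
  by field; rewrite hr hq hp.
have inner i : (i <= n)%N ->
    `|G b y * H c z - be1 i| <= l.+2%:R * (K * K) * D ^+ (n - i + e).
  move=> hi; apply: (@truncated_product_bound l (n - i) e _ _ K K D (al G b y y')
    (fun j => taylor1 l H c (n - i - j) z z')) => //; first by rewrite bH//; lia.
  - by apply: (pw _ y y' _ dy); apply: jG => //; lia.
  - by move=> j hj; apply: alb => //; lia.
  - by move=> j hj; apply: (pw _ z z' _ dz); apply: jH => //; lia.
have l2 : 1 <= l.+2%:R :> R by rewrite ler1n.
rewrite (_ : l.+2%:R ^+ 2 * K ^+ 3 = l.+2%:R * (K * (l.+2%:R * (K * K)))); last by ring.
apply: (@truncated_product_bound l n e _ _ K (l.+2%:R * (K * K)) D (al F a x x') be1) => //.
- by rewrite !mulr_ge0.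
- rewrite normrM (@le_trans _ _ (K * K))//.
    by rewrite ler_pM// ?bG ?bH//; lia.
  by rewrite ler_peMl ?mulr_ge0.
- by apply: (pw _ x x' _ dx); apply: jF => //; lia.
- by move=> j hj; apply: alb => //; lia.
Qed.

End TensorJets.

Section TensorSums.
Context {R : realType} {d : nat} (B : 'I_d -> set (plane R)).
Variables (I : finType) (cf : I -> R[i]) (F G H : I -> nat -> R -> R).
Implicit Types (X Y Z : phase R).

Definition tensor_sum a b c Z : R[i] :=
  \sum_p cf p * (tensor (F p) (G p) (H p) a b c Z)%:C.

Lemma taylor_rem_tensor_sum l a b c X Y :
  taylor_rem l tensor_sum a b c X Y =
  \sum_p cf p * (rtaylor_rem l (tensor (F p) (G p) (H p)) a b c X Y)%:C.
Proof.
rewrite /taylor_rem /rtaylor_rem.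
under [RHS]eq_bigr => p _ do rewrite rmorphB mulrBr.
rewrite sumrB; congr (_ - _).
pose r i j k : R := (X.1.1 - Y.1.1) ^+ i * (X.1.2 - Y.1.2) ^+ j * (X.2 - Y.2) ^+ k
  / (i`! * j`! * k`!)%:R.
rewrite [RHS](eq_bigr (fun p => \sum_(i < l.+1) \sum_(j < l.+1)
    \sum_(k < l.+1 | (a + b + c + (i + j + k) <= l)%N) (r i j k)%:C *
  (cf p * (tensor (F p) (G p) (H p) (a + i) (b + j) (c + k) Y)%:C))); last first.
  move=> p _; rewrite rmorph_sum mulr_sumr; apply: eq_bigr => i _.
  rewrite rmorph_sum mulr_sumr; apply: eq_bigr => j _.
  rewrite rmorph_sum mulr_sumr; apply: eq_bigr => k _.
  by rewrite rmorphM mulrCA.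
rewrite [RHS]exchange_big /=; apply: eq_bigr => i _.
rewrite [RHS]exchange_big /=; apply: eq_bigr => j _.
rewrite [RHS]exchange_big /=; apply: eq_bigr => k _.
by rewrite -mulr_sumr.
Qed.

Lemma normc_tensor_sum_le (M C : R) (r : I -> R) : 0 <= M -> 0 <= C ->
  (forall p, normc (cf p) <= M) -> (forall p, `|r p| <= C) ->
  normc (\sum_p cf p * (r p)%:C) <= #|I|%:R * M * C.
Proof.
move=> M0 C0 cfM rC; rewrite (le_trans (normc_sum _ _ _))//.
apply: (@le_trans _ _ (\sum_(p : I) M * C)).
  by apply: ler_sum => p _; rewrite normcM normc_real ler_pM ?normc_ge0.
by rewrite sumr_const -[leLHS]mulr_natl mulrA.
Qed.

Lemma tensor_sum_Cl (l : nat) (K M : R) (h : phase R -> R[i]) :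
  0 <= K -> 0 <= M -> (forall p, normc (cf p) <= M) ->
  (forall p, [/\ jet1 l K (F p), jet1 l K (G p) & jet1 l K (H p)]) ->
  (forall p a x (n : int), F p a (x + n%:~R) = F p a x) ->
  (forall p a x (n : int), G p a (x + n%:~R) = G p a x) ->
  (forall p a x (n : int), H p a (x + n%:~R * (2 * pi)) = H p a x) ->
  (forall Z, Omega0 B Z -> h Z = tensor_sum 0 0 0 Z) ->
  Cl B l h /\
  fine (Cl_norm B l h) <= 2 * (#|I|%:R * M * (l.+2%:R ^+ 2 * K ^+ 3)).
Proof.
move=> K0 M0 cfM jFGH pF pG pH hE.
set C := l.+2%:R ^+ 2 * K ^+ 3.
have C0 : 0 <= C by rewrite mulr_ge0 ?exprn_ge0.
have S0 : 0 <= #|I|%:R * M * C by rewrite !mulr_ge0.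
have rem a b c e X Y : (a + b + c <= l)%N -> (e <= 1)%N ->
    normc (taylor_rem l tensor_sum a b c X Y) <=
      #|I|%:R * M * C * eucl_dist X Y ^+ (l - (a + b + c) + e).
  move=> abc e1; rewrite taylor_rem_tensor_sum -mulrA.
  apply: normc_tensor_sum_le => // [|p]; first by rewrite mulr_ge0// exprn_ge0 ?eucl_dist_ge0.
  by have [hF hG hH] := jFGH p; exact: tensor_rem_bound.
have bd a b c Z : (a + b + c <= l)%N -> normc (tensor_sum a b c Z) <= #|I|%:R * M * C.
  move=> abc; apply: normc_tensor_sum_le => // p; rewrite /tensor.
  have [[hF _] [hG _] [hH _]] := jFGH p.
  have ab : (a + b <= l)%N by rewrite (leq_trans _ abc)// leq_addr.
  rewrite !normrM (@le_trans _ _ (K * (K * K)))//.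
    rewrite !ler_pM ?mulr_ge0// ?hF ?hG ?hH//.
    - by rewrite (leq_trans _ ab)// leq_addr.
    - by rewrite (leq_trans _ ab)// leq_addl.
    - by rewrite (leq_trans _ abc)// leq_addl.
  rewrite /C -[leLHS]mul1r (_ : K * (K * K) = K ^+ 3); last by ring.
  by rewrite ler_wpM2r ?exprn_ge0// exprn_ege1// ler1n.
have jet : whitney_jet B l h tensor_sum.
  split=> [Z /hE //|a b c abc n m k Z _|a b c abc e e0].
    by apply: eq_bigr => p _; rewrite /tensor /= pF pG pH.
  have q0 : 0 < #|I|%:R * M * C + 1 by rewrite ltr_wpDl.
  exists (e / (#|I|%:R * M * C + 1)) => [|X Y _ _ XY]; first by rewrite divr_gt0.
  apply: (le_trans (rem a b c 1%N X Y abc _)) => //.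
  rewrite addn1 exprS mulrA ler_wpM2r ?exprn_ge0 ?eucl_dist_ge0//.
  move: XY; rewrite ltr_pdivlMr// => /ltW; apply: le_trans.
  by rewrite mulrC ler_wpM2l ?eucl_dist_ge0// lerDl.
split; first by exists tensor_sum.
apply: (fine_Cl_norm_le _ jet); first by rewrite mulr_ge0.
rewrite /jet_norm mulr_natl mulr2n EFinD leeD//; apply: ge_ereal_sup.
  by move=> _ [a [b [c [Z [abc _ ->]]]]]; rewrite lee_fin bd.
move=> _ [a [b [c [X [Y [abc _ _ _ ->]]]]]]; rewrite lee_fin.
have := rem a b c 0%N X Y abc isT; rewrite addn0.
set D := _ ^+ _; have D0 : 0 <= D by rewrite exprn_ge0 ?eucl_dist_ge0.
have [->|Dn] := eqVneq D 0; first by rewrite invr0 !mulr0.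
by rewrite ler_pdivrMr// lt_neqAle eq_sym Dn.
Qed.

Lemma tensor_sum_continuous :
  (forall p, [/\ continuous (F p 0%N), continuous (G p 0%N) & continuous (H p 0%N)]) ->
  continuous (fun Z => complex.Re (tensor_sum 0 0 0 Z)) /\
  continuous (fun Z => complex.Im (tensor_sum 0 0 0 Z)).
Proof.
move=> cFGH.
have ct p : continuous (tensor (F p) (G p) (H p) 0 0 0).
  have [hF hG hH] := cFGH p; move=> Z; rewrite /tensor.
  have c1 : {for Z, continuous (fun Z : phase R => Z.1.1)}.
    by apply: (@continuous_comp _ _ _ (fun Z : phase R => Z.1) fst); exact: cvg_fst.
  have c2 : {for Z, continuous (fun Z : phase R => Z.1.2)}.
    apply: (@continuous_comp _ _ _ (fun Z : phase R => Z.1) snd);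
      [exact: cvg_fst|exact: cvg_snd].
  have c3 : {for Z, continuous (fun Z : phase R => Z.2)} by exact: cvg_snd.
  apply: cvgM; first exact: (continuous_comp c1 (hF _)).
  apply: cvgM; first exact: (continuous_comp c2 (hG _)).
  exact: (continuous_comp c3 (hH _)).
have cs (f : R[i] -> R) : (forall z w, f (z + w) = f z + f w) -> f 0 = 0 ->
    (forall z (r : R), f (z * r%:C) = f z * r) ->
    continuous (fun Z => f (tensor_sum 0 0 0 Z)).
  move=> fD f0 fM.
  rewrite (_ : (fun Z => _) = (fun Z => \sum_p f (cf p) * tensor (F p) (G p) (H p) 0 0 0 Z)).
    elim: (index_enum I) => [|p s IH] Z.
      by under eq_fun do rewrite big_nil; exact: cvg_cst.
    under eq_fun do rewrite big_cons.
    apply: cvgD; last exact: IH.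
    by apply: cvgM; [exact: cvg_cst|exact: ct].
  apply/funext => Z; rewrite /tensor_sum (big_morph f fD f0).
  by apply: eq_bigr => p _; rewrite fM.
by split; apply: cs => [[a b] [a' b']||[a b] r] //=; rewrite mulr0 ?subr0 ?add0r.
Qed.

End TensorSums.

(** * Smooth approximation *)

Section PositivePart.
Context {R : realType}.
Implicit Types (x y t : R).

Definition pospart x : R := Num.max 0 x.

Lemma pospart_ge0 x : 0 <= pospart x.
Proof. by rewrite /pospart le_max lexx. Qed.

Lemma pospart_lip x y : `|pospart x - pospart y| <= `|x - y|.
Proof.
have := ler_norm (x - y); have := ler_norm (y - x); rewrite [`|y - x|]distrC.
rewrite /pospart /Num.max ler_norml => h1 h2.
by case: (ltP 0 x) => hx; case: (ltP 0 y) => hy; apply/andP; split; lra.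
Qed.

(** Suited to the square of the positive part, which satisfies this bound even across its kink. *)
Lemma is_derive_quadratic (f : R -> R) x (L : R) :
  (forall h, `|f (h + x) - f x - L * h| <= h ^+ 2) -> is_derive x (1 : R) f L.
Proof.
move=> H.
have C : (fun h => h^-1 *: ((f \o shift x) (h *: (1 : R)) - f x)) @ 0^' --> L.
  apply/cvgrPdist_le => e e0; near=> h.
  have h0 : h != 0 by near: h; exact: nbhs_dnbhs_neq.
  have he : `|h| <= e.
    near: h; apply: dnbhs0_le => //.
  rewrite /= distrC -[h *: 1]/(h * 1) mulr1 -[_ *: _]/(h^-1 * _).
  have -> : h^-1 * (f (h + x) - f x) - L = h^-1 * (f (h + x) - f x - L * h).
    by field.
  rewrite normrM normfV mulrC ler_pdivrMr ?normr_gt0// (le_trans (H h))//.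
  by rewrite -[h ^+ 2]ger0_norm ?sqr_ge0// normrX expr2 ler_wpM2r.
by apply: DeriveDef; [apply/cvg_ex; exists L|exact: cvg_lim].
Unshelve. all: by end_near.
Qed.

Lemma is_derive_pospart2 x :
  is_derive x (1 : R) (fun x => pospart x ^+ 2) (2 * pospart x).
Proof.
apply: is_derive_quadratic => h; rewrite /pospart /Num.max.
have q := sqr_ge0 (h + x); have q2 := sqr_ge0 h.
case: (ltP 0 x) => x0; case: (ltP 0 (h + x)) => hx; rewrite ler_norml.
- by apply/andP; split; lra.
- have : 0 <= (- (h + x)) * (- h + x) by apply: mulr_ge0; lra.
  have : 0 <= x * (- h) by apply: mulr_ge0; lra.
  by move=> *; apply/andP; split; lra.
- have : 0 <= (h + x) * (- x) by apply: mulr_ge0; lra.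
  have : 0 <= (- x) * (- x) by apply: mulr_ge0; lra.
  by move=> *; apply/andP; split; lra.
- have := sqr_ge0 h.
  by move=> *; apply/andP; split; lra.
Qed.

Lemma is_derive_pospart3 x :
  is_derive x (1 : R) (fun x => pospart x ^+ 3) (3 * pospart x ^+ 2).
Proof.
have E y : pospart y ^+ 3 = y * pospart y ^+ 2.
  by rewrite /pospart /Num.max; case: ltP => _; [rewrite exprS|rewrite !expr0n mulr0].
rewrite (_ : (fun x => _) = (fun y => y * pospart y ^+ 2)); last exact/funext.
apply: ptder_eq (ptderM (ptder_id x) (is_derive_pospart2 x)) _.
rewrite mul1r /pospart /Num.max; case: ltP => _; first by ring.
by rewrite !expr0n /= !mulr0 addr0.
Qed.

End PositivePart.

Section Bump.
Context {R : realType}.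
Implicit Types (x y t : R) (j : nat).

Lemma cosD2piz t (n : int) : cos (t + n%:~R * (2 * pi)) = cos t :> R.
Proof.
have E (m : nat) s : cos (s + m%:R * (2 * pi)) = cos s :> R.
  rewrite (_ : m%:R * (2 * pi) = (pi *+ 2) *+ m); last by rewrite -[RHS]mulr_natl -[pi *+ 2]mulr_natl.
  exact: (periodicn (@cosD2pi R)).
case: n => m; first exact: E.
by rewrite NegzE mulrNz mulNr -{2}[t](subrK (m.+1%:R * (2 * pi))) E.
Qed.

Lemma sinD2piz t (n : int) : sin (t + n%:~R * (2 * pi)) = sin t :> R.
Proof. by rewrite -!cosBpihalf addrAC cosD2piz. Qed.

Definition bump_level j : R := cos (pi / 2 ^+ j).

(* max(0, cos t - cos (pi / 2 ^ j)) ^ 3, whose second derivative is Lipschitz, and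
   its first two derivatives. *)
Definition tbump j (a : nat) t : R :=
  let p := pospart (cos t - bump_level j) in
  match a with
  | 0 => p ^+ 3
  | 1 => - (3 * p ^+ 2 * sin t)
  | _ => 6 * p * sin t ^+ 2 - 3 * p ^+ 2 * cos t
  end.

#[global] Arguments tbump : simpl never.

Lemma bumpD2piz j a t (n : int) : tbump j a (t + n%:~R * (2 * pi)) = tbump j a t.
Proof. by rewrite /tbump cosD2piz sinD2piz. Qed.

Lemma is_derive_bump j a t : (a < 2)%N -> is_derive t (1 : R) (tbump j a) (tbump j a.+1 t).
Proof.
have du : is_derive t (1 : R) (fun t => cos t - bump_level j) (- sin t).
  by apply: ptder_eq (ptderB (is_derive_cos t) (ptder_cst _ t)) _; rewrite subr0.
case: a => [|[|//]] _; rewrite /tbump.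
  by apply: ptder_eq (ptder_comp (is_derive_pospart3 _) du) _; ring.
rewrite (_ : (fun t => _) =
  (fun t => -3 * (pospart (cos t - bump_level j) ^+ 2 * sin t))); last first.
  by apply/funext => s; ring.
apply: ptder_eq (ptderM (ptder_cst (-3) t)
  (ptderM (ptder_comp (is_derive_pospart2 _) du) (is_derive_sin t))) _.
ring.
Qed.

Let p j t := pospart (cos t - bump_level j).

Let p_bd j t : `|p j t| <= 2.
Proof.
rewrite ger0_norm ?pospart_ge0// /p /pospart ge_max ler0n /=.
have := cos_max t; have := cos_max (pi / 2 ^+ j : R); rewrite !ler_norml /bump_level; lra.
Qed.

Let sin_bd t : `|sin t| <= 1 :> R.
Proof. by rewrite -cosBpihalf cos_max. Qed.

Let cos_lip t s : `|cos t - cos s| <= `|t - s| :> R.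
Proof.
rewrite -[leRHS]mul1r; apply: (@ptder_lip _ (@cos R) (fun t => - sin t)) => z.
by rewrite normrN.
Qed.

Let sin_lip t s : `|sin t - sin s| <= `|t - s| :> R.
Proof.
rewrite -[leRHS]mul1r; apply: (@ptder_lip _ (@sin R) (@cos R)) => z.
exact: cos_max.
Qed.

Let p_lip j t s : `|p j t - p j s| <= `|t - s|.
Proof.
apply: le_trans (pospart_lip _ _) _.
by rewrite opprB addrA subrK; exact: cos_lip.
Qed.

Lemma lip_mul (f g : R -> R) (A a D b t s : R) : 0 <= a -> 0 <= b ->
  (forall t, `|f t| <= A) -> (forall t, `|g t| <= D) ->
  `|f t - f s| <= a * `|t - s| -> `|g t - g s| <= b * `|t - s| ->
  `|f t * g t - f s * g s| <= (a * D + A * b) * `|t - s|.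
Proof.
move=> a0 b0 fA gD fl gl.
have -> : f t * g t - f s * g s = (f t - f s) * g t + f s * (g t - g s) by ring.
rewrite (le_trans (ler_normD _ _))// [leRHS]mulrDl !normrM lerD//.
  by rewrite mulrAC ler_pM.
by rewrite -mulrA ler_pM.
Qed.

(** A common constant for the values and the Lipschitz constants at all orders. Its size is dictated
    by the Lipschitz constant of the second derivative in [bump_lip], namely 6 * 5 + 3 * 8. *)
Lemma bump_bound j a t : (a <= 2)%N -> `|tbump j a t| <= 54.
Proof.
have pb := p_bd j t; have p0 := pospart_ge0 (cos t - bump_level j).
have sb := sin_bd t; have cb := cos_max t.
move: pb; rewrite ger0_norm// => pb.
have p2 : 0 <= p j t ^+ 2 <= 4.
  by rewrite sqr_ge0 /= (_ : 4 = 2 ^+ 2) ?lerXn2r ?nnegrE// -natrX.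
case: a => [|[|[|//]]] _; rewrite /tbump /= -/(p j t).
- rewrite normrX [X in X ^+ 3]ger0_norm//; apply: (@le_trans _ _ (2 ^+ 3)).
    by rewrite lerXn2r ?nnegrE.
  by rewrite -natrX ler_nat.
- rewrite normrN normrM [X in X * _]ger0_norm; last by lra.
  by apply: (@le_trans _ _ (12 * 1)); [rewrite ler_pM//; lra|lra].
- have hX : 0 <= p j t * sin t ^+ 2 <= 2 * 1.
    rewrite mulr_ge0 ?sqr_ge0//= ler_pM ?sqr_ge0//.
  have : `|p j t ^+ 2 * cos t| <= 4 * 1.
    by rewrite normrM ler_pM// ger0_norm; lra.
  by rewrite !ler_norml => hY; lra.
Qed.

Lemma bump_lip j a t s : (a <= 2)%N -> `|tbump j a t - tbump j a s| <= 54 * `|t - s|.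
Proof.
rewrite leq_eqVlt => /predU1P[->|a2]; last first.
  apply: (@ptder_lip _ (tbump j a) (tbump j a.+1)) => z; first exact: is_derive_bump.
  by rewrite bump_bound.
rewrite /tbump /= -!/(p j _).
have one x : `|x| <= 1 * `|x| by rewrite mul1r.
have L1 : `|p j t * sin t - p j s * sin s| <= (1 * 1 + 2 * 1) * `|t - s|.
  by apply: (@lip_mul (p j) (@sin R)) => //; rewrite mul1r.
have L2 : `|p j t * sin t * sin t - p j s * sin s * sin s|
    <= ((1 * 1 + 2 * 1) * 1 + 2 * 1) * `|t - s|.
  apply: (@lip_mul (fun t => p j t * sin t) (@sin R)) => //; last by rewrite mul1r.
    by move=> z; rewrite normrM -[leRHS]mulr1 ler_pM.
have L3 : `|p j t * p j t - p j s * p j s| <= (1 * 2 + 2 * 1) * `|t - s|.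
  by apply: (@lip_mul (p j) (p j)) => //; rewrite mul1r.
have L4 : `|p j t * p j t * cos t - p j s * p j s * cos s|
    <= ((1 * 2 + 2 * 1) * 1 + 4 * 1) * `|t - s|.
  apply: (@lip_mul (fun t => p j t * p j t) (@cos R)) => //.
  - by move=> z; rewrite normrM (_ : 4 = 2 * 2) ?ler_pM// -natrM.
  - exact: cos_max.
  - by rewrite mul1r.
have -> : 6 * p j t * sin t ^+ 2 - 3 * p j t ^+ 2 * cos t
   - (6 * p j s * sin s ^+ 2 - 3 * p j s ^+ 2 * cos s) =
   6 * (p j t * sin t * sin t - p j s * sin s * sin s)
   - 3 * (p j t * p j t * cos t - p j s * p j s * cos s) by ring.
rewrite (le_trans (ler_normB _ _))// !normrM !normr_nat; lra.
Qed.

End Bump.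

Section BumpSums.
Context {R : realType}.
Implicit Types (x y t : R) (j N : nat).

Lemma bump_ge0 j t : 0 <= tbump j 0 t.
Proof. by rewrite exprn_ge0 ?pospart_ge0. Qed.

Lemma bump_support j t : tbump j 0 t != 0 ->
  exists n : int, `|t - n%:~R * (2 * pi)| <= pi / 2 ^+ j.
Proof.
move=> nz; have pi0 : 0 < pi :> R := pi_gt0 R.
have pj0 : 0 < pi / 2 ^+ j :> R by rewrite divr_gt0// exprn_gt0.
have pj1 : pi / 2 ^+ j <= pi :> R.
  rewrite ler_pdivrMr ?exprn_gt0// -[leLHS]mulr1 ler_wpM2l ?(ltW pi0)//.
  by rewrite exprn_ege1// ler1n.
have cb : bump_level j < cos t.
  rewrite ltNge; apply/negP => le; move: nz; rewrite /tbump.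
  by rewrite /pospart max_l ?subr_le0// expr0n eqxx.
(* Brings t into [- pi, pi), where cos is a decreasing function of the absolute value. *)
pose n := Num.floor ((t + pi) / (2 * pi)).
exists n; rewrite leNgt; apply/negP => lt.
set s := t - n%:~R * (2 * pi) in lt.
have cs : cos t = cos `|s|.
  have cabs : cos `|s| = cos s by case: (ger0P s) => // _; rewrite cosN.
  by rewrite cabs -(cosD2piz s n) /s subrK.
have s2 : `|s| <= pi.
  have p2 : 0 < 2 * pi :> R by rewrite mulr_gt0.
  have h1 : n%:~R * (2 * pi) <= t + pi by rewrite -ler_pdivlMr// floor_le_tmp.
  have h2 : t + pi < (n%:~R + 1) * (2 * pi).
    by rewrite -ltr_pdivrMr// -intrD1 floorD1_gt.
  by rewrite ler_norml /s; lra.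
move: cb; rewrite cs /bump_level ltr_cos ?in_itv/= ?normr_ge0//.
  by rewrite ltNge (ltW lt).
by rewrite ltW.
Qed.

(** Starts from 1 - cos pi = 2. With c the cosine of half the angle, the doubling formula gives 1 -
    cos = 2 (1 - c) (1 + c) <= 4 (1 - c), so each halving divides the quantity by at most 4. *)
Lemma bump_level_ge j : 2 / 4 ^+ j <= 1 - bump_level j :> R.
Proof.
elim: j => [|j IH].
  by rewrite /bump_level !expr0 !divr1 cospi; lra.
have E : bump_level j = 2 * bump_level j.+1 ^+ 2 - 1 :> R.
  rewrite /bump_level; have := @cos_mulr2n R (pi / 2 ^+ j.+1).
  rewrite (_ : pi / 2 ^+ j.+1 *+ 2 = pi / 2 ^+ j) => [->|]; last first.
    by rewrite exprS -mulr_natl; field; rewrite gt_eqF// exprn_gt0.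
  by rewrite -mulr_natl.
have c1 : -1 <= (bump_level j.+1 : R) <= 1 by rewrite -ler_norml cos_max.
rewrite exprS invfM mulrCA.
have : 1 - (bump_level j : R) <= 4 * (1 - bump_level j.+1).
  rewrite E; have : 0 <= (1 - bump_level j.+1 : R) * (1 - bump_level j.+1) by rewrite -expr2 sqr_ge0.
  by lra.
by move: IH; set q := 2 / 4 ^+ j; lra.
Qed.

Lemma bump0_ge j : 8 / 64 ^+ j <= tbump j 0 0 :> R.
Proof.
rewrite /tbump cos0 /pospart.
have h := bump_level_ge j; have h0 : 0 <= 2 / 4 ^+ j :> R by rewrite divr_ge0// exprn_ge0.
rewrite max_r; last exact: le_trans h.
apply: le_trans (_ : (2 / 4 ^+ j) ^+ 3 <= _); last by rewrite lerXn2r// nnegrE (le_trans h0).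
by rewrite exprMn exprVn -exprM mulnC exprM -!natrX.
Qed.

Definition bump_sum j N t : R := \sum_(i < N) tbump j 0 (t - 2 * pi * (i%:R / N%:R)).

Lemma bump_sum_shift j N t : (0 < N)%N ->
  bump_sum j N (t + 2 * pi / N%:R) = bump_sum j N t.
Proof.
case: N => // N _; rewrite /bump_sum big_ord_recl [RHS]big_ord_recr /= [LHS]addrC.
have N0 : (N.+1%:R : R) != 0 by rewrite pnatr_eq0.
congr (_ + _).
  apply: eq_bigr => i _.
  congr (tbump _ _ _); rewrite /bump /= -natr1; field.
  by rewrite ?natr1 ?nat1r.
rewrite -(bumpD2piz _ _ _ (-1)); congr (tbump _ _ _).
rewrite mul0r mulr0 subr0 mulN1r.
have -> : (N%:R : R) = N.+1%:R - 1 by rewrite -natr1 addrK.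
by field.
Qed.

(* [bump_sum j N] has period 2 pi / N and Lipschitz constant 54 N. *)
Lemma bump_sum_close j N t : (0 < N)%N ->
  `|bump_sum j N t - bump_sum j N 0| <= 54 * (2 * pi).
Proof.
move=> N0; have pi0 : 0 < pi :> R := pi_gt0 R.
have NR : 0 < N%:R :> R by rewrite ltr0n.
pose de : R := 2 * pi / N%:R.
have de0 : 0 < de by rewrite divr_gt0// mulr_gt0.
have shn (m : nat) s : bump_sum j N (s + m%:R * de) = bump_sum j N s.
  elim: m => [|m IH]; first by rewrite mul0r addr0.
  by rewrite -natr1 mulrDl mul1r addrA bump_sum_shift.
have shz (n : int) u : bump_sum j N (u - n%:~R * de) = bump_sum j N u.
  case: n => m; first by rewrite -[in RHS](subrK (m%:R * de) u) shn.
  by rewrite NegzE mulrNz mulNr opprK shn.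
pose k := Num.floor (t / de).
pose s := t - k%:~R * de.
rewrite -(shz k t) -/s.
have s0 : `|s| <= de.
  have h1 : k%:~R * de <= t by rewrite -ler_pdivlMr// floor_le_tmp.
  have h2 : t < (k%:~R + 1) * de by rewrite -ltr_pdivrMr// -intrD1 floorD1_gt.
  by rewrite ger0_norm /s; lra.
rewrite /bump_sum -sumrB (le_trans (ler_norm_sum _ _ _))//.
apply: (@le_trans _ _ (\sum_(i < N) 54 * de)).
  apply: ler_sum => i _; apply: le_trans (bump_lip _ _ _ _) _ => //.
  by rewrite ler_wpM2l// opprB addrA subrK subr0.
rewrite sumr_const card_ord -mulr_natr le_eqVlt; apply/orP; left.
by apply/eqP; rewrite /de; field; rewrite gt_eqF.
Qed.

(* Number of nodes per coordinate: the variation of [bump_sum j N] is at most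
   54 (2 pi) whatever N, so N has to be so large that [bump_sum j N 0] is at least
   54 * 8 * 2 ^ j. *)
Definition grid j : nat := (108 * 64 ^ j * (108 * 128 ^ j)).

Lemma grid_gt0 j : (0 < grid j)%N.
Proof. by rewrite /grid !muln_gt0 !expn_gt0. Qed.

(** Only the first m = 108 * 128 ^ j nodes are counted. Their angles are at most 8 / (108 * 64 ^ j),
    so the Lipschitz constant 54 lets the bump lose at most 4 / 64 ^ j of a peak value of at least 8
    / 64 ^ j, and m * 4 / 64 ^ j = 432 * 2 ^ j. *)
Lemma bump_sum0_ge j : 432 * 2 ^+ j <= bump_sum j (grid j) 0.
Proof.
have pi0 : 0 < pi :> R := pi_gt0 R.
have pi4 : pi < 4 :> R by have := pihalf_lt2 R; lra.
set m := (108 * 128 ^ j)%N; set N := grid j.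
have NE : N = (108 * 64 ^ j * m)%N by [].
have mN : (m <= N)%N by rewrite NE leq_pmull// muln_gt0 expn_gt0.
have NR : 0 < N%:R :> R by rewrite ltr0n grid_gt0.
have q0 : 0 < 64 ^+ j :> R by rewrite exprn_gt0.
rewrite /bump_sum; apply: (@le_trans _ _ (\sum_(i < N | (i < m)%N) (4 / 64 ^+ j))).
  rewrite -(big_ord_widen N (fun=> 4 / 64 ^+ j) mN) sumr_const card_ord -[leRHS]mulr_natl /m natrM natrX.
  have -> : (128 : R) = 64 * 2 by rewrite -natrM.
  rewrite exprMn le_eqVlt; apply/orP; left; apply/eqP; field.
  by rewrite gt_eqF.
rewrite big_mkcond; apply: ler_sum => i _; case: ifPn => [im|_]; last exact: bump_ge0.
have h : 8 / 64 ^+ j <= tbump j 0 0 :> R := bump0_ge j.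
set th : R := 2 * pi * (i%:R / N%:R).
have th0 : 0 <= th by rewrite !mulr_ge0 ?invr_ge0 ?(ltW pi0)// ltW.
have := bump_lip j (0 - th) 0 (isT : (0 <= 2)%N).
rewrite subr0 sub0r normrN (ger0_norm th0) ler_norml.
have : th <= 2 * 4 * (1 / (108 * 64 ^+ j)).
  rewrite /th ler_pM ?mulr_ge0 ?invr_ge0 ?(ltW pi0)//; first by lra.
  have NE' : N%:R = 108 * 64 ^+ j * m%:R :> R by rewrite NE !natrM natrX.
  have c0 : 0 < 108 * 64 ^+ j :> R by rewrite mulr_gt0.
  rewrite mul1r ler_pdivrMr// NE' mulrA mulVf ?mul1r ?gt_eqF//.
  by rewrite ler_nat ltnW.
have -> : 1 / (108 * 64 ^+ j) = (64 ^+ j)^-1 / 108 :> R.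
  by field; rewrite gt_eqF.
set q := (64 ^+ j)^-1 in h * => h1 /andP[h2 _].
have qq : 0 < q by rewrite invr_gt0.
lra.
Qed.

Definition weight j N t : R := bump_sum j N t / bump_sum j N 0.

(** Since 2 pi < 8, the variation 54 (2 pi) is below 54 * 8 = 432, which is at most the value at 0
    divided by 2 ^ j. *)
Lemma weight_close j t : `|weight j (grid j) t - 1| <= 1 / 2 ^+ j.
Proof.
have h := bump_sum0_ge j; have c := bump_sum_close j t (grid_gt0 j).
have p0 : 0 < 2 ^+ j :> R by rewrite exprn_gt0.
have W0 : 0 < bump_sum j (grid j) 0.
  by apply: lt_le_trans h; apply: mulr_gt0 p0; rewrite ltr0n.
rewrite /weight -[X in _ - X](divff (lt0r_neq0 W0)) -mulrBl normrM normfV.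
rewrite (gtr0_norm W0) ler_pdivrMr// (le_trans c)//.
rewrite mul1r ler_pdivlMl// mulrC; apply: le_trans h.
rewrite ler_wpM2r ?(ltW p0)//; have := pihalf_lt2 R; lra.
Qed.

End BumpSums.

(** * Hoelder functions on the torus *)

Section HolderBounds.
Context {R : realType} {d : nat} (B : 'I_d -> set (plane R)).
Implicit Types (Z : phase R) (h : phase R -> R[i]).

Lemma eucl_dist_le_sum Z Z' :
  eucl_dist Z Z' <= `|Z.1.1 - Z'.1.1| + `|Z.1.2 - Z'.1.2| + `|Z.2 - Z'.2|.
Proof.
rewrite /eucl_dist; set x := _ - _; set y := _ - _; set z := _ - _.
have s0 : 0 <= `|x| + `|y| + `|z| by rewrite !addr_ge0.
rewrite -[leRHS]ger0_norm// -sqrtr_sqr ler_sqrt ?sqr_ge0//.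
rewrite -[x ^+ 2]real_normK ?num_real// -[y ^+ 2]real_normK ?num_real//.
rewrite -[z ^+ 2]real_normK ?num_real//.
have : 0 <= `|x| * `|y| by rewrite mulr_ge0.
have : 0 <= `|x| * `|z| by rewrite mulr_ge0.
have : 0 <= `|y| * `|z| by rewrite mulr_ge0.
move: (`|x|) (`|y|) (`|z|) => a b c; lra.
Qed.

Lemma int_dist_ge1 (n n' : int) : n != n' -> 1 <= `|n%:~R - n'%:~R| :> R.
Proof.
move=> nn; rewrite -intrB -intr_norm (_ : 1 = (1%:~R : R))// ler_int.
by move: nn; rewrite -subr_eq0; lia.
Qed.

Lemma tdist_le Z Z' (n m k : int) : tdist Z Z' <= eucl_dist Z (shift3 n m k Z').
Proof.
apply: ge_inf; last by exists n, m, k.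
by exists 0 => _ [n' [m' [k' ->]]]; exact: eucl_dist_ge0.
Qed.

Lemma eucl_dist_triangle_shift Z Z' (n m k n' m' k' : int) :
  (n, m, k) != (n', m', k') ->
  1 <= 3 * (eucl_dist Z (shift3 n m k Z') + eucl_dist Z (shift3 n' m' k' Z')).
Proof.
move=> neq.
have [h1 h2 h3] := eucl_dist_ge Z (shift3 n m k Z').
have [h1' h2' h3'] := eucl_dist_ge Z (shift3 n' m' k' Z').
move: h1 h2 h3 h1' h2' h3'; set D := eucl_dist _ _; set D' := eucl_dist _ _.
rewrite /shift3 /shift2 /= => h1 h2 h3 h1' h2' h3'.
have D0 : 0 <= D := eucl_dist_ge0 _ _; have D'0 : 0 <= D' := eucl_dist_ge0 _ _.
suff : 1 <= D + D' by lra.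
have tri (x x' y : R) (n1 n2 : int) (c : R) : 1 <= c ->
    `|x - (y + n1%:~R * c)| <= D -> `|x - (y + n2%:~R * c)| <= D' -> n1 != n2 ->
    1 <= D + D'.
  move=> c1 e1 e2 /int_dist_ge1 e3.
  apply: (@le_trans _ _ (`|n1%:~R - n2%:~R| * `|c|)).
    by rewrite -[leLHS]mulr1 ler_pM// ger0_norm// (le_trans _ c1).
  rewrite -normrM (_ : _ * _ = (x - (y + n2%:~R * c)) - (x - (y + n1%:~R * c))); last by ring.
  by rewrite (le_trans (ler_normB _ _))// addrC lerD.
case: (eqVneq n n') => [nn|nn]; last first.
  by apply: (tri Z.1.1 0 Z'.1.1 n n' 1); rewrite ?mulr1.
case: (eqVneq m m') => [mm|mm]; last first.
  by apply: (tri Z.1.2 0 Z'.1.2 m m' 1); rewrite ?mulr1.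
case: (eqVneq k k') => [kk|kk]; first by rewrite nn mm kk eqxx in neq.
apply: (tri Z.2 0 Z'.2 k k' (2 * pi)) => //.
by have := pi_ge2 R; lra.
Qed.

Lemma eucl_dist_eq0 Z Z' : eucl_dist Z Z' = 0 -> Z = Z'.
Proof.
move=> D0; have [] := eucl_dist_ge Z Z'; rewrite D0 !normr_le0 !subr_eq0.
by case: Z {D0} => [[x y] z]; case: Z' => [[x' y'] z'] /= /eqP-> /eqP-> /eqP->.
Qed.

(** The distances to two different translates add up to at least 1 / 3, so at most one is below 1 /
    6: the infimum is either that one, which is positive, or at least 1 / 6. *)
Lemma tdist_gt0 Z Z' : ~ same_point Z Z' -> 0 < tdist Z Z'.
Proof.
move=> ns.
have pos n m k : 0 < eucl_dist Z (shift3 n m k Z').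
  rewrite lt_neqAle eucl_dist_ge0 andbT eq_sym; apply/eqP => /eucl_dist_eq0 E.
  by apply: ns; exists n, m, k.
have [[n [m [k lt]]]|far] :=
    pselect (exists n m k : int, eucl_dist Z (shift3 n m k Z') < 1 / 6).
  apply: (@lt_le_trans _ _ (eucl_dist Z (shift3 n m k Z'))) => //.
  apply: lb_le_inf; first by exists (eucl_dist Z (shift3 n m k Z')), n, m, k.
  move=> _ [n' [m' [k' ->]]].
  have [[-> -> ->]//|/eqP neq] := pselect ((n, m, k) = (n', m', k')).
  by have := eucl_dist_triangle_shift Z Z' neq; lra.
apply: (@lt_le_trans _ _ (1 / 6)); first by lra.
apply: lb_le_inf; first by exists (eucl_dist Z (shift3 0 0 0 Z')), 0, 0, 0.
move=> _ [n [m [k ->]]]; rewrite leNgt; apply/negP => lt.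
by apply: far; exists n, m, k.
Qed.

Lemma holder_norm_ge0_or kappa h :
  holder_norm B kappa h = -oo%E \/ (0 <= holder_norm B kappa h)%E.
Proof.
rewrite /holder_norm; set S1 := ereal_sup _; set S2 := ereal_sup _.
have [->|h1] : S1 = -oo%E \/ (0 <= S1)%E.
- by apply: ereal_sup_ge0_or => _ [Z _ <-]; rewrite lee_fin normc_ge0.
- by left; rewrite addNye.
have [->|h2] : S2 = -oo%E \/ (0 <= S2)%E.
- apply: ereal_sup_ge0_or => _ [Z [Z' [_ _ _ ->]]].
  by rewrite lee_fin divr_ge0 ?normc_ge0// powR_ge0.
- by left; rewrite addeNy.
by right; rewrite adde_ge0.
Qed.

(** The Hoelder bound is put in a form free of the infimum in [tdist]: any bound r on the distance
    to some translate may be used. *)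
Lemma holder_bounds kappa h : 0 < kappa -> holder B kappa h ->
  let H := fine (holder_norm B kappa h) in
  [/\ 0 <= H, forall Z, Omega0 B Z -> normc (h Z) <= H &
      forall Z Z' (n m k : int) (r : R), Omega0 B Z -> Omega0 B Z' ->
        eucl_dist Z (shift3 n m k Z') <= r ->
        normc (h Z - h Z') <= H * r `^ kappa].
Proof.
move=> k0 [per fin] H.
have H0 : 0 <= H.
  by rewrite /H; have [->|h0] := holder_norm_ge0_or kappa h; rewrite //= fine_ge0.
suff main Z0 : Omega0 B Z0 -> exists2 s : R * R, 0 <= s.1 /\ 0 <= s.2 & [/\ H = s.1 + s.2,
    forall Z, Omega0 B Z -> normc (h Z) <= s.1 &
    forall Z Z', Omega0 B Z -> Omega0 B Z' -> ~ same_point Z Z' ->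
      normc (h Z - h Z') / tdist Z Z' `^ kappa <= s.2].
  split=> // [Z OZ|Z Z' n m k r OZ OZ' Zr].
    have [[s1 s2] /= [p1 p2] [-> hs _]] := main Z OZ.
    by rewrite (le_trans (hs _ OZ))// lerDl.
  have r0 : 0 <= r by exact: le_trans (eucl_dist_ge0 _ _) Zr.
  have [[s1 s2] /= [p1 p2] [HE _ hs]] := main Z OZ.
  have [[n' [m' [k' ->]]]|ns] := pselect (same_point Z Z').
    rewrite per// subrr (_ : normc 0 = 0) ?normc_zero//.
    by rewrite mulr_ge0 ?powR_ge0.
  have tp := tdist_gt0 ns; have pp : 0 < tdist Z Z' `^ kappa by rewrite powR_gt0.
  have := hs _ _ OZ OZ' ns; rewrite ler_pdivrMr// => /le_trans; apply.
  rewrite ler_pM ?powR_ge0//; first by rewrite HE lerDr.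
  rewrite ge0_ler_powR ?nnegrE ?(ltW k0) ?(ltW tp)//.
  exact: le_trans (tdist_le _ _ _ _ _) Zr.
move=> OZ0.
(* A second point of [Omega0], distinct on the torus because 1 is not a multiple of 2 pi; it shows
   that the supremum of the quotients is not taken over the empty set, so that both suprema are
   finite. *)
have ns : ~ same_point Z0 (Z0.1, Z0.2 + 1).
  case=> n [m [k /(congr1 snd) /=]] E.
  have {E} : k%:~R * (2 * pi) = -1 :> R by lra.
  have p2 := pi_ge2 R.
  have [->|k1] := eqVneq k 0; first by rewrite mul0r; lra.
  move=> E; have := int_dist_ge1 k1; rewrite subr0 => h1.
  have := congr1 Num.norm E; rewrite normrM normrN1 [X in _ * X]ger0_norm; last by lra.
  have h0 : 1 * 4 <= `|k%:~R| * (2 * pi) :> R by rewrite ler_pM//; lra.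
  lra.
move: fin; rewrite /H /holder_norm; set S1 := ereal_sup _; set S2 := ereal_sup _.
have S1b Z : Omega0 B Z -> ((normc (h Z))%:E <= S1)%E.
  by move=> OZ; apply: ereal_sup_ubound; exists Z.
have S2b Z Z' : Omega0 B Z -> Omega0 B Z' -> ~ same_point Z Z' ->
    ((normc (h Z - h Z') / tdist Z Z' `^ kappa)%:E <= S2)%E.
  by move=> *; apply: ereal_sup_ubound; exists Z, Z'.
have S10 : (0 <= S1)%E by apply: le_trans (S1b _ OZ0); rewrite lee_fin normc_ge0.
have S20 : (0 <= S2)%E.
  apply: le_trans (S2b _ (Z0.1, Z0.2 + 1) OZ0 OZ0 ns).
  by rewrite lee_fin divr_ge0 ?normc_ge0 ?powR_ge0.
case: S1 S10 S1b => [s1| |] // S10 S1b; case: S2 S20 S2b => [s2| |] // S20 S2b _.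
by exists (s1, s2); split.
Qed.

End HolderBounds.

Section ScaledBump.
Context {R : realType}.

(** 54 bounds the bump and its derivatives, (2 pi) ^ 3 the chain rule factors s ^ a for a <= 3 (the
    third power comes from the Lipschitz bound on the second derivative), and 2 is the factor of
    [jet1_of_derivatives]. *)
Definition jet_const : R := 2 * (54 * (2 * pi) ^+ 3).

Lemma jet_const_ge0 : 0 <= jet_const.
Proof. by rewrite /jet_const mulr_ge0// mulr_ge0// exprn_ge0// mulr_ge0// pi_ge0. Qed.

Lemma scaled_bump_jet (j l : nat) (s phi : R) : (l <= 2)%N -> 0 <= s <= 2 * pi ->
  jet1 l jet_const (fun a x => s ^+ a * tbump j a (s * x - phi)).
Proof.
move=> l2 /andP[s0 sp].
have p1 : 1 <= 2 * pi :> R by have := pi_ge2 R; lra.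
have p0 : 0 <= 2 * pi :> R by lra.
have sa a : (a <= 3)%N -> s ^+ a <= (2 * pi) ^+ 3.
  move=> a3; apply: (@le_trans _ _ ((2 * pi) ^+ a)); first by rewrite lerXn2r// nnegrE.
  by rewrite ler_weXn2l.
have K0 : 0 <= 54 * (2 * pi) ^+ 3 :> R by rewrite mulr_ge0// exprn_ge0.
apply: jet1_of_derivatives => // [a t al|a x al|x y].
- have al' : (a < 2)%N by rewrite (leq_trans al).
  have dl : is_derive t (1 : R) (fun x => s * x - phi) s.
    apply: ptder_eq (ptderB (ptderM (ptder_cst s t) (ptder_id t)) (ptder_cst phi t)) _.
    by rewrite mul0r add0r mulr1 subr0.
  apply: ptder_eq (ptderM (ptder_cst (s ^+ a) t)
    (ptder_comp (is_derive_bump j _ al') dl)) _.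
  by rewrite mul0r add0r exprSr mulrA.
- rewrite normrM (ger0_norm (exprn_ge0 a s0)) mulrC.
  rewrite ler_pM ?exprn_ge0// ?bump_bound// ?(leq_trans al)// sa//.
  by rewrite (leq_trans al)// (leq_trans l2).
- rewrite -mulrBr normrM (ger0_norm (exprn_ge0 l s0)).
  apply: (@le_trans _ _ (s ^+ l * (54 * (s * `|x - y|)))).
    rewrite ler_wpM2l ?exprn_ge0//; apply: (le_trans (bump_lip _ _ _ l2)).
    rewrite ler_wpM2l// -(ger0_norm s0) -normrM mulrBr (ger0_norm s0).
    by rewrite opprB addrA subrK.
  rewrite (_ : s ^+ l * _ = 54 * s ^+ l.+1 * `|x - y|); last by rewrite exprS; ring.
  by rewrite ler_wpM2r// ler_wpM2l// sa.
Qed.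

Lemma continuous_scaled_bump (j : nat) (s phi : R) :
  continuous (fun x => s ^+ 0 * tbump j 0 (s * x - phi)).
Proof.
move=> t.
have dl : is_derive t (1 : R) (fun x => s * x - phi) s.
  apply: ptder_eq (ptderB (ptderM (ptder_cst s t) (ptder_id t)) (ptder_cst phi t)) _.
  by rewrite mul0r add0r mulr1 subr0.
have [/derivable1_diffP/differentiable_continuous//] := ptderM (ptder_cst (s ^+ 0) t)
    (ptder_comp (is_derive_bump j _ (isT : (0 < 2)%N)) dl).
Qed.

End ScaledBump.

Section Approximation.
Context {R : realType} {d : nat} (B : 'I_d -> set (plane R)) (gam : 'I_d -> R -> plane R).
Variable j : nat.
Implicit Types (Z : phase R).

Definition node := ('I_(grid j) * 'I_(grid j) * 'I_(grid j))%type.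
Definition node_angle (i : 'I_(grid j)) : R := 2 * pi * (i%:R / (grid j)%:R).

Let F (p : node) a x := (2 * pi) ^+ a * tbump j a (2 * pi * x - node_angle p.1.1) : R.
Let G (p : node) a x := (2 * pi) ^+ a * tbump j a (2 * pi * x - node_angle p.1.2) : R.
Let H (p : node) a x := 1 ^+ a * tbump j a (1 * x - node_angle p.2) : R.

Definition node_weight (p : node) Z : R := tensor (F p) (G p) (H p) 0 0 0 Z.

(** Normalized by a constant, not by the total weight at Z: the approximant remains a finite sum of
    tensor products, at the price of the error 7 / 2 ^ j of [total_weight_close]. *)
Definition approx (c : node -> R[i]) Z : R[i] :=
  \sum_p c p * (bump_sum j (grid j) 0 ^- 3)%:C * (node_weight p Z)%:C.

Lemma node_weightE p Z : node_weight p Z =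
  tbump j 0 (2 * pi * Z.1.1 - node_angle p.1.1) *
  (tbump j 0 (2 * pi * Z.1.2 - node_angle p.1.2) * tbump j 0 (Z.2 - node_angle p.2)).
Proof. by rewrite /node_weight /tensor /F /G /H !expr0 !mul1r. Qed.

Lemma node_weight_ge0 p Z : 0 <= node_weight p Z.
Proof.
rewrite node_weightE.
exact: mulr_ge0 (bump_ge0 _ _) (mulr_ge0 (bump_ge0 _ _) (bump_ge0 _ _)).
Qed.

Let W0 : R := bump_sum j (grid j) 0.

Let W0_ge1 : 1 <= W0.
Proof.
apply: le_trans (bump_sum0_ge j).
have : 1 <= 2 ^+ j :> R by rewrite exprn_ege1// ler1n.
lra.
Qed.

(** The jets of the bumps are bounded uniformly in j and the normalizing constant is at least 1, so
    the growth of the norm comes only from the number of nodes. *)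
Lemma approx_Cl (l : nat) (c : node -> R[i]) (M : R) : (l <= 2)%N -> 0 <= M ->
  (forall p, normc (c p) <= M) ->
  Cl B l (approx c) /\
  fine (Cl_norm B l (approx c)) <=
    2 * ((grid j ^ 3)%:R * M * (l.+2%:R ^+ 2 * jet_const ^+ 3)).
Proof.
move=> l2 M0 cM.
have p0 : 0 <= 2 * pi :> R by rewrite mulr_ge0// pi_ge0.
have -> : (grid j ^ 3 = #|{: node}|)%N.
  by rewrite !card_prod !card_ord !expnS expn0 muln1 mulnA.
apply: (@tensor_sum_Cl _ _ _ _ (fun p => c p * (W0 ^- 3)%:C) F G H) => //.
- exact: jet_const_ge0.
- move=> p; rewrite normcM normc_real -[leRHS]mulr1 ler_pM ?normc_ge0//.
  rewrite ger0_norm ?invr_ge0 ?exprn_ge0 ?(le_trans _ W0_ge1)//.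
  by rewrite invf_le1 ?exprn_gt0 ?(lt_le_trans _ W0_ge1)// exprn_ege1.
- move=> p; split; apply: scaled_bump_jet => //; rewrite ?p0 ?lexx ?ler01//=.
  by have := pi_ge2 R; lra.
- move=> p a x n; rewrite /F; congr (_ * _).
  by rewrite mulrDr addrAC [2 * pi * n%:~R]mulrC bumpD2piz.
- move=> p a x n; rewrite /G; congr (_ * _).
  by rewrite mulrDr addrAC [2 * pi * n%:~R]mulrC bumpD2piz.
- by move=> p a x n; rewrite /H !mul1r addrAC bumpD2piz.
Qed.

Lemma approx_periodic (c : node -> R[i]) : torus_periodic B (approx c).
Proof.
move=> n m k Z _; apply: eq_bigr => p _; congr (_ * _%:C).
rewrite !node_weightE /shift3 /shift2 /=.
have E (x a : R) (q : int) : 2 * pi * (x + q%:~R) - a = (2 * pi * x - a) + q%:~R * (2 * pi).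
  by ring.
by rewrite !E [Z.2 + _ - _]addrAC !bumpD2piz.
Qed.

Lemma approx_continuous (c : node -> R[i]) :
  continuous (fun Z => complex.Re (approx c Z)) /\
  continuous (fun Z => complex.Im (approx c Z)).
Proof.
apply: (@tensor_sum_continuous _ _ (fun p => c p * (W0 ^- 3)%:C) F G H).
by move=> p; split; exact: continuous_scaled_bump.
Qed.

Lemma sum_node_weight Z : \sum_p node_weight p Z =
  bump_sum j (grid j) (2 * pi * Z.1.1) *
  (bump_sum j (grid j) (2 * pi * Z.1.2) * bump_sum j (grid j) Z.2).
Proof.
rewrite (eq_bigr _ (fun p _ => node_weightE p Z)) /bump_sum.
rewrite -(pair_bigA _ (fun (q : 'I_(grid j) * 'I_(grid j)) (l : 'I_(grid j)) =>
  tbump j 0 (2 * pi * Z.1.1 - node_angle q.1) *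
  (tbump j 0 (2 * pi * Z.1.2 - node_angle q.2) * tbump j 0 (Z.2 - node_angle l)))) /=.
rewrite -(pair_bigA _ (fun i k : 'I_(grid j) => \sum_l
  tbump j 0 (2 * pi * Z.1.1 - node_angle i) *
  (tbump j 0 (2 * pi * Z.1.2 - node_angle k) * tbump j 0 (Z.2 - node_angle l)))) /=.
rewrite mulr_suml; apply: eq_bigr => i _.
rewrite mulr_suml mulr_sumr; apply: eq_bigr => k _.
by rewrite mulr_sumr mulr_sumr.
Qed.

Definition total_weight Z : R := \sum_p node_weight p Z / W0 ^+ 3.

(** A product of three factors, each within q = 2 ^ (- j) <= 1 of 1 and hence at most 2; replacing
    them by 1 one after the other costs 4 q + 2 q + q. *)
Lemma total_weight_close Z : `|total_weight Z - 1| <= 7 / 2 ^+ j.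
Proof.
rewrite /total_weight -mulr_suml sum_node_weight.
have W0n : W0 != 0 by rewrite gt_eqF// (lt_le_trans _ W0_ge1).
have := weight_close j (2 * pi * Z.1.1); have := weight_close j (2 * pi * Z.1.2).
have := weight_close j Z.2.
set a := weight _ _ Z.2; set b := weight _ _ (_ * Z.1.2); set c := weight _ _ _.
have q1 : 1 / 2 ^+ j <= 1 :> R.
  by rewrite ler_pdivrMr ?exprn_gt0// mul1r exprn_ege1// ler1n.
have q0 : 0 <= 1 / 2 ^+ j :> R by rewrite divr_ge0// exprn_ge0.
rewrite (_ : 7 / 2 ^+ j = 7 * (1 / 2 ^+ j)); last by rewrite mul1r.
move: q0 q1; set q := 1 / 2 ^+ j => q0 q1 ha hb hc.
have bd u : `|u - 1| <= q -> `|u| <= 2 by rewrite !ler_norml; lra.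
have -> : bump_sum j (grid j) (2 * pi * Z.1.1) *
    (bump_sum j (grid j) (2 * pi * Z.1.2) * bump_sum j (grid j) Z.2) / W0 ^+ 3 = c * (b * a).
  by rewrite /a /b /c /weight -/W0; field.
have -> : c * (b * a) - 1 = (c - 1) * (b * a) + (b - 1) * a + (a - 1) by ring.
have h1 : `|(c - 1) * (b * a)| <= q * (2 * 2).
  by rewrite normrM ler_pM// normrM ler_pM// bd.
have h2 : `|(b - 1) * a| <= q * 2 by rewrite normrM ler_pM// bd.
have := ler_normD ((c - 1) * (b * a) + (b - 1) * a) (a - 1).
have := ler_normD ((c - 1) * (b * a)) ((b - 1) * a).
lra.
Qed.

Lemma total_weight_bound Z : 0 <= total_weight Z <= 8.
Proof.
have := total_weight_close Z.
have : 7 / 2 ^+ j <= 7 :> R.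
  by rewrite ler_pdivrMr ?exprn_gt0// -[leLHS]mulr1 ler_wpM2l// exprn_ege1// ler1n.
rewrite ler_norml => h1 /andP[_ h2]; apply/andP; split; last by lra.
apply: sumr_ge0 => p _; rewrite divr_ge0 ?node_weight_ge0// exprn_ge0//.
exact: le_trans W0_ge1.
Qed.

Let node_coef_ge0 p Z : 0 <= node_weight p Z / W0 ^+ 3.
Proof.
rewrite divr_ge0 ?node_weight_ge0// exprn_ge0//; exact: le_trans W0_ge1.
Qed.

Lemma approxE (c : node -> R[i]) Z :
  approx c Z = \sum_p c p * (node_weight p Z / W0 ^+ 3)%:C.
Proof.
apply: eq_bigr => p _; rewrite -mulrA; congr (_ * _).
by rewrite -rmorphM mulrC.
Qed.

Lemma approx_bound (c : node -> R[i]) (M : R) Z : 0 <= M ->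
  (forall p, normc (c p) <= M) -> normc (approx c Z) <= 8 * M.
Proof.
move=> M0 cM; have /andP[T0 T8] := total_weight_bound Z.
rewrite approxE (le_trans (normc_sum _ _ _))//.
apply: (@le_trans _ _ (\sum_p M * (node_weight p Z / W0 ^+ 3))).
  apply: ler_sum => p _; rewrite normcM normc_real ger0_norm ?node_coef_ge0//.
  by rewrite ler_wpM2r ?node_coef_ge0.
by rewrite -mulr_sumr mulrC ler_wpM2r.
Qed.

Lemma approx_close (c : node -> R[i]) (v : R[i]) (M del : R) Z : 0 <= del ->
  normc v <= M -> (forall p, node_weight p Z != 0 -> normc (c p - v) <= del) ->
  normc (approx c Z - v) <= 8 * del + 7 * M / 2 ^+ j.
Proof.
move=> del0 vM H0.
have /andP[T0 T8] := total_weight_bound Z.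
have -> : approx c Z - v = \sum_p (c p - v) * (node_weight p Z / W0 ^+ 3)%:C
    + v * (total_weight Z - 1)%:C.
  rewrite approxE; under [X in _ = X + _]eq_bigr do rewrite mulrBl.
  rewrite sumrB -mulr_sumr -rmorph_sum -/(total_weight Z).
  by rewrite rmorphB rmorph1; ring.
rewrite (le_trans (normcD_le _ _))// lerD//; last first.
  rewrite normcM normc_real mulrAC mulrC ler_pM ?normc_ge0// ?total_weight_close//.
rewrite (le_trans (normc_sum _ _ _))//.
apply: (@le_trans _ _ (\sum_p del * (node_weight p Z / W0 ^+ 3))).
  apply: ler_sum => p _; rewrite normcM normc_real ger0_norm ?node_coef_ge0//.
  have [w0|w0] := eqVneq (node_weight p Z) 0; first by rewrite w0 mul0r !mulr0.
  by rewrite ler_wpM2r ?node_coef_ge0// H0.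
by rewrite -mulr_sumr mulrC ler_wpM2r.
Qed.

End Approximation.

(** * Sampling of an observable on the grid *)

Section Sampling.
Context {R : realType} {d : nat} (B : 'I_d -> set (plane R)) (gam : 'I_d -> R -> plane R).
Implicit Types (Z : phase R) (h : phase R -> R[i]) (bad : set (plane R)) (j : nat).

Definition curves : set (plane R) :=
  [set q | exists i (n m : int) s, q = shift2 n m (gam i s)].

Definition near_torus j (q q' : plane R) := exists n m : int,
  `|q.1 - (q'.1 + n%:~R)| <= 1 / 2 ^+ j /\ `|q.2 - (q'.2 + m%:~R)| <= 1 / 2 ^+ j.

(** Bumps have half-width pi / 2 ^ j in angle, so two points of one support differ by at most 2 pi /
    2 ^ j in the velocity angle and, after division by 2 pi, 1 / 2 ^ j in each position coordinate;
    10 comes from 1 + 1 + 8. *)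
Lemma node_support j (p : node j) Z Z' :
  node_weight p Z != 0 -> node_weight p Z' != 0 ->
  near_torus j Z.1 Z'.1 /\
  exists n m k : int, eucl_dist Z (shift3 n m k Z') <= 10 / 2 ^+ j.
Proof.
have key (t t' : R) (a : R) : tbump j 0 (t - a) != 0 -> tbump j 0 (t' - a) != 0 ->
    exists n : int, `|t - (t' + n%:~R * (2 * pi))| <= 2 * pi * (1 / 2 ^+ j).
  move=> /bump_support[n hn] /bump_support[n' hn']; exists (n - n').
  rewrite (_ : t - _ = (t - a - n%:~R * (2 * pi)) - (t' - a - n'%:~R * (2 * pi))).
    rewrite (le_trans (ler_normB _ _))// (_ : 2 * pi * _ = pi / 2 ^+ j + pi / 2 ^+ j).
      exact: lerD.
    by ring.
  by rewrite intrB; ring.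
have pi0 : 0 < 2 * pi :> R by rewrite mulr_gt0// pi_gt0.
have key2 (x x' a : R) : tbump j 0 (2 * pi * x - a) != 0 ->
    tbump j 0 (2 * pi * x' - a) != 0 ->
    exists n : int, `|x - (x' + n%:~R)| <= 1 / 2 ^+ j.
  move=> h h'; have [n hn] := key _ _ _ h h'; exists n.
  rewrite -(ler_pM2l pi0) -{1}(gtr0_norm pi0) -normrM.
  rewrite (_ : _ * (x - _) = 2 * pi * x - (2 * pi * x' + n%:~R * (2 * pi))) ?hn//.
  by ring.
have nz3 (a b c : R) : a * (b * c) != 0 -> [/\ a != 0, b != 0 & c != 0].
  by rewrite !mulf_eq0 !negb_or => /and3P[].
rewrite !node_weightE => /nz3[h1 h2 h3] /nz3[h1' h2' h3'].
have [n hn] := key2 _ _ _ h1 h1'; have [m hm] := key2 _ _ _ h2 h2'.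
have [k hk] := key _ _ _ h3 h3'.
split; first by exists n, m.
exists n, m, k; apply: (le_trans (eucl_dist_le_sum _ _)).
rewrite /shift3 /shift2 /=.
have pi4 : pi < 4 :> R by have := pihalf_lt2 R; lra.
have q0 : 0 <= 1 / 2 ^+ j :> R by rewrite divr_ge0// exprn_ge0.
rewrite (_ : 10 / 2 ^+ j = 10 * (1 / 2 ^+ j)); last by rewrite mul1r.
have : 2 * pi * (1 / 2 ^+ j) <= 8 * (1 / 2 ^+ j) :> R by rewrite ler_wpM2r//; lra.
lra.
Qed.

(* The coefficient of the bump p: the value of h at some point of Omega0 in its
   support, or 0 if there is none or if the support meets the bad set. *)
Definition sample j h bad (p : node j) : R[i] :=
  if `[< (exists Z, Omega0 B Z /\ node_weight p Z != 0) /\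
         ~ (exists Z, bad Z.1 /\ node_weight p Z != 0) >]
  then h (xget (0, 0, 0) [set Z | Omega0 B Z /\ node_weight p Z != 0]) else 0.

Lemma sample_bound j h bad (p : node j) (H : R) : 0 <= H ->
  (forall Z, Omega0 B Z -> normc (h Z) <= H) -> normc (sample h bad p) <= H.
Proof.
move=> H0 hH; rewrite /sample; case: asboolP => [[[Z PZ] _]|_]; last by rewrite normc_zero.
case: xgetP => [Z' -> [OZ _]|/(_ Z)/(_ PZ)//]; exact: hH.
Qed.

Lemma approx_sample_close j h bad (kappa : R) Z : 0 < kappa -> holder B kappa h ->
  Omega0 B Z -> (forall q, bad q -> ~ near_torus j Z.1 q) ->
  normc (approx (@sample j h bad) Z - h Z) <=
    (8 * (10 / 2 ^+ j) `^ kappa + 7 / 2 ^+ j) * fine (holder_norm B kappa h) :> R.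
Proof.
move=> k0 hol OZ far; have [H0 hH hL] := holder_bounds k0 hol.
set H := fine _ in H0 hH hL *.
have -> : (8 * (10 / 2 ^+ j) `^ kappa + 7 / 2 ^+ j) * H =
    8 * (H * (10 / 2 ^+ j) `^ kappa) + 7 * H / 2 ^+ j by ring.
apply: approx_close; [by rewrite mulr_ge0// powR_ge0|exact: hH|].
move=> p pZ; rewrite /sample asboolT; last first.
  split; first by exists Z.
  by case=> Z' [bZ' pZ']; have [near _] := node_support pZ pZ'; exact: far bZ' near.
case: xgetP => [Z' -> [OZ' pZ']|/(_ Z)]; last by case.
have [_ [n [m [k D]]]] := node_support pZ' pZ.
exact: hL D.
Qed.

Lemma approx_sample_bad j h bad Z : bad Z.1 -> approx (@sample j h bad) Z = 0.
Proof.
move=> bZ; rewrite /approx big1// => p _.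
have [->|pZ] := eqVneq (node_weight p Z) 0; first by rewrite mulr0.
rewrite /sample asboolF ?mul0r//; by case=> _; apply; exists Z.
Qed.

(** Elastic pairs lie over boundary points, where every retained bump vanishes, so both sides of the
    collision condition are 0. *)
Lemma approx_sample_C0 j h : C0_Omega B gam (approx (@sample j h curves)).
Proof.
have [cR cI] := approx_continuous (@sample j h curves).
split; [exact: approx_periodic|exact: continuous_subspaceT cR|
  exact: continuous_subspaceT cI|].
move=> q w w' _ [i [n [m [s /= [qE _ _]]]]].
by rewrite !approx_sample_bad//=; exists i, n, m, s.
Qed.

End Sampling.

(** * Small sets of phase space *)

Notation phase_measure R := ((@lebesgue_measure R \x @lebesgue_measure R)
  \x @lebesgue_measure R)%E.
Notation measurable_phase R :=
  (measurableTypeR R * measurableTypeR R * measurableTypeR R)%type.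

Section BoundaryLayer.
Context {R : realType}.

Lemma C3_lipschitz_on (h : R -> R) (L : R) : C3 h -> 0 < L ->
  exists2 K : R, 0 <= K & forall s t, 0 <= s <= L -> 0 <= t <= L ->
    `|h s - h t| <= K * `|s - t|.
Proof.
move=> [dh _] L0.
have d0 s : derivable h s 1 := dh 0%N s isT.
have c1 : {within `[0, L], continuous (fun s => `|derive1 h s|)}.
  apply: continuous_subspaceT => s; apply: continuous_comp; last exact: norm_continuous.
  exact/differentiable_continuous/derivable1_diffP/(dh 1%N s isT).
have [c _ cmax] := EVT_max (ltW L0) c1.
exists `|derive1 h c| => // .
have main s t : 0 <= s -> s <= t -> t <= L -> `|h t - h s| <= `|derive1 h c| * `|t - s|.
  move=> s0 st tL.
  have [u] := @MVT_segment R h (derive1 h) s t st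
    (fun x _ => DeriveDef (d0 x) (esym (derive1E h x)))
    (derivable_within_continuous (fun x _ => d0 x)).
  rewrite in_itv/= => /andP[su ut] ->; rewrite normrM ler_wpM2r//.
  by apply: cmax; rewrite in_itv/= (le_trans s0 su) (le_trans ut tL).
move=> s t /andP[s0 sL] /andP[t0 tL]; have [st|/ltW ts] := leP s t; last exact: main.
by rewrite distrC [`|s - t|]distrC main.
Qed.

Lemma periodic_reduce (T : Type) (g : R -> T) (L : R) : 0 < L ->
  (forall s, g (s + L) = g s) -> forall s, exists2 s', 0 <= s' < L & g s = g s'.
Proof.
move=> L0 per.
have shn (m : nat) s : g (s + m%:R * L) = g s.
  elim: m => [|m IH]; first by rewrite mul0r addr0.
  by rewrite -natr1 mulrDl mul1r addrA per.
have shz (n : int) s : g (s - n%:~R * L) = g s.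
  case: n => m; first by rewrite -[in RHS](subrK (m%:R * L) s) shn.
  by rewrite NegzE mulrNz mulNr opprK shn.
move=> s; pose k := Num.floor (s / L); exists (s - k%:~R * L); last by rewrite shz.
have h1 : k%:~R * L <= s by rewrite -ler_pdivlMr// floor_le_tmp.
have h2 : s < (k%:~R + 1) * L by rewrite -ltr_pdivrMr// -intrD1 floorD1_gt.
by apply/andP; split; lra.
Qed.

(** A period is cut into 2 ^ j equal intervals, and both coordinates are Lipschitz in the
    parameter. *)
Lemma loop_net (g : R -> plane R) : convex_C3_loop g ->
  exists D M : R, [/\ 0 <= D, 0 <= M,
    forall s, `|(g s).1| <= M /\ `|(g s).2| <= M &
    forall j, exists s_ : 'I_(2 ^ j) -> R, forall s, exists a,
      `|(g s).1 - (g (s_ a)).1| <= D / 2 ^+ j /\ `|(g s).2 - (g (s_ a)).2| <= D / 2 ^+ j].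
Proof.
case=> [C1 C2 [L L0 [per _]] _].
have [K1 K10 lip1] := C3_lipschitz_on C1 L0.
have [K2 K20 lip2] := C3_lipschitz_on C2 L0.
have red := periodic_reduce L0 per.
exists ((K1 + K2) * L), (`|(g 0).1| + `|(g 0).2| + (K1 + K2) * L).
have DL : 0 <= (K1 + K2) * L by rewrite mulr_ge0 ?addr_ge0// ltW.
split=> //; first by rewrite !addr_ge0.
  move=> s; have [s' /andP[s0 sL] ->] := red s.
  have sb : 0 <= s' <= L by rewrite s0 ltW.
  have zb : 0 <= (0 : R) <= L by rewrite lexx ltW.
  have h1 := lip1 _ _ sb zb; have h2 := lip2 _ _ sb zb.
  rewrite subr0 (ger0_norm s0) in h1 h2.
  have e1 : K1 * s' <= K1 * L by rewrite ler_wpM2l// ltW.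
  have e2 : K2 * s' <= K2 * L by rewrite ler_wpM2l// ltW.
  have f1 : 0 <= K1 * L by rewrite mulr_ge0// ltW.
  have f2 : 0 <= K2 * L by rewrite mulr_ge0// ltW.
  have g1 := ler_normD ((g s').1 - (g 0).1) (g 0).1.
  have g2 := ler_normD ((g s').2 - (g 0).2) (g 0).2.
  rewrite !subrK in g1 g2.
  have n1 := normr_ge0 (g 0).1; have n2 := normr_ge0 (g 0).2.
  by split; lra.
move=> j; have p0 : 0 < 2 ^+ j :> R by rewrite exprn_gt0.
exists (fun a => a%:R * (L / 2 ^+ j)) => s.
have [s' /andP[s0 sL] ->] := red s.
pose a := Num.truncn (s' / (L / 2 ^+ j)).
have q0 : 0 < L / 2 ^+ j by rewrite divr_gt0.
have s0' : 0 <= s' / (L / 2 ^+ j) by rewrite divr_ge0// ltW.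
have /andP[a1 a2] := truncn_itv s0'.
rewrite -/a ler_pdivlMr// in a1; rewrite -/a ltr_pdivrMr// in a2.
have aj : (a < 2 ^ j)%N.
  rewrite -(ltr_nat R) natrX -(ltr_pM2r q0).
  by rewrite (le_lt_trans a1)// mulrC divfK// gt_eqF.
exists (Ordinal aj) => /=.
have sb : 0 <= s' <= L by rewrite s0 ltW.
have ab : 0 <= a%:R * (L / 2 ^+ j) <= L.
  by rewrite mulr_ge0 ?(ltW q0)//= (le_trans a1)// ltW.
have d : `|s' - a%:R * (L / 2 ^+ j)| <= L / 2 ^+ j.
  by rewrite -natr1 in a2; rewrite ger0_norm; lra.
have dd K : 0 <= K -> K <= K1 + K2 ->
    K * `|s' - a%:R * (L / 2 ^+ j)| <= (K1 + K2) * L / 2 ^+ j.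
  by move=> K0 K12; rewrite -mulrA ler_pM.
split; first by rewrite (le_trans (lip1 _ _ sb ab))// dd// lerDl.
by rewrite (le_trans (lip2 _ _ sb ab))// dd// lerDr.
Qed.

Lemma measure_bigsetU_le d (T : measurableType d) (mu : {measure set T -> \bar R})
    (I : finType) (S : I -> set T) (e : R) :
  (forall p, measurable (S p)) -> (forall p, (mu (S p) <= e%:E)%E) ->
  measurable (\bigcup_p S p) /\ (mu (\bigcup_p S p) <= (#|I|%:R * e)%:E)%E.
Proof.
move=> mS Se.
have -> : \bigcup_p S p = \big[setU/set0]_(p <- index_enum I) S p.
  by rewrite -bigcup_seq; apply/seteqP; split => x [p _ Sx]; exists p => //=;
    rewrite mem_index_enum.
have -> : #|I| = size (index_enum I) by rewrite cardT enumT.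
elim: (index_enum I) => [|p s [IHm IH]]; first by rewrite big_nil mul0r measure0.
rewrite big_cons; split; first exact: measurableU.
rewrite (le_trans (measureU2 _ _ _))//= -nat1r mulrDl mul1r EFinD.
exact: leeD.
Qed.

Lemma phase_box_measure (a b r : R) : 0 < r ->
  let S : set (measurable_phase R) :=
    (`[a - r, a + r] `*` `[b - r, b + r]) `*` `[0, 2 * pi] in
  measurable S /\ phase_measure R S = ((2 * r) * (2 * r) * (2 * pi))%:E.
Proof.
move=> r0 S; have p0 : 0 < 2 * pi :> R by rewrite mulr_gt0// pi_gt0.
have ar : a - r < a + r by lra.
have br : b - r < b + r by lra.
have E : (a + r - (a - r)) * (b + r - (b - r)) = (2 * r) * (2 * r) by ring.
pose A : set (measurableTypeR R) := `[a - r, a + r]%classic.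
pose B : set (measurableTypeR R) := `[b - r, b + r]%classic.
pose C : set (measurableTypeR R) := `[0, 2 * pi]%classic.
have mA : measurable A by exact: measurable_itv.
have mB : measurable B by exact: measurable_itv.
have mC : measurable C by exact: measurable_itv.
have mAB : measurable (A `*` B) by exact: measurableX.
split; first exact: measurableX.
have -> : S = (A `*` B) `*` C by [].
rewrite product_measure1E//.
transitivity (@lebesgue_measure R A * @lebesgue_measure R B * @lebesgue_measure R C)%E.
  by congr (_ * _)%E; exact: product_measure1E.
have len (x y : R) : x < y ->
    @lebesgue_measure R (`[x, y]%classic : set (measurableTypeR R)) = (y - x)%:E.
  by move=> xy; rewrite lebesgue_measure_itv /= lte_fin xy.
by rewrite /A /B /C !len// -!EFinM E subr0.
Qed.

End BoundaryLayer.
Section CurveLayer.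
Context {R : realType} {d : nat} (gam : 'I_d -> R -> plane R).

Lemma shift_index (K : nat) (n : int) : (`|n| < K.+1)%N ->
  (`|(n + K%:Z)%R| < K.*2.+1)%N /\ `|(n + K%:Z)%R|%N = n + K%:Z :> int.
Proof. by split; lia. Qed.

(** Around each of the 2 ^ j net points of a loop, and for each relevant translate, a box of side
    O(2 ^ (- j)) in position has area O(4 ^ (- j)); the union has measure O(2 ^ (- j)). *)
Lemma boundary_layer : (forall i, convex_C3_loop (gam i)) ->
  exists2 C : R, 0 <= C & forall j, exists A : set (measurable_phase R),
    [/\ measurable A, (phase_measure R A <= (C / 2 ^+ j)%:E)%E &
      forall Z, fundamental3 Z ->
        (exists q, curves gam q /\ near_torus j Z.1 q) -> A Z].
Proof.
move=> loops.
have /choice[DM HDM] : forall i, exists DM : R * R, [/\ 0 <= DM.1, 0 <= DM.2,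
    forall s, `|(gam i s).1| <= DM.2 /\ `|(gam i s).2| <= DM.2 &
    forall j, exists s_ : 'I_(2 ^ j) -> R, forall s, exists a,
      `|(gam i s).1 - (gam i (s_ a)).1| <= DM.1 / 2 ^+ j /\
      `|(gam i s).2 - (gam i (s_ a)).2| <= DM.1 / 2 ^+ j].
  by move=> i; have [D [M H]] := loop_net (loops i); exists (D, M).
pose D := \sum_i (DM i).1; pose M := \sum_i (DM i).2.
have DM0 i : 0 <= (DM i).1 /\ 0 <= (DM i).2 by have [] := HDM i.
have D0 : 0 <= D by apply: sumr_ge0 => i _; have [] := DM0 i.
have M0 : 0 <= M by apply: sumr_ge0 => i _; have [] := DM0 i.
have Di i : (DM i).1 <= D.
  by rewrite /D (bigD1 i)//= lerDl sumr_ge0// => k _; have [] := DM0 k.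
have Mi i : (DM i).2 <= M.
  by rewrite /M (bigD1 i)//= lerDl sumr_ge0// => k _; have [] := DM0 k.
(* Only translates with shifts at most 2 + M in absolute value come near the fundamental domain: 1
   for the domain, [M] for the loop, 1 for the distance. The shift k is encoded as the index k + K,
   between 0 and 2 K. *)
pose K := Num.truncn (2 + M).
have KM : 2 + M < K.+1%:R by rewrite truncnS_gt.
exists (d%:R * (K.*2.+1)%:R ^+ 2 * (4 * (1 + D) ^+ 2 * (2 * pi))) => [|j].
  by rewrite !mulr_ge0 ?exprn_ge0 ?pi_ge0// addr_ge0.
have p0 : 0 < 2 ^+ j :> R by rewrite exprn_gt0.
have p1 : 1 / 2 ^+ j <= 1 :> R.
  by rewrite ler_pdivrMr// mul1r exprn_ege1// ler1n.
have /choice[s_ Hs] : forall i, exists s_ : 'I_(2 ^ j) -> R, forall s, exists a,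
      `|(gam i s).1 - (gam i (s_ a)).1| <= (DM i).1 / 2 ^+ j /\
      `|(gam i s).2 - (gam i (s_ a)).2| <= (DM i).1 / 2 ^+ j.
  by move=> i; have [_ _ _ /(_ j)] := HDM i.
pose I := ('I_d * 'I_(2 ^ j) * ('I_(K.*2.+1) * 'I_(K.*2.+1)))%type.
(* 1 / 2 ^ j for the distance to the boundary and D / 2 ^ j for the distance to the net. *)
pose r := (1 + D) / 2 ^+ j.
have r0 : 0 < r by rewrite divr_gt0// ltr_pwDl.
pose cx (p : I) := (gam p.1.1 (s_ p.1.1 p.1.2)).1 + (p.2.1%:R - K%:R).
pose cy (p : I) := (gam p.1.1 (s_ p.1.1 p.1.2)).2 + (p.2.2%:R - K%:R).
pose S (p : I) : set (measurable_phase R) :=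
  (`[cx p - r, cx p + r] `*` `[cy p - r, cy p + r]) `*` `[0, 2 * pi].
have box p := phase_box_measure (cx p) (cy p) r0.
have [p|p|mS Sle] := @measure_bigsetU_le R _ _ (phase_measure R) I S
  ((2 * r) * (2 * r) * (2 * pi)); [by case: (box p)|by rewrite le_eqVlt; apply/orP; left; apply/eqP; case: (box p)|].
exists (\bigcup_p S p); split=> //.
  apply: (le_trans Sle); rewrite lee_fin /I !card_prod !card_ord !natrM natrX /r.
  rewrite le_eqVlt; apply/orP; left; apply/eqP.
  by field; rewrite gt_eqF.
move=> [[x y] w] [[/= x01 y01] w2] [q [[i [n [m [s qE]]]] [n' [m' [/= hx hy]]]]].
have [_ _ gM _] := HDM i; have [gx gy] := gM s.
have [a [ax ay]] := Hs i s.
have idx (z g g' : R) (k k' : int) : 0 <= z < 1 -> `|g| <= (DM i).2 ->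
    `|z - (g + k%:~R + k'%:~R)| <= 1 / 2 ^+ j -> `|g - g'| <= (DM i).1 / 2 ^+ j ->
    exists e : 'I_(K.*2.+1), g' + (e%:R - K%:R) - r <= z <= g' + (e%:R - K%:R) + r.
  move=> z01 gb hz hg.
  have kb : `|(k + k')%:~R| < K.+1%:R :> R.
    apply: le_lt_trans KM; have := Mi i; move: z01 gb hz p1; rewrite intrD.
    rewrite !ler_norml; lra.
  have kb' : (`|(k + k')%R| < K.+1)%N.
    by rewrite -(ltr_nat R) natr_absz intr_norm.
  have [eb ee] := shift_index kb'.
  exists (Ordinal eb) => /=.
  have -> : (`|(k + k' + K%:Z)%R|)%N%:R = (k + k')%:~R + K%:R :> R.
    by rewrite -[LHS]/((`|(k + k' + K%:Z)%R|)%N%:~R) ee !intrD.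
  rewrite addrK intrD.
  have rE : r = 1 / 2 ^+ j + D / 2 ^+ j by rewrite /r mulrDl.
  have hg' : `|g - g'| <= D / 2 ^+ j.
    by rewrite (le_trans hg)// ler_wpM2r// ?invr_ge0 ltW.
  move: hz hg'; rewrite rE !ler_norml; lra.
rewrite qE /= in hx hy.
have [ex hex] := idx _ _ _ _ _ x01 gx hx ax.
have [ey hey] := idx _ _ _ _ _ y01 gy hy ay.
exists (i, a, (ex, ey)) => //=; split; first by split; rewrite /= in_itv.
by rewrite /= in_itv/=; case/andP: w2 => -> /ltW ->.
Qed.

End CurveLayer.

(** * The domain of integration *)

Section DomainMeasurable.
Context {R : realType}.

(** An open set is the countable union of the boxes with rational centre and radius 1 / (n + 1) that
    it contains. *)
Lemma open_measurable2 (U : set (R * R)) : open U ->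
  measurable (U : set (measurableTypeR R * measurableTypeR R)).
Proof.
move=> oU.
pose box (p : rat * rat * nat) : set (measurableTypeR R * measurableTypeR R) :=
  `](ratr p.1.1 - p.2.+1%:R^-1), (ratr p.1.1 + p.2.+1%:R^-1)[ `*`
  `](ratr p.1.2 - p.2.+1%:R^-1), (ratr p.1.2 + p.2.+1%:R^-1)[.
have -> : U = \bigcup_(p in [set p | box p `<=` U]) box p.
  apply/seteqP; split => [[x y] Uxy|z [p pU pz]]; last exact: pU.
  have /nbhs_ballP[e /= e0 eU] : nbhs (x, y) U by exact: open_nbhs_nbhs.
  pose n := Num.truncn (2 / e).
  have [r rE] : exists r : R, r = n.+1%:R^-1 by exists n.+1%:R^-1.
  have ne : 2 * r <= e.
    rewrite rE ler_pdivrMr// mulrC -ler_pdivrMr// ltW//.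
    by rewrite /n truncnS_gt.
  have r0 : 0 < r by rewrite rE invr_gt0.
  have near (z : R) : exists q : rat, `|z - ratr q| < r.
    have [|q] := @rat_in_itvoo R (z - r) (z + r); first by lra.
    by rewrite in_itv/= => /andP[? ?]; exists q; rewrite ltr_norml; lra.
  have [p hp] := near x; have [q hq] := near y.
  exists (p, q, n) => /=; last first.
    by split; rewrite /= in_itv/= -rE; move: hp hq; rewrite !ltr_norml; lra.
  move=> [x' y'] [/=]; rewrite !in_itv/= -rE => hx hy; apply: eU; split => /=.
    by rewrite /ball /= ltr_norml; move: hp; rewrite ltr_norml; lra.
  by rewrite /ball /= ltr_norml; move: hq; rewrite ltr_norml; lra.
rewrite bigcup_mkcond; apply: countable_bigcupT_measurable => [|p]; first exact: countableP.
case: ifP => _; last exact: measurable0.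
apply: measurableX; exact: measurable_itv.
Qed.

Context {d : nat} (B : 'I_d -> set (plane R)).

Definition domain : set (measurable_phase R) := Omega0 B `&` fundamental3.

Lemma measurable_domain : (forall i, open (B i)) -> measurable domain.
Proof.
move=> oB.
have oS : open (in_scatterer B).
  rewrite (_ : in_scatterer B = \bigcup_i \bigcup_n \bigcup_m
      (fun q => shift2 n m q) @^-1` (B i)); last first.
    apply/seteqP; split => [q [i [n [m H]]]|q [i _ [n _ [m _ H]]]].
      by exists i => //; exists n => //; exists m.
    by exists i, n, m.
  apply: bigcup_open => i _; apply: bigcup_open => n _; apply: bigcup_open => m _.
  apply: open_comp => // q _; rewrite /shift2.
  have c1 : {for q, continuous (fun q : plane R => q.1 + n%:~R)}.
    by apply: cvgD; [exact: cvg_fst|exact: cvg_cst].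
  have c2 : {for q, continuous (fun q : plane R => q.2 + m%:~R)}.
    by apply: cvgD; [exact: cvg_snd|exact: cvg_cst].
  exact: (cvg_pair c1 c2).
pose C : set (measurableTypeR R * measurableTypeR R) := ~` in_scatterer B `&`
   (`[0, 1[ `*` `[0, 1[).
pose W : set (measurableTypeR R) := `[0, 2 * pi[%classic.
have -> : domain = C `*` W.
  apply/seteqP; split => [[[x y] w]|[[x y] w]].
    by move=> [hq [[a b] c]]; split => //=; split => //; split; rewrite /= in_itv.
  by move=> [[hq [a b]] c]; split => //; split => //; split.
apply: measurableX; last exact: measurable_itv.
apply: measurableI; first by apply: measurableC; exact: open_measurable2.
apply: measurableX; exact: measurable_itv.
Qed.

Lemma domain_finite : (forall i, open (B i)) -> (phase_measure R domain < +oo)%E.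
Proof.
move=> oB; have h2 : 0 < 1 / 2 :> R by lra.
have [mS Sv] := phase_box_measure (1 / 2 : R) (1 / 2) h2.
apply: (@le_lt_trans _ _ (((2 * (1 / 2)) * (2 * (1 / 2)) * (2 * pi))%:E)%E); last exact: ltry.
rewrite -Sv; apply: le_measure; rewrite ?inE//; first exact: measurable_domain.
move=> [[x y] w] [_ [[/= /andP[a b] /andP[a' b']] /andP[p q]]].
by split; [split|]; rewrite /= in_itv/=; apply/andP; split; lra.
Qed.

End DomainMeasurable.

(** * The points that the flow takes out of the phase space *)

Section ExitSet.
Context {R : realType} {d : nat} (B : 'I_d -> set (plane R)) (gam : 'I_d -> R -> plane R).

(** Only the values on [Omega0] matter, so this covers the indicator functions of [Omega0] and of
    its complement; a bound proportional to the constant gives norm 0 to the latter. *)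
Lemma const_Cl (l : nat) (c : R[i]) (h : phase R -> R[i]) :
  (forall Z, Omega0 B Z -> h Z = c) ->
  Cl B l h /\ fine (Cl_norm B l h) <= 2 * (l.+2%:R ^+ 2 * 2 ^+ 3) * normc c.
Proof.
move=> hc; pose F (a : nat) (x : R) := (a == 0%N)%:R : R.
have jF : jet1 l 2 F.
  have dF a t : (a < l)%N -> is_derive t (1 : R) (F a) (F a.+1 t).
    by move=> _; exact: ptder_cst.
  have bF a x : (a <= l)%N -> `|F a x| <= 1.
    by move=> _; rewrite /F; case: eqP => _; rewrite ?normr1 ?normr0.
  have lF x y : `|F l x - F l y| <= 1 * `|x - y| by rewrite subrr normr0 mul1r.
  by have := jet1_of_derivatives ler01 dF bF lF; rewrite mulr1.
have hT Z : Omega0 B Z -> h Z =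
    tensor_sum (fun _ : unit => c) (fun=> F) (fun=> F) (fun=> F) 0 0 0 Z.
  by move=> OZ; rewrite hc// /tensor_sum big_const card_unit /= /tensor /F /= !mulr1 addr0.
have [H1 H2] := @tensor_sum_Cl R d B unit (fun=> c) (fun=> F) (fun=> F) (fun=> F)
  l 2 (normc c) h (ler0n _ 2) (normc_ge0 c) (fun=> lexx _)
  (fun=> And3 jF jF jF) (fun _ _ _ _ => erefl) (fun _ _ _ _ => erefl)
  (fun _ _ _ _ => erefl) hT.
split=> //; apply: (le_trans H2); rewrite card_unit mul1r.
by rewrite le_eqVlt; apply/orP; left; apply/eqP; ring.
Qed.

Local Notation mu := (phase_measure R).
Local Notation D := (domain B).

Definition exits t : set (measurable_phase R) :=
  [set Z | D Z /\ ~ Omega0 B (flow B gam t Z)].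

(* Dolgopyat's estimate with f = 1 and psi = 0 or 1 on Omega0: [out0] has zero
   C^1 norm, and the pairings with [in0] and with 1 are equal. *)
Lemma exit_set (v : R) : (forall i, open (B i)) -> 0 < (2 * pi * area B)^-1 ->
  Dolgopyat_constant B gam v -> exists2 C : R, 0 <= C & forall t, 0 <= t ->
    (forall U, measurable U -> U `<=` D `&` exits t -> mu U = 0%E) /\
    exists A : set (measurable_phase R), [/\ measurable A, A `<=` D, exits t `<=` A &
      fine (mu A) <= C * expR (- (v / 2) * t)].
Proof.
move=> oB c0 [v0 [N [phi [Pi [X [[phiL phib _] _ _ _ hDo]]]]]].
have mD : measurable D := measurable_domain oB.
have Doo : (mu D < +oo)%E := domain_finite oB.
have [|C1 C10 hC1] := hDo (v / 2); first by lra.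
pose one : phase R -> R[i] := fun=> 1.
pose in0 : phase R -> R[i] := fun Z => (\1_(Omega0 B) Z)%:C.
pose out0 : phase R -> R[i] := fun Z => (\1_(~` Omega0 B) Z)%:C.
have [one1 _] := @const_Cl 1 1 one (fun _ _ => erefl).
have [one2 _] := @const_Cl 2 1 one (fun _ _ => erefl).
have [in1 _] : Cl B 1 in0 /\ fine (Cl_norm B 1 in0) <= 2 * (3%:R ^+ 2 * 2 ^+ 3) * normc (1 : R[i]).
  by apply: const_Cl => Z OZ; rewrite /in0 indicE mem_set.
have [out1 outn] : Cl B 1 out0 /\ fine (Cl_norm B 1 out0) <= 2 * (3%:R ^+ 2 * 2 ^+ 3) * normc (0 : R[i]).
  by apply: const_Cl => Z OZ; rewrite /out0 indicE memNset// => /(_ OZ).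
have out_n : fine (Cl_norm B 1 out0) = 0.
  by apply/eqP; rewrite eq_le fine_Cl_norm_ge0 andbT (le_trans outn)// normc_zero mulr0.
have C0one : C0_Omega B gam one.
  by split=> // ; apply: continuous_subspaceT => ?; exact: cvg_cst.
have phi_out i : phi i out0 = 0.
  have [K hK] := phib i; have := hK _ out1; rewrite out_n mulr0 => h.
  by apply: eq0_normc; apply/eqP; rewrite eq_le h normc_ge0.
have pair_out u : pairing phi u out0 = 0.
  by rewrite /pairing big1// => i _; rewrite phi_out mulr0.
have oneE : one = (fun Z => 1 * in0 Z + out0 Z).
  apply/funext => Z; rewrite /one /in0 /out0 !indicE mul1r in_setC.
  by case: (_ \in _); rewrite /= ?addr0 ?add0r.
have pair_in u : pairing phi u in0 = pairing phi u one.
  rewrite /pairing; apply: eq_bigr => i _; congr (_ * _).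
  by rewrite oneE phiL// phi_out mul1r addr0.
set n2 := fine (Cl_norm B 2 one) in hC1 *.
have n20 : 0 <= n2 by exact: fine_Cl_norm_ge0.
set a := fine (Cl_norm B 1 in0); set b := fine (Cl_norm B 1 one).
have a0 : 0 <= a by exact: fine_Cl_norm_ge0.
have b0 : 0 <= b by exact: fine_Cl_norm_ge0.
set c := (2 * pi * area B)^-1 in c0 *.
(* The quotient is the error of two applications of the estimate, freed from the normalization [c]
   of the integral; the 1 is the slack allowed in the choice of the hull. *)
exists (C1 * n2 * (a + b) / c + 1) => [|t t0].
  by apply: addr_ge0 => //; apply: mulr_ge0; [apply: mulr_ge0; [apply: mulr_ge0 (ltW C10) n20|exact: addr_ge0]|rewrite invr_ge0 ltW].
have ReI h : complex.Re (integral_m B h) =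
  c * \int[mu]_(Z in D) complex.Re (h Z) by [].
split=> [U mU UE|].
  (* For [out0] both the error bound and the pairing are 0, so its correlation with 1 vanishes
     exactly. *)
  have := hC1 t _ _ t0 out1 one2 C0one.
  rewrite out_n mulr0 mul0r pair_out subr0 => nz.
  have Iz : integral_m B (fun Z => out0 (flow B gam t Z) * one Z) = 0.
    by apply: eq0_normc; apply/eqP; rewrite eq_le nz normc_ge0.
  have : c * \int[mu]_(Z in D) complex.Re (out0 (flow B gam t Z) * one Z) = 0.
    by rewrite -ReI Iz.
  move/eqP; rewrite mulf_eq0 gt_eqF//= => /eqP.
  rewrite /Rintegral (_ : (fun Z => _) =
     (fun Z => (\1_(~` Omega0 B) (flow B gam t Z) : R)%:E)); last first.
    by apply/funext => Z; rewrite /out0 /one mulr1 mul0r subr0.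
  set I := integral _ _ _ => I0.
  have Ige : (0 <= I)%E by apply: integral_ge0 => Z _; rewrite lee_fin.
  have Ile : (I <= mu D)%E.
    apply: (@le_trans _ _ (\int[mu]_(x in D) (cst 1 x))%E).
        by apply: ge0_integral_mono => Z _; rewrite lee_fin// indicE;
        case: (flow B gam t Z \in _).
    by rewrite integral_cst// mul1e.
  have If : I \is a fin_num by rewrite ge0_fin_numE// (le_lt_trans Ile).
  have {}I0 : I = 0%E by rewrite -(fineK If) I0.
  apply/eqP; rewrite eq_le measure_ge0 andbT.
  have <- : mu (U `&` D) = mu U.
    by congr (mu _); apply/seteqP; split=> [x []//|x Ux]; split=> //; have [] := UE _ Ux.
  rewrite -(integral_indic mu mD mU) -I0.
  apply: ge0_integral_mono => Z DZ; rewrite lee_fin// !indicE.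
  case: (boolP (Z \in U)) => [|_]; last by case: (flow B gam t Z \in _).
  by rewrite inE => /UE[_ [_ nO]]; rewrite mem_set.
have e0 : 0 < expR (- (v / 2) * t) by exact: expR_gt0.
have [A [mA AD EA Ale]] := inner_integral_hull mD Doo (exits t) e0.
exists A; split=> // [Z [DZ EZ]|]; first by apply: EA; split.
apply: (le_trans Ale); rewrite mulrDl mul1r lerD2r.
have h1 := hC1 t _ _ t0 one1 one2 C0one.
have h2 := hC1 t _ _ t0 in1 one2 C0one.
set G1 := integral_m _ _ in h1; set G2 := integral_m _ _ in h2.
(* [G1] and [G2] are compared through their common pairing; their difference is [c] times the defect
   which bounds the measure of the hull. *)
have h3 : normc (G1 - G2) <= C1 * n2 * (a + b) * expR (- (v / 2) * t).
  rewrite pair_in in h2.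
  set P := pairing _ _ _ in h1 h2.
  have -> : G1 - G2 = (G1 - P) - (G2 - P) by ring.
  by rewrite (le_trans (normcB_le _ _))// mulrDr mulrDl addrC lerD.
have : c * (\int[mu]_(Z in D) (1 : R) - \int[mu]_(x in D) \1_(~` exits t) x)
    <= C1 * n2 * (a + b) * expR (- (v / 2) * t).
  apply: le_trans h3; apply: le_trans (normc_Re _); apply: le_trans (ler_norm _).
  rewrite [complex.Re _](_ : _ = complex.Re G1 - complex.Re G2); last first.
    by case: (G1) => ? ?; case: (G2).
  rewrite !ReI -mulrBr ler_wpM2l ?(ltW c0)//.
  rewrite le_eqVlt; apply/orP; left; apply/eqP; congr (_ - _).
    by apply: eq_Rintegral => Z _; rewrite /one mulr1 ?mul0r ?subr0.
  apply: eq_Rintegral => Z; rewrite inE => DZ.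
  rewrite /one /in0 mulr1 ?mul0r ?subr0 /= !indicE; congr (nat_of_bool _)%:R.
  have [OF|nF] := pselect (Omega0 B (flow B gam t Z)).
    by rewrite !mem_set//= => -[].
  by rewrite !memNset// => /=; apply; split.
rewrite Rintegral_cst// mul1r -ler_pdivlMl// => /le_trans; apply.
by rewrite mulrC mulrAC.
Qed.

End ExitSet.

(** * Decay of correlations *)

Section CoreEstimate.
Context {R : realType} {d : nat} (B : 'I_d -> set (plane R)) (gam : 'I_d -> R -> plane R).
Local Notation mu := (phase_measure R).
Local Notation D := (domain B).
Local Notation c := ((2 * pi * area B)^-1).
Implicit Types g h : phase R -> R[i].

(** The factor 4 counts the positive and negative parts of the real and imaginary parts. *)
Lemma integral_m_close (E A : set (measurable_phase R)) g h (M e : R) :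
  (forall i, open (B i)) -> 0 <= c ->
  measurable A -> (mu A < +oo)%E -> E `<=` A ->
  (forall U, measurable U -> U `<=` D `&` E -> mu U = 0%E) -> 0 <= M -> 0 <= e ->
  (forall Z, D Z -> ~ E Z -> normc (g Z) <= M) ->
  (forall Z, D Z -> ~ E Z -> normc (h Z) <= M) ->
  (forall Z, D Z -> ~ A Z -> normc (g Z - h Z) <= e) ->
  normc (integral_m B g - integral_m B h)
    <= 4 * c * (e * fine (mu D) + M * fine (mu A)).
Proof.
move=> oB c0 mA Aoo EA En M0 e0 gM hM gh.
have mD : measurable D := measurable_domain oB.
have Doo : (mu D < +oo)%E := domain_finite oB.
have key (p : R[i] -> R) : (forall z, `|p z| <= normc z) ->
    (forall z w, p (z - w) = p z - p w) ->
    `|integral_m_real B (fun Z => p (g Z)) - integral_m_real B (fun Z => p (h Z))|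
      <= c * (2 * (e * fine (mu D) + M * fine (mu A))).
  move=> pn pB; rewrite /integral_m_real -mulrBr normrM ger0_norm// ler_wpM2l//.
  apply: (@Rintegral_close _ _ R mu D mD Doo E A) => // Z DZ nE.
  - exact: le_trans (pn _) (gM _ DZ nE).
  - exact: le_trans (pn _) (hM _ DZ nE).
  - by rewrite -pB; exact: le_trans (pn _) (gh _ DZ nE).
apply: (le_trans (normc_le_ReIm _)).
have -> : 4 * c * (e * fine (mu D) + M * fine (mu A)) =
    c * (2 * (e * fine (mu D) + M * fine (mu A))) +
    c * (2 * (e * fine (mu D) + M * fine (mu A))) by ring.
apply: lerD.
- apply: (key (@complex.Re R)); first exact: normc_Re.
  by move=> [? ?] [? ?].
- apply: (key (@complex.Im R)); first exact: normc_Im.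
  by move=> [? ?] [? ?].
Qed.

Lemma integral_m_bound g (M : R) : (forall i, open (B i)) -> 0 <= c -> 0 <= M ->
  (forall Z, D Z -> normc (g Z) <= M) ->
  normc (integral_m B g) <= 4 * c * (M * fine (mu D)).
Proof.
move=> oB c0 M0 gM.
have z : integral_m B (fun=> 0 : R[i]) = 0.
  by apply: complex_eqP; rewrite /= /integral_m_real /Rintegral integral0_eq ?mulr0.
rewrite -[integral_m B g]subr0 -z.
have := @integral_m_close set0 set0 g (fun=> 0) M M oB c0 measurable0.
rewrite measure0 mulr0 addr0; apply=> //.
- by move=> U _ Us; rewrite (_ : U = set0) ?measure0//; apply/seteqP; split => x // /Us [].
- by move=> Z DZ _; exact: gM.
- by move=> Z _ _; rewrite (normc_zero : normc ((fun=> 0) Z) = 0).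
- by move=> Z DZ _; rewrite (subr0 (g Z) : g Z - (fun=> 0) Z = g Z) gM.
Qed.

Let le_sum4 (x y z w : R) : 0 <= x -> 0 <= y -> 0 <= z -> 0 <= w ->
  [/\ x <= x + y + z + w, y <= x + y + z + w, z <= x + y + z + w &
      w <= x + y + z + w].
Proof. by move=> *; split; lra. Qed.

(** The scale j is kept independent of t here; the terms are the approximation error, the boundary
    layer, the exit set, and the spectral decay multiplied by the norms of both approximants. *)
Lemma core_estimate (v kappa : R) : billiard_table B gam ->
  Dolgopyat_constant B gam v -> 0 < kappa -> 0 < c ->
  exists K g0 : R, [/\ 0 <= K, 0 < g0, g0 < v &
    forall psi f, holder B kappa psi -> holder B kappa f ->
    forall (t : R) (j : nat), 0 <= t ->
      normc (integral_m B (fun Z => psi (flow B gam t Z) * f Z)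
             - integral_m B psi * integral_m B f)
      <= K * ((8 * (10 / 2 ^+ j) `^ kappa + 7 / 2 ^+ j) + 1 / 2 ^+ j + expR (- g0 * t)
              + (grid j ^ 3)%:R ^+ 2 * expR (- g0 * t))
         * (fine (holder_norm B kappa psi) * fine (holder_norm B kappa f))].
Proof.
move=> [oBc loops _ _] hDo k0 c0.
have oB i : open (B i) by have [] := oBc i.
have c0' := ltW c0.
have mD : measurable D := measurable_domain oB.
have Doo : (mu D < +oo)%E := domain_finite oB.
have [Ce Ce0 hE] := exit_set oB c0 hDo.
have [Cb Cb0 hB] := boundary_layer loops.
have [v0 [N [phi [Pi [X [hphi hPi hev h0 hdec]]]]]] := hDo.
have [Cp [g [Cp0 g0 hpair]]] := pairing_decay hphi hPi hev h0.
have [|C1 C10 hC1] := hdec (v / 2); first by lra.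
(* v / 2 is the rate used for the exit set and in Dolgopyat's estimate, g the rate of exp (t X) on
   its image. *)
pose ga := Num.min (v / 2) g.
have ga0 : 0 < ga by rewrite lt_min divr_gt0.
have gav : ga <= v / 2 by rewrite ge_min lexx.
have gag : ga <= g by rewrite ge_min lexx orbT.
set m := fine (mu D) in hE *.
have m0 : 0 <= m by rewrite fine_ge0.
(* The constant of [approx_Cl] for l = 2, where l + 2 = 4; it also dominates the one for l = 1. *)
pose ka := 2 * (4 ^+ 2 * jet_const ^+ 3) : R.
have J0 : 0 <= jet_const ^+ 3 :> R by rewrite exprn_ge0// jet_const_ge0.
have ka0 : 0 <= ka by rewrite /ka; apply: mulr_ge0 => //; apply: mulr_ge0 => //; apply: exprn_ge0.
pose K1 := 4 * c * (9 * m + 64 * (Ce + Cb)).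
pose K2 := 4 * c * m * (4 * c * m) + 32 * c * m * (4 * c * (m + 8 * Cb)).
pose K3 := C1 * (ka * ka).
pose K4 := Cp * (ka + 32 * c * m) * ka.
have [K10 K20 K30 K40] : [/\ 0 <= K1, 0 <= K2, 0 <= K3 & 0 <= K4].
  have C10' := ltW C10.
  by split; rewrite /K1 /K2 /K3 /K4; repeat (apply: mulr_ge0 || apply: addr_ge0) => //.
exists (K1 + K2 + K3 + K4), ga; split=> //; first by repeat (apply: addr_ge0 => //).
  by apply: (le_lt_trans gav); lra.
move=> psi f hpsi hf t j t0.
have [A [mA AD EA Ale]] := (hE t t0).2; have En := (hE t t0).1.
have [Aj [mAj Ajle hAj]] := hB j.
have [Hp0 pH _] := holder_bounds k0 hpsi.
have [Hf0 fH _] := holder_bounds k0 hf.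
set Hp := fine (holder_norm B kappa psi) in Hp0 pH *.
set Hf := fine (holder_norm B kappa f) in Hf0 fH *.
set q := 8 * (10 / 2 ^+ j) `^ kappa + 7 / 2 ^+ j.
set s := 1 / 2 ^+ j; set e := expR (- ga * t); set NN := (grid j ^ 3)%:R : R.
have q0 : 0 <= q by rewrite addr_ge0 ?mulr_ge0 ?powR_ge0 ?divr_ge0 ?exprn_ge0.
have s0 : 0 <= s by rewrite divr_ge0 ?exprn_ge0.
have e0 : 0 <= e by exact: expR_ge0.
have NN1 : 1 <= NN by rewrite ler1n expn_gt0 grid_gt0.
have NN0 : 0 <= NN by rewrite ler0n.
have e1 : expR (- (v / 2) * t) <= e by rewrite ler_expR ler_wpM2r// lerN2.
have e2 : expR (- g * t) <= e by rewrite ler_expR ler_wpM2r// lerN2.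
set XX := q + s + e + NN ^+ 2 * e.
have Ne0 : 0 <= NN ^+ 2 * e by rewrite mulr_ge0// exprn_ge0.
have [qX sX eX nX] : [/\ q <= XX, s <= XX, e <= XX & NN ^+ 2 * e <= XX].
  exact: le_sum4.
have X0 : 0 <= XX by exact: le_trans q0 qX.
(* No bump is dropped for psi, which only has to be C^1; so its approximation is uniform on
   [Omega0], including at the image points of the flow. *)
pose psij := approx (@sample _ _ B j psi set0).
pose fj := approx (@sample _ _ B j f (curves gam)).
have psib Z : normc (psij Z) <= 8 * Hp.
  by apply: approx_bound => // p; exact: sample_bound.
have fb Z : normc (fj Z) <= 8 * Hf.
  by apply: approx_bound => // p; exact: sample_bound.
have psic Z : Omega0 B Z -> normc (psij Z - psi Z) <= q * Hp.
  by move=> OZ; apply: approx_sample_close.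
have fc Z : D Z -> ~ Aj Z -> normc (fj Z - f Z) <= q * Hf.
  move=> [OZ FZ] nA; apply: approx_sample_close => // q' cq nq; apply: nA.
  by apply: hAj => //; exists q'.
have [psiC psin] : Cl B 1 psij /\ fine (Cl_norm B 1 psij) <= NN * ka * Hp.
  have sb (p : node j) : normc (sample B psi set0 p) <= Hp by exact: sample_bound.
  have [H1 H2] := @approx_Cl R d B j 1 (@sample _ _ B j psi set0) Hp isT Hp0 sb.
  split=> //; apply: (le_trans H2); rewrite -/NN /ka.
  rewrite [leRHS](_ : _ = 2 * (NN * Hp * (4 ^+ 2 * jet_const ^+ 3))); last by ring.
  rewrite ler_wpM2l// ler_wpM2l ?mulr_ge0// ler_wpM2r// lerXn2r ?nnegrE//.
  by rewrite ler_nat.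
have [fC fn] : Cl B 2 fj /\ fine (Cl_norm B 2 fj) <= NN * ka * Hf.
  have sb (p : node j) : normc (sample B f (curves gam) p) <= Hf by exact: sample_bound.
  have [H1 H2] := @approx_Cl R d B j 2 (@sample _ _ B j f (curves gam)) Hf isT Hf0 sb.
  split=> //; apply: (le_trans H2); rewrite -/NN /ka.
  by rewrite [leRHS](_ : _ = 2 * (NN * Hf * (4 ^+ 2 * jet_const ^+ 3)))//; ring.
have fC0 : C0_Omega B gam fj by exact: approx_sample_C0.
set G := integral_m B (fun Z => psi (flow B gam t Z) * f Z).
pose Gj := integral_m B (fun Z => psij (flow B gam t Z) * fj Z).
pose P := pairing phi (Pi fj *m expmx (t%:C *: X)) psij.
have Ajoo : (mu Aj < +oo)%E by rewrite (le_lt_trans Ajle) ?ltry.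
have Aoo : (mu A < +oo)%E.
  by rewrite (le_lt_trans _ Doo)// le_measure ?inE.
have Ajs : fine (mu Aj) <= Cb * s.
  by rewrite -lee_fin fineK ?ge0_fin_numE// /s mul1r.
have AAoo : (mu (A `|` Aj) < +oo)%E.
  apply: (@le_lt_trans _ _ (mu A + mu Aj)%E); first exact: measureU2.
  exact: lte_add_pinfty.
have AAle : fine (mu (A `|` Aj)) <= Ce * e + Cb * s.
  rewrite -lee_fin fineK ?ge0_fin_numE//.
  apply: (@le_trans _ _ (mu A + mu Aj)%E); first exact: measureU2.
  rewrite EFinD leeD//.
    rewrite -(@fineK _ (mu A)) ?ge0_fin_numE// lee_fin (le_trans Ale)//.
    by rewrite ler_wpM2l.
  by rewrite -(@fineK _ (mu Aj)) ?ge0_fin_numE// lee_fin.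
(* 64 = 8 * 8 bounds the product of the approximants; 9 = 1 + 8 arises from replacing psi while f is
   kept, then f while the approximant of psi is kept. *)
have T1 : normc (G - Gj) <= K1 * XX * (Hp * Hf).
  have := @integral_m_close (exits B gam t) (A `|` Aj)
    (fun Z => psi (flow B gam t Z) * f Z) (fun Z => psij (flow B gam t Z) * fj Z)
    (64 * Hp * Hf) (9 * q * Hp * Hf) oB c0' (measurableU _ _ mA mAj) AAoo.
  move=> H; apply: (le_trans (H _ En _ _ _ _ _)).
  - by move=> Z /EA AZ; left.
  - by rewrite !mulr_ge0.
  - by rewrite !mulr_ge0.
  - move=> Z DZ nE; have OF : Omega0 B (flow B gam t Z).
      by apply: contrapT => nO; apply: nE.
    rewrite normcM (@le_trans _ _ (Hp * Hf))//.
      by rewrite ler_pM ?normc_ge0 ?pH// fH//; case: DZ.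
    by rewrite -mulrA ler_peMl ?mulr_ge0// ler1n.
  - move=> Z _ _; rewrite normcM.
    rewrite (_ : 64 * Hp * Hf = (8 * Hp) * (8 * Hf)); last by ring.
    by rewrite ler_pM ?normc_ge0.
  - move=> Z DZ nA; have OF : Omega0 B (flow B gam t Z).
      by apply: contrapT => nO; apply: nA; left; apply: EA.
    have nAj : ~ Aj Z by move=> AjZ; apply: nA; right.
    set a := psi _; set aj := psij _.
    have -> : a * f Z - aj * fj Z = (a - aj) * f Z + aj * (f Z - fj Z) by ring.
    rewrite (le_trans (normcD_le _ _))// !normcM.
    rewrite (_ : 9 * q * Hp * Hf = (q * Hp) * Hf + (8 * Hp) * (q * Hf)); last by ring.
    apply: lerD; apply: ler_pM; rewrite ?normc_ge0//.
    - by rewrite normc_distC psic.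
    - by apply: fH; case: DZ.
    - exact: psib.
    - by rewrite normc_distC fc.
  rewrite (_ : K1 * XX * (Hp * Hf) = 4 * c *
    ((9 * XX * (Hp * Hf)) * m + (64 * (Hp * Hf)) * ((Ce + Cb) * XX))); last by rewrite /K1; ring.
  have HH0 : 0 <= Hp * Hf by exact: mulr_ge0.
  rewrite ler_wpM2l ?mulr_ge0// lerD//.
    rewrite ler_wpM2r// -[9 * q * Hp * Hf]mulrA ler_wpM2r// ler_wpM2l//.
  rewrite -[64 * Hp * Hf]mulrA ler_wpM2l ?mulr_ge0// (le_trans AAle)//.
  by rewrite mulrDl lerD// ler_wpM2l.
have set0null (U : set (measurable_phase R)) : measurable U -> U `<=` D `&` set0 -> mu U = 0%E.
  by move=> _ Us; rewrite (_ : U = set0) ?measure0//; apply/seteqP; split => x // /Us [].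
have S1 : normc (integral_m B psi - integral_m B psij) <= 4 * c * m * q * Hp.
  have := @integral_m_close set0 set0 psi psij (8 * Hp) (q * Hp) oB c0' measurable0.
  rewrite measure0 mulr0 addr0 => H.
  rewrite (_ : _ * _ * m * q * Hp = 4 * c * (q * Hp * m)); last by ring.
  apply: H => //; rewrite ?mulr_ge0// => Z [OZ _] _.
  - by rewrite (le_trans (pH _ OZ))// ler_peMl// ler1n.
  - by rewrite normc_distC psic.
have S2 : normc (integral_m B f) <= 4 * c * m * Hf.
  rewrite (_ : _ * _ * m * Hf = 4 * c * (Hf * m)); last by ring.
  by apply: integral_m_bound => // Z [OZ _]; exact: fH.
have S3 : normc (integral_m B psij) <= 32 * c * m * Hp.
  rewrite (_ : _ * _ * m * Hp = 4 * c * (8 * Hp * m)); last by ring.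
  by apply: integral_m_bound => //; rewrite mulr_ge0.
have S3' : normc (integral_m B fj) <= 32 * c * m * Hf.
  rewrite (_ : _ * _ * m * Hf = 4 * c * (8 * Hf * m)); last by ring.
  by apply: integral_m_bound => //; rewrite mulr_ge0.
have S4 : normc (integral_m B f - integral_m B fj) <= 4 * c * (m * q + 8 * (Cb * s)) * Hf.
  have := @integral_m_close set0 Aj f fj (8 * Hf) (q * Hf) oB c0' mAj Ajoo.
  move=> H; apply: (le_trans (H _ set0null _ _ _ _ _)) => //; rewrite ?mulr_ge0//.
  - by move=> Z [OZ _] _; rewrite (le_trans (fH _ OZ))// ler_peMl// ler1n.
  - by move=> Z DZ nA; rewrite normc_distC fc.
  rewrite (_ : _ * _ * _ * Hf = 4 * c * (q * Hf * m + 8 * Hf * (Cb * s))); last by ring.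
  by rewrite ler_wpM2l ?mulr_ge0// lerD// ler_wpM2l ?mulr_ge0.
have T2 : normc (integral_m B psi * integral_m B f - integral_m B psij * integral_m B fj)
    <= K2 * XX * (Hp * Hf).
  set a1 := integral_m B psi in S1 *; set b1 := integral_m B f in S2 S4 *.
  set a2 := integral_m B psij in S1 S3 *; set b2 := integral_m B fj in S4 *.
  have -> : a1 * b1 - a2 * b2 = (a1 - a2) * b1 + a2 * (b1 - b2) by ring.
  rewrite (le_trans (normcD_le _ _))// !normcM.
  apply: (@le_trans _ _ ((4 * c * m * XX * Hp) * (4 * c * m * Hf) +
      (32 * c * m * Hp) * (4 * c * (m * XX + 8 * (Cb * XX)) * Hf))); last first.
    by rewrite le_eqVlt; apply/orP; left; apply/eqP; rewrite /K2; ring.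
  apply: lerD; apply: ler_pM; rewrite ?normc_ge0//.
    apply: (le_trans S1); rewrite ler_wpM2r// ler_wpM2l//.
    by rewrite !mulr_ge0.
  apply: (le_trans S4); rewrite ler_wpM2r// ler_wpM2l ?mulr_ge0//.
  by rewrite lerD// ?ler_wpM2l// ler_wpM2l.
have T3 : normc (Gj - P) <= K3 * XX * (Hp * Hf).
  apply: (le_trans (hC1 t psij fj t0 psiC fC fC0)).
  apply: (@le_trans _ _ (C1 * (NN * ka * Hf) * (NN * ka * Hp) * e)).
    have C10' := ltW C10.
    do 2 (apply: ler_pM; rewrite ?expR_ge0 ?mulr_ge0 ?fine_Cl_norm_ge0//).
    by rewrite ler_wpM2l.
  rewrite [leLHS](_ : _ = K3 * (NN ^+ 2 * e) * (Hp * Hf)); last by rewrite /K3; ring.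
  by rewrite ler_wpM2r ?mulr_ge0// ler_wpM2l.
have T4 : normc (P - integral_m B psij * integral_m B fj) <= K4 * XX * (Hp * Hf).
  apply: (le_trans (hpair t psij fj t0 psiC fC fC0)).
  apply: (@le_trans _ _ (Cp * (NN * (ka + 32 * c * m) * Hf) * (NN * ka * Hp) * e)).
    do 2 (apply: ler_pM; rewrite ?expR_ge0 ?mulr_ge0 ?addr_ge0 ?normc_ge0 ?fine_Cl_norm_ge0//).
    rewrite ler_wpM2l// mulrDr mulrDl lerD//.
    apply: (le_trans S3'); rewrite -[NN * _ * Hf]mulrA ler_peMl//.
    by rewrite !mulr_ge0.
  rewrite [leLHS](_ : _ = K4 * (NN ^+ 2 * e) * (Hp * Hf)); last by rewrite /K4; ring.
  by rewrite ler_wpM2r ?mulr_ge0// ler_wpM2l.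
(* In turn: smoothing in the correlation, Dolgopyat's estimate, convergence of the pairing to the
   product of the means, and smoothing in the means. *)
have -> : G - integral_m B psi * integral_m B f =
  (G - Gj) + (Gj - P) + (P - integral_m B psij * integral_m B fj)
  - (integral_m B psi * integral_m B f - integral_m B psij * integral_m B fj) by ring.
rewrite (_ : _ * XX * _ = K1 * XX * (Hp * Hf) + K3 * XX * (Hp * Hf)
  + K4 * XX * (Hp * Hf) + K2 * XX * (Hp * Hf)); last by ring.
apply: (le_trans (normcB_le _ _)); apply: lerD => //.
apply: (le_trans (normcD_le _ _)); apply: lerD => //.
by apply: (le_trans (normcD_le _ _)); apply: lerD.
Qed.

End CoreEstimate.

(** * Balance between the approximation error and the decay *)

Section ScaleChoice.
Context {R : realType}.

Lemma grid_pow j : (grid j)%:R = 108 ^+ 2 * (2 ^+ j) ^+ 13 :> R.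
Proof.
rewrite /grid !natrM !natrX.
have -> : (64 : R) = 2 ^+ 6 by rewrite -natrX.
have -> : (128 : R) = 2 ^+ 7 by rewrite -natrX.
rewrite -!exprM ![(_ * j)%N]mulnC !exprM.
move: (2 ^+ j : R) (108 : R) => y u; ring.
Qed.

Let collect (p x e g N c0 : R) : p <= 10 * (2 * e) -> x <= 2 * e -> g <= e ->
  N <= c0 * e -> (8 * p + 7 * x) + x + g + N <= (177 + c0) * e.
Proof. by move=> *; lra. Qed.

Let absorb (k j2 g0 nu t : R) : k * j2 <= g0 * t -> nu * t <= g0 / 2 * t ->
  k / 2 * j2 + - g0 * t <= - nu * t.
Proof. by move=> *; lra. Qed.

(* With 2 ^ j of the order of expR (lam a t), the error 2 ^ (- kappa j) of the
   approximation and the growth 2 ^ (78 j) of the norms of the approximants are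
   both absorbed by the exponential decay. *)
Lemma scale_choice (kappa g0 : R) : 0 < kappa < 1 -> 0 < g0 ->
  exists nu C : R, [/\ 0 < nu, nu < g0, 0 <= C & forall t, 0 <= t -> exists j : nat,
    (8 * (10 / 2 ^+ j) `^ kappa + 7 / 2 ^+ j) + 1 / 2 ^+ j + expR (- g0 * t)
      + (grid j ^ 3)%:R ^+ 2 * expR (- g0 * t) <= C * expR (- nu * t)].
Proof.
move=> /andP[k0 k1] g00.
have lam0 : 0 < ln 2 :> R by rewrite ln_gt0// ltr1n.
set lam := ln 2 in lam0.
have two : expR lam = 2 :> R by rewrite lnK// posrE.
have pow2 (j : nat) : 2 ^+ j = expR (lam * j%:R) :> R.
  by rewrite -two -expRM_natl mulrC.
have gh : g0 / 2 <= g0 by lra.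
(* 78 = 13 * 3 * 2: of order 2 ^ (13 j) nodes per coordinate, three coordinates, two approximants.
   With a = g0 / k, the factor 2 ^ (78 j) consumes at most half of the rate [g0]. *)
have [k [kp kE]] : exists k : R, 0 < k /\ forall x, lam * x * 78 = k / 2 * x.
  by exists (2 * 78 * lam); split=> [|x]; [exact: mulr_gt0|field].
pose a := g0 / k.
have a0 : 0 < a by rewrite divr_gt0.
pose nu := Num.min (g0 / 2) (kappa * lam * a).
have nu0 : 0 < nu.
  rewrite lt_min; apply/andP; split; first exact: divr_gt0.
  exact: mulr_gt0 (mulr_gt0 k0 lam0) a0.
have nu1 : nu <= g0 / 2 by rewrite ge_min lexx.
have nu2 : nu <= kappa * lam * a by rewrite ge_min lexx orbT.
have [c0 [c00 gridE]] : exists c0 : R, 0 <= c0 /\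
    forall j, (grid j ^ 3)%:R ^+ 2 = c0 * (2 ^+ j) ^+ 78 :> R.
  exists (((108 ^+ 2) ^+ 3) ^+ 2); split; first by do 3![apply: exprn_ge0].
  by move=> j; rewrite natrX grid_pow; move: (2 ^+ j : R) (108 : R) => y u; ring.
(* 177 = 8 * 20 + 7 * 2 + 2 + 1, from the bounds collected in [collect]. *)
exists nu, (177 + c0); split=> //.
- by apply: (le_lt_trans nu1); rewrite ltr_pdivrMr// ltr_pMr// ltr1n.
- exact: addr_ge0.
move=> t t0; exists (Num.truncn (a * t)); set j := Num.truncn _.
have /andP[j1 j2] : j%:R <= a * t < j.+1%:R by rewrite truncn_itv// mulr_ge0// ltW.
set en := expR (- nu * t).
have kl0 : 0 < kappa * lam by rewrite mulr_gt0.
(* Rounding a t down to the integer j costs at most 2 ^ kappa <= 2. *)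
have ekj : expR (- (kappa * lam * j%:R)) <= 2 * en.
  rewrite /en -two -expRD ler_expR.
  have h1 : nu * t <= kappa * lam * (a * t) by rewrite mulrA ler_wpM2r.
  have h2 : kappa * lam * (a * t) <= kappa * lam * (j%:R + 1).
    by rewrite ler_wpM2l// ?(ltW kl0)// natr1 ltW.
  have h3 : kappa * lam <= lam by rewrite ler_piMl// ltW.
  lra.
have yV : (2 ^+ j)^-1 = expR (- (lam * j%:R)) :> R by rewrite pow2 expRN.
have ey : 1 / 2 ^+ j <= 2 * en.
  rewrite mul1r yV (le_trans _ ekj)// ler_expR lerN2.
  by rewrite ler_wpM2r// ler_piMl// ltW.
have ep : (10 / 2 ^+ j) `^ kappa <= 10 * (2 * en).
  rewrite powRM ?invr_ge0 ?exprn_ge0// ler_pM ?powR_ge0//.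
    by rewrite -[leRHS]powRr1// ler_powR// ?ler1n ?ltW.
  by rewrite yV /powR gt_eqF ?expR_gt0// expRK (le_trans _ ekj)// ler_expR mulrN mulrA.
have eg : expR (- g0 * t) <= en.
  by rewrite ler_expR ler_wpM2r// lerN2 (le_trans nu1).
have eN : (grid j ^ 3)%:R ^+ 2 * expR (- g0 * t) <= c0 * en.
  rewrite gridE -mulrA ler_wpM2l// pow2 -expRM_natr -expRD ler_expR kE.
  apply: absorb; last by rewrite ler_wpM2r.
  have -> : g0 = k * a by rewrite mulrC divfK// gt_eqF.
  by rewrite -mulrA ler_wpM2l// ltW.
have e7 : 7 / 2 ^+ j = 7 * (1 / 2 ^+ j) :> R by rewrite mul1r.
by rewrite e7; exact: collect.
Qed.

End ScaleChoice.

Theorem corollary1p3 (R : realType) (d : nat)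
    (B : 'I_d -> set (R * R)) (gam : 'I_d -> R -> R * R)
    (table : billiard_table B gam) (horizon : finite_horizon B)
    (vDo : R) (hDo : Dolgopyat_constant B gam vDo)
    (kappa : R) (hkappa : 0 < kappa < 1) :
  exists vcorr Ccorr : R,
    [/\ 0 < vcorr < vDo, 0 < Ccorr &
        forall psi f : R * R * R -> R[i],
          holder B kappa psi -> holder B kappa f ->
          forall t : R, 0 <= t ->
            normc (integral_m B (fun Z => psi (flow B gam t Z) * f Z)
                   - integral_m B psi * integral_m B f)
              <= Ccorr * fine (holder_norm B kappa psi)
                 * fine (holder_norm B kappa f) * expR (- vcorr * t)].
Proof.
have /andP[k0 _] := hkappa.
have v0 : 0 < vDo by case: hDo.
have nonneg psi f t (C vc : R) : 0 <= C -> holder B kappa psi -> holder B kappa f ->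
    0 <= C * fine (holder_norm B kappa psi) * fine (holder_norm B kappa f) * expR (- vc * t).
  move=> C0 hpsi hf; have [H1 _ _] := holder_bounds k0 hpsi.
  have [H2 _ _] := holder_bounds k0 hf.
  exact: mulr_ge0 (mulr_ge0 (mulr_ge0 C0 H1) H2) (expR_ge0 _).
have c0 : 0 <= (2 * pi * area B)^-1.
  by rewrite invr_ge0 mulr_ge0 ?mulr_ge0 ?pi_ge0// fine_ge0.
(* If the table has area 0, the normalization is 1 / 0 = 0 and all the integrals vanish. *)
move: c0; rewrite le_eqVlt => /predU1P[cz|c0].
  have Iz h : integral_m B h = 0.
    by apply: complex_eqP; rewrite /= /integral_m_real -cz mul0r.
  exists (vDo / 2), 1; split=> [||psi f hpsi hf t _]; rewrite ?ltr01//.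
    by apply/andP; split; lra.
  by rewrite !Iz mul0r subr0 normc_zero nonneg.
have [K [g0 [K0 g00 g0v H]]] := core_estimate table hDo k0 c0.
have [nu [C [nu0 nug C0 hj]]] := scale_choice hkappa g00.
exists nu, (K * C + 1); split.
- by rewrite nu0 (lt_trans nug).
- by rewrite ltr_wpDl// mulr_ge0.
move=> psi f hpsi hf t t0; have [j jle] := hj t t0.
apply: (le_trans (H psi f hpsi hf t j t0)).
have [H1 _ _] := holder_bounds k0 hpsi; have [H2 _ _] := holder_bounds k0 hf.
set Hp := fine _ in H1 *; set Hf := fine (holder_norm B kappa f) in H2 *.
rewrite -[(K * C + 1) * Hp * Hf]mulrA [leRHS]mulrAC ler_wpM2r ?mulr_ge0//.
apply: (@le_trans _ _ (K * (C * expR (- nu * t)))); first by rewrite ler_wpM2l.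
by rewrite mulrA ler_wpM2r ?expR_ge0// lerDl.
Qed.
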